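(* Suppose that the following statement (P) holds. (P): For every $\epsilon\in\mathbb R$, if $\varphi: M^2 \to N^4(\epsilon)$ is a non-CMC W-surface with flat normal bundle such that $3 f^2 + K - \epsilon \neq 0$ and $\nabla ^\perp E_3 \neq 0$ at any point, then $M$ is not biharmonic. Then the following holds. Let $\varphi : M^2 \to N^4 (\epsilon)$ be a proper biharmonic W-surface with flat normal bundle, and assume that $3 f^2 + K - \epsilon \neq 0$ at any point. Then $\epsilon > 0$, that is, $N^4 (\epsilon)$ is the 4-dimensional sphere $\mathbb S^4 (\epsilon)$ of constant sectional curvature $\epsilon$, and the image $\varphi (M)$ lies minimally in the small hypersphere $\mathbb S^3 (2 \epsilon)$ of constant sectional curvature $2\epsilon$.
   Context: $N^4(\epsilon)$, $\epsilon\in\mathbb R$, is the 4-dimensional space form (complete, simply connected) of constant sectional curvature $\epsilon$. Manifolds are connected and immersions are isometric. For a surface $\varphi:M^2\to N^4(\epsilon)$: $B$ is the second fundamental form, $A_\eta$ the shape operator in the normal direction $\eta$, $\nabla^\perp$ the normal connection, $\Delta^\perp=-\operatorname{trace}(\nabla^\perp\nabla^\perp-\nabla^\perp_\nabla)$, $H=\frac12\operatorname{trace}B$, $f=|H|$, $K$ the Gaussian curvature, and, where $H\ne0$, $E_3=H/f$. Flat normal bundle means the curvature of $\nabla^\perp$ vanishes. The surface is biharmonic (vanishing bitension field) if and only if $2\operatorname{trace}A_{\nabla^\perp_{(\cdot)}H}(\cdot)+\operatorname{grad}|H|^2=0$ and $\Delta^\perp H+\operatorname{trace}B(\cdot,A_H(\cdot))-2\epsilon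 H=0$; proper biharmonic means biharmonic and non-minimal. A W-surface is one for which there is a smooth $W:\mathbb R^2\to\mathbb R$ with nowhere zero gradient such that $W(f,K)=0$ on $M$. ''Non-CMC'' in (P) means $H\neq0$, $\operatorname{grad}f\neq0$ and $A_{E_3}\neq f\,\mathrm{Id}$ at every point. *)

(* Defs.v *)
(* Surfaces in 4-dimensional space forms.

   N^4(eps) is realised by its standard model in R^5 (sphere, affine space or
   hyperboloid); all vectors tangent to N^4(eps) are vectors of R^5, and the
   Levi-Civita connection of N^4(eps) is the tangential part of the derivative
   in R^5.  The metric of an immersed surface is the induced one.  Local
   quantities are written in the coordinates of a chart, for the local
   parametrization X = phi o (chart)^-1 : R^2 -> R^5. *)

From HB Require Import structures.
From mathcomp Require Import all_boot all_order all_algebra.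
From mathcomp Require Import all_classical all_reals all_analysis.
Set Implicit Arguments.
Unset Strict Implicit.
Unset Printing Implicit Defensive.
Import Order.TTheory GRing.Theory Num.Theory.
Import numFieldNormedType.Exports.
Local Open Scope classical_set_scope.
Local Open Scope ring_scope.

Section Calculus.
Variables (R : realType) (V : normedModType R).
Implicit Types (F : 'rV[R]_2 -> V) (U : set 'rV[R]_2).

Definition partial (i : 'I_2) F (u : 'rV[R]_2) : V := 'D_(delta_mx 0 i) F u.

(* C^oo on the (open) set U *)
Definition smooth_on U F : Prop :=
  forall (s : seq 'I_2) u, U u -> differentiable (foldr partial F s) u.

End Calculus.

Section Surfaces.
Variable R : realType.

(* [par] maps the open set [dom] of the plane homeomorphically onto an open
   set of M, with inverse [coord]; both are total functions, constrained only
   on [dom] and on its image. *)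
Record chart (M : Type) := Chart {
  dom : set 'rV[R]_2;
  par : 'rV[R]_2 -> M;
  coord : M -> 'rV[R]_2 }.

Definition is_chart (M : topologicalType) (c : chart M) : Prop :=
  [/\ open (dom c), open (par c @` dom c),
      forall u, dom c u -> coord c (par c u) = u,
      {within dom c, continuous (par c)} &
      {within par c @` dom c, continuous (coord c)}].

Definition smooth_transition (M : Type) (c c' : chart M) : Prop :=
  smooth_on (dom c `&` par c @^-1` (par c' @` dom c')) (coord c' \o par c).

(* connected smooth 2-manifolds *)
Record surface := Surface {
  carrier :> topologicalType;
  atlas : set (chart carrier);
  surface_nonempty : [set: carrier] !=set0;
  surface_connected : connected [set: carrier];
  surface_hausdorff : hausdorff_space carrier;
  surface_second_countable : @second_countable carrier;
  atlas_chart : forall c, atlas c -> is_chart c;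
  atlas_cover : forall p, exists2 c, atlas c & (par c @` dom c) p;
  atlas_smooth : forall c c', atlas c -> atlas c' -> smooth_transition c c' }.

End Surfaces.

Section SpaceForm.
Variable R : realType.
Implicit Types (eps k : R) (x v w a : 'rV[R]_5).

(* Euclidean if eps >= 0, Lorentzian (the first coordinate being timelike) if
   eps < 0 *)
Definition ip eps v w : R :=
  (-1) ^+ (eps < 0)%R * (v 0 0 * w 0 0) +
  \sum_(i < 4) v 0 (lift ord0 i) * w 0 (lift ord0 i).

(* N^4(eps): the sphere <x, x> = 1/eps, the hyperplane x_0 = 0, or the upper
   sheet of the hyperboloid <x, x> = 1/eps *)
Definition spaceform eps : set 'rV[R]_5 :=
  [set x : 'rV[R]_5 | if eps == 0 then x 0 0 = 0
           else eps * ip eps x x = 1 /\ (eps < 0 -> 0 < x 0 0)].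

Definition spaceform_tangent eps x : set 'rV[R]_5 :=
  [set v : 'rV[R]_5 | if eps == 0 then v 0 0 = 0 else ip eps v x = 0].

(* Orthogonal projection onto T_x N^4(eps); for eps = 0 it is only applied to
   vectors of the hyperplane, on which it is the identity. *)
Definition spaceform_proj eps x v := v - (eps * ip eps v x) *: x.

(* R^N(v, w) z *)
Definition spaceform_curv eps v w z : 'rV[R]_5 :=
  eps *: (ip eps w z *: v - ip eps v z *: w).

(* For k > eps > 0: the hypersphere of N^4(eps) of constant curvature k with
   centre a, i.e. the round 3-sphere of radius k^(-1/2) in the affine
   hyperplane through a orthogonal to a. It lies in N^4(eps) as soon as
   <a, a> = 1/eps - 1/k. *)
Definition hypersphere eps k a : set 'rV[R]_5 :=
  [set x : 'rV[R]_5 | ip eps (x - a) a = 0 /\ ip eps (x - a) (x - a) = k^-1].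

(* orthogonal projection onto T_x (hypersphere eps k a) *)
Definition hypersphere_proj eps k a x v : 'rV[R]_5 :=
  v - (k * ip eps v (x - a)) *: (x - a) - (ip eps v a / ip eps a a) *: a.

End SpaceForm.

Section LocalGeometry.
Variables (R : realType) (eps : R).
Implicit Types (X xi : 'rV[R]_2 -> 'rV[R]_5) (u : 'rV[R]_2) (i j k l : 'I_2).
(* P x : orthogonal projection of R^5 onto the tangent space at x of the
   ambient space of the surface *)
Implicit Types (P : 'rV[R]_5 -> 'rV[R]_5 -> 'rV[R]_5).

Local Notation ip := (ip eps).

Definition metric X u : 'M[R]_2 :=
  \matrix_(i, j) ip (partial i X u) (partial j X u).

Definition ginv X u : 'M[R]_2 := invmx (metric X u).

Definition dmetric X l i j u : R :=
  partial (V := R^o) l (fun u' => metric X u' i j) u.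

(* Gamma^k_ij *)
Definition christoffel X k i j u : R :=
  2^-1 * \sum_l ginv X u k l *
    (dmetric X i j l u + dmetric X j i l u - dmetric X l i j u).

(* the coefficient on d_l of R(d_0, d_1) d_1 *)
Definition riemann011 X l u : R :=
  partial (V := R^o) 0 (christoffel X l 1 1) u
  - partial (V := R^o) 1 (christoffel X l 0 1) u
  + \sum_k (christoffel X k 1 1 u * christoffel X l 0 k u
            - christoffel X k 0 1 u * christoffel X l 1 k u).

Definition gauss_curvature X u : R :=
  (\sum_l riemann011 X l u * metric X u l 0) / \det (metric X u).

Definition grad X (h : 'rV[R]_2 -> R) u : 'rV[R]_5 :=
  \sum_i \sum_j (ginv X u i j * partial (V := R^o) j h u) *: partial i X u.

(* covariant derivative, in the ambient space, of a vector field along X *)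
Definition nabla P X i xi u : 'rV[R]_5 := P (X u) (partial i xi u).

(* B(d_i, d_j), by the Gauss formula; also the Hessian (nabla dX)(d_i, d_j) *)
Definition second_ff P X i j u : 'rV[R]_5 :=
  nabla P X i (partial j X) u - \sum_k christoffel X k i j u *: partial k X u.

Definition tension P X u : 'rV[R]_5 :=
  \sum_i \sum_j ginv X u i j *: second_ff P X i j u.

Definition mean_curvature P X u : 'rV[R]_5 := 2^-1 *: tension P X u.

Local Notation PN := (spaceform_proj eps).

Definition mcv X u : 'rV[R]_5 := mean_curvature PN X u.

Definition fmc X u : R := Num.sqrt (ip (mcv X u) (mcv X u)).

Definition E3 X u : 'rV[R]_5 := (fmc X u)^-1 *: mcv X u.

(* trace(nabla nabla - nabla_nabla) tau - trace R^N(dX(.), tau) dX(.) *)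
Definition bitension X u : 'rV[R]_5 :=
  let tau := tension PN X in
  \sum_i \sum_j ginv X u i j *:
    (nabla PN X i (nabla PN X j tau) u
     - \sum_k christoffel X k i j u *: nabla PN X k tau u
     - spaceform_curv eps (partial i X u) (tau u) (partial j X u)).

Definition normal_part X u (v : 'rV[R]_5) : 'rV[R]_5 :=
  v - \sum_i \sum_j (ginv X u i j * ip v (partial j X u)) *: partial i X u.

Definition nabla_perp X i xi u : 'rV[R]_5 := normal_part X u (nabla PN X i xi u).

Definition curv_perp X xi u : 'rV[R]_5 :=
  nabla_perp X 0 (nabla_perp X 1 xi) u - nabla_perp X 1 (nabla_perp X 0 xi) u.

(* smooth section over U of the normal bundle of X in N^4(eps) *)
Definition normal_field (U : set 'rV[R]_2) X xi : Prop :=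
  smooth_on U xi /\ forall u, U u ->
    spaceform_tangent eps (X u) (xi u) /\
    forall i, ip (xi u) (partial i X u) = 0.

Definition flat_normal_at X u : Prop :=
  forall U xi, open U -> U u -> normal_field U X xi -> curv_perp X xi u = 0.

(* matrix of A_eta: A_eta(d_j) = sum_i (shape X eta u i j) d_i *)
Definition shape X (eta : 'rV[R]_5) u : 'M[R]_2 :=
  ginv X u *m \matrix_(i, j) ip (second_ff PN X i j u) eta.

End LocalGeometry.

Section GlobalNotions.
Variables (R : realType) (eps : R) (M : surface R) (phi : M -> 'rV[R]_5).

(* Q (u) for the local expression of phi at every point of every chart; used
   for pointwise conditions that do not depend on the choice of the chart *)
Definition everywhere (Q : ('rV[R]_2 -> 'rV[R]_5) -> 'rV[R]_2 -> Prop) : Prop :=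
  forall c, atlas c -> forall u, dom c u -> Q (phi \o par c) u.

Definition immersion : Prop :=
  [/\ forall p, spaceform eps (phi p),
      forall c, atlas c -> smooth_on (dom c) (phi \o par c) &
      everywhere (fun X u => row_free (\matrix_(i < 2) partial i X u))].

Definition biharmonic : Prop := everywhere (fun X u => bitension eps X u = 0).

Definition minimal : Prop := everywhere (fun X u => mcv eps X u = 0).

Definition proper_biharmonic : Prop := biharmonic /\ ~ minimal.

Definition flat_normal_bundle : Prop := everywhere (flat_normal_at eps).

Definition W_surface : Prop :=
  exists W : 'rV[R]_2 -> R^o,
    [/\ smooth_on setT W,
        forall z, exists i, partial i W z != 0 &
        everywhere (fun X u =>
          W (row_mx (fmc eps X u)%:M (gauss_curvature eps X u)%:M) = 0)].

Definition non_CMC : Prop :=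
  everywhere (fun X u => [/\ mcv eps X u != 0,
    grad eps X (fmc eps X) u != 0 &
    shape eps X (E3 eps X u) u != (fmc eps X u)%:M]).

Definition curvature_condition : Prop :=
  everywhere (fun X u =>
    3 * fmc eps X u ^+ 2 + gauss_curvature eps X u - eps != 0).

(* nabla^perp E_3 <> 0 at every point *)
Definition E3_nowhere_parallel : Prop :=
  everywhere (fun X u => exists i, nabla_perp eps X i (E3 eps X) u != 0).

Definition minimal_in_hypersphere (k : R) (a : 'rV[R]_5) : Prop :=
  (forall p, hypersphere eps k a (phi p)) /\
  everywhere (fun X u =>
    mean_curvature eps (hypersphere_proj eps k a) X u = 0).

End GlobalNotions.

Definition statement_P (R : realType) : Prop :=
  forall (eps : R) (M : surface R) (phi : M -> 'rV[R]_5),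
    immersion eps phi -> non_CMC eps phi -> W_surface eps phi ->
    flat_normal_bundle eps phi -> curvature_condition eps phi ->
    E3_nowhere_parallel eps phi -> ~ biharmonic eps phi.

(* Main.v *)
From HB Require Import structures.
Require Import Defs.
From mathcomp Require Import all_boot all_order all_algebra.
From mathcomp Require Import all_classical all_reals all_analysis.
From mathcomp Require Import ring lra.

(** Write [X] for the surface in a chart, [H] for its mean curvature vector, [f = |H|], [E3 = H/f]
where [H] does not vanish, [h = <B, E3>] for the second fundamental form in the direction of
[E3], and [g] for the metric.

The gradient of [f] vanishes wherever [H] does not ([mean_norm_critical]). Assume the contrary on
an open set. If [h = f g] on it, the Codazzi equation in the direction of [E3] and the tangential
part of the biharmonic equation force [df = 0] ([umbilical_const]); so the set can be shrunk
until [h <> f g] everywhere. If [E3] were parallel there, the tangential equation would say that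
[grad f] is an eigenvector of the shape operator with eigenvalue [- f], whence
[det h = - 3 f^2 det g]; the normal equation and the symmetry of the second derivatives of [E3]
give [B = h E3], and the Gauss equation then gives [3 f^2 + K - eps = 0], which is excluded
([par_curvature]). So the set can be shrunk to a ball on which [E3] is nowhere parallel. This ball
is itself a surface that has all the properties required by (P) ([generic_not_biharmonic]), a
contradiction. Hence [f] is locally constant where it is positive, and by connectedness it is a
positive constant ([mean_norm_constant]).

For constant [f > 0] the component of the biharmonic equation along [E3] reads
[|dE3|^2 = 2 eps] ([energy]), so [eps >= 0], and [eps = 0] would make [h] vanish. Two cases are
then excluded by one lemma ([codazzi_flat]): if [B = h E3] and [det h = c det g] with a constant
[c <> f^2], then [h - f g] is a Codazzi tensor of constant trace and constant nonzero norm, hence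
parallel, hence the surface is flat, hence [eps + c = 0] by the Gauss equation. If [E3] is not
parallel at some point, the tangential equation gives [B = h E3] near it and the Codazzi equation
gives [det h = 0], so [c = 0] ([cmc_parallel]). If [E3] is parallel and [h <> f g] somewhere, then
[c = 2 f^2 - eps] ([cmc_umbilical]). Neither satisfies [eps + c = 0].

What remains is [h = f g] with [E3] parallel; then [f^2 = eps] and [dH = - eps dX], so
[(H + eps X) / (2 eps)] is locally constant, hence one point [a] for the whole surface
([center_locally_constant]). The surface lies at constant distance from [a] in the affine
hyperplane through [a] orthogonal to [a], and its second fundamental form in that small sphere is
[B - g H] ([hypersphere_second_ff]), which is trace free. *)

Set Implicit Arguments.
Unset Strict Implicit.
Unset Printing Implicit Defensive.
Import Order.TTheory GRing.Theory Num.Theory.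
Import numFieldNormedType.Exports.
Local Open Scope classical_set_scope.
Local Open Scope ring_scope.

(** * Partial derivatives *)

(** Locked copies of [partial] and [ip]: matching up to conversion would otherwise unfold
    directional derivatives into limits. *)
HB.lock Definition pt (R : realType) (V : normedModType R) (i : 'I_2)
  (F : 'rV[R]_2 -> V) (u : 'rV[R]_2) : V := partial i F u.
HB.lock Definition dot (R : realType) (eps : R) (v w : 'rV[R]_5) : R := ip eps v w.

Lemma ptE (R : realType) (V : normedModType R) i (F : 'rV[R]_2 -> V) u :
  partial i F u = pt i F u.
Proof. by rewrite pt.unlock. Qed.

Lemma ptfE (R : realType) (V : normedModType R) i (F : 'rV[R]_2 -> V) :
  partial i F = pt i F.
Proof. by apply/funext => u; rewrite ptE. Qed.

Lemma dotE (R : realType) (eps : R) v w : ip eps v w = dot eps v w.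
Proof. by rewrite dot.unlock. Qed.

(** The case of a real function, kept apart so that its values are in [R] and not in [R^o]. *)
HB.lock Definition sd (R : realType) (i : 'I_2) (F : 'rV[R]_2 -> R) (u : 'rV[R]_2) : R :=
  partial (V := R^o) i F u.

Lemma sdE (R : realType) i (F : 'rV[R]_2 -> R) u : partial (V := R^o) i F u = sd i F u.
Proof. by rewrite sd.unlock. Qed.

Lemma ptsdE (R : realType) i (F : 'rV[R]_2 -> R) u : pt (V := R^o) i F u = sd i F u.
Proof. by rewrite -ptE sdE. Qed.

Section HasPartial.
Variable R : realType.

(** Differentiability is a property of germs: the expansion of order one at [u] only involves
    the values near [u]. *)
Lemma near_eq_differentiable (V W : normedModType R) (F G : V -> W) (u : V) :
  {near u, F =1 G} -> differentiable F u -> differentiable G u.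
Proof.
move=> FG dF; have FGu : F u = G u by apply: nbhs_singleton FG.
have E : G \o shift u = cst (G u) + 'd F u +o_ 0 id.
  apply/eqaddoP => e e0; have /eqaddoP/(_ e e0) := diff_locally dF.
  have : \forall h \near 0, F (h + u) = G (h + u).
    have := FG; rewrite [X in X -> _](near_shift 0 u) /=.
    by apply: filterS => h /=; rewrite subr0.
  by apply: filterS2 => h /= FGh; rewrite /= !fctE /= FGh FGu.
have dc : continuous ('d F u) by exact: diff_continuous.
by apply/diff_locallyP; rewrite (diff_unique dc E).
Qed.

(** Differentiability is part of the predicate, so that the rules of differentiation need no
    side conditions. *)
Definition has_partial (V : normedModType R) (i : 'I_2) (F : 'rV[R]_2 -> V)
    (u : 'rV[R]_2) (d : V) :=
  differentiable F u /\ pt i F u = d.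

Lemma near_has_partial (V : normedModType R) i (F G : 'rV[R]_2 -> V) u d :
  {near u, F =1 G} -> has_partial i F u d -> has_partial i G u d.
Proof.
move=> FG [dF <-]; split; first exact: near_eq_differentiable FG dF.
by rewrite -!ptE; apply/esym/near_eq_derive.
Qed.

Lemma has_partial_diff (V : normedModType R) i (F : 'rV[R]_2 -> V) u :
  differentiable F u -> has_partial i F u (pt i F u).
Proof. by []. Qed.

Lemma has_partial_eq (V : normedModType R) i (F : 'rV[R]_2 -> V) u d d' :
  has_partial i F u d -> d = d' -> has_partial i F u d'.
Proof. by move=> ? <-. Qed.

Lemma has_partialE (V : normedModType R) i (F : 'rV[R]_2 -> V) u d :
  has_partial i F u d -> pt i F u = d.
Proof. by case. Qed.

Lemma eq_has_partial (V : normedModType R) i (F G : 'rV[R]_2 -> V) u d :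
  F =1 G -> has_partial i F u d -> has_partial i G u d.
Proof. by move=> /funext ->. Qed.

Lemma has_partial_cst (V : normedModType R) i (c : V) u :
  has_partial i (fun=> c) u 0.
Proof. by split; [exact: differentiable_cst | rewrite -!ptE; exact: derive_cst]. Qed.

Lemma has_partialD (V : normedModType R) i (F G : 'rV[R]_2 -> V) u d e :
  has_partial i F u d -> has_partial i G u e ->
  has_partial i (fun x => F x + G x) u (d + e).
Proof.
move=> [dF <-] [dG <-]; split; first exact: differentiableD.
by rewrite -!ptE /partial -deriveD//; exact: diff_derivable.
Qed.

Lemma has_partialN (V : normedModType R) i (F : 'rV[R]_2 -> V) u d :
  has_partial i F u d -> has_partial i (fun x => - F x) u (- d).
Proof.
move=> [dF <-]; split; first exact: differentiableN.
by rewrite -!ptE /partial -deriveN//; exact: diff_derivable.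
Qed.

Lemma has_partialB (V : normedModType R) i (F G : 'rV[R]_2 -> V) u d e :
  has_partial i F u d -> has_partial i G u e ->
  has_partial i (fun x => F x - G x) u (d - e).
Proof. by move=> /has_partialD D /has_partialN; exact: D. Qed.

Lemma has_partialM i (F G : 'rV[R]_2 -> R) u d e :
  has_partial (V := R^o) i F u d -> has_partial (V := R^o) i G u e ->
  has_partial (V := R^o) i (fun x => F x * G x) u (d * G u + F u * e).
Proof.
move=> [dF <-] [dG <-]; split; first exact: differentiableM.
rewrite -!ptE /partial [LHS](deriveM (f := F) (g := G)); [|exact: diff_derivable..].
by rewrite addrC /GRing.scale /= [G u * _]mulrC.
Qed.

Lemma has_partialV i (F : 'rV[R]_2 -> R) u d : F u != 0 ->
  has_partial (V := R^o) i F u d ->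
  has_partial (V := R^o) i (fun x => (F x)^-1) u (- d * (F u)^-1 * (F u)^-1).
Proof.
move=> Fu [dF <-]; split; first exact: differentiableV.
rewrite -!ptE /partial [LHS](deriveV (f := F)) //; last exact: diff_derivable.
by rewrite /GRing.scale /= -exprVn expr2; ring.
Qed.

Lemma has_partial_sum (V : normedModType R) i n (F : 'I_n -> 'rV[R]_2 -> V) u d :
  (forall k, has_partial i (F k) u (d k)) ->
  has_partial i (fun x => \sum_k F k x) u (\sum_k d k).
Proof.
elim: n F d => [|n IH] F d H.
  rewrite big_ord0; apply: eq_has_partial (has_partial_cst _ _ _).
  by move=> x; rewrite big_ord0.
rewrite big_ord_recr /=; apply: (eq_has_partial (F := fun x =>
   \sum_(k < n) F (widen_ord (leqnSn n) k) x + F ord_max x)).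
  by move=> x; rewrite big_ord_recr.
by apply: has_partialD => //; exact: IH.
Qed.

(** A row vector is the sum of its coordinates times the basis vectors. *)
Lemma differentiable_coordP n (F : 'rV[R]_2 -> 'rV[R]_n.+1) u :
  differentiable F u <-> forall j, differentiable (fun x => F x 0 j : R^o) u.
Proof.
split=> [dF j|dF].
  exact: (differentiable_comp (g := fun v : 'rV[R]_n.+1 => v 0 j : R^o) dF
    (differentiable_coord _ _ _)).
have -> : F = fun x => \sum_j F x 0 j *: (delta_mx 0 j : 'rV[R]_n.+1).
  by apply/funext => x; rewrite [LHS]row_sum_delta.
have -> : (fun x => \sum_j F x 0 j *: (delta_mx 0 j : 'rV[R]_n.+1)) =
   \sum_j (fun x => F x 0 j *: (delta_mx 0 j : 'rV[R]_n.+1)).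
  by apply/funext => x; rewrite fct_sumE.
by apply: differentiable_sum => j; exact: differentiableZl.
Qed.

Lemma has_partial_coordP n i (F : 'rV[R]_2 -> 'rV[R]_n.+1) u d :
  has_partial i F u d <-> forall j, has_partial (V := R^o) i (fun x => F x 0 j) u (d 0 j).
Proof.
have E : differentiable F u -> forall j,
    (pt i F u) 0 j = pt (V := R^o) i (fun x => F x 0 j) u.
  by move=> dF j; rewrite -!ptE /partial derive_mx ?mxE//; exact: diff_derivable.
split=> [[dF <-] j|H].
  by split; [exact: (differentiable_coordP F u).1 | rewrite E].
have dF : differentiable F u by apply/differentiable_coordP => j; case: (H j).
by split => //; apply/rowP => j; rewrite E//; case: (H j).
Qed.

Lemma has_partialZ n i (a : 'rV[R]_2 -> R) (F : 'rV[R]_2 -> 'rV[R]_n.+1) u a' d :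
  has_partial (V := R^o) i a u a' -> has_partial i F u d ->
  has_partial i (fun x => a x *: F x) u (a' *: F u + a u *: d).
Proof.
move=> Ha /has_partial_coordP HF; apply/has_partial_coordP => j.
have := has_partialM Ha (HF j); rewrite !mxE; apply: eq_has_partial.
by move=> x; rewrite mxE.
Qed.

Lemma has_partial_comp (V : normedModType R) i (t : 'rV[R]_2 -> 'rV[R]_2)
    (F : 'rV[R]_2 -> V) u d :
  has_partial i t u d -> differentiable F (t u) ->
  has_partial i (F \o t) u (\sum_a d 0 a *: pt a F (t u)).
Proof.
move=> [dt td] dF; split; first exact: differentiable_comp.
rewrite -!ptE /partial deriveE; last exact: differentiable_comp.
rewrite diff_comp//= -(deriveE _ dt) -[X in 'd F _ X]/(partial i t u) ptE td {1}[d]row_sum_delta.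
rewrite linear_sum; apply: eq_bigr => a _.
by rewrite linearZ /= -ptE /partial deriveE.
Qed.

Lemma has_partial_sqrt i (F : 'rV[R]_2 -> R) u d : 0 < F u ->
  has_partial (V := R^o) i F u d ->
  has_partial (V := R^o) i (fun x => Num.sqrt (F x)) u (2^-1 * d * (Num.sqrt (F u))^-1).
Proof.
move=> F0 [dF <-].
have [ds sE] := is_derive1_sqrt F0.
have ds' : differentiable (Num.sqrt : R -> R) (F u) by apply/derivable1_diffP.
split; first exact: (differentiable_comp (f := F) dF ds').
rewrite -!ptE /partial deriveE; last exact: (differentiable_comp (f := F) dF ds').
rewrite (diff_comp (f := F) dF ds') /= -(deriveE _ dF).
rewrite -[X in 'd _ _ X]mulr1 [LHS]linearZ /= -deriveE // sE /GRing.scale /=.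
by rewrite invfM; ring.
Qed.

End HasPartial.

(** * Smooth functions *)

Section Smooth.
Variable R : realType.
Implicit Types (U : set 'rV[R]_2).

(** Differentiability of all derivatives of order at most [n]. Unlike [smooth_on], which
    quantifies over all iterated derivatives, it lends itself to induction on the order: a
    product rule for order [n.+1] needs the one for order [n]. *)
Fixpoint Ck (V : normedModType R) n U (F : 'rV[R]_2 -> V) : Prop :=
  if n is n'.+1 then
    (forall u, U u -> differentiable F u) /\ forall i, Ck n' U (pt i F)
  else forall u, U u -> differentiable F u.

Lemma smooth_onP (V : normedModType R) U (F : 'rV[R]_2 -> V) :
  smooth_on U F <-> forall n, Ck n U F.
Proof.
split=> [sF n|sF s].
  elim: n F sF => [|n IH] F sF; first by move=> u; exact: (sF [::]).
  split=> [u|i]; first exact: (sF [::]).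
  by apply: IH => s u Uu; have := sF (rcons s i) u Uu; rewrite foldr_rcons ptfE.
elim/last_ind: s F sF => [|s i IH] F sF u Uu; first exact: (sF 0).
rewrite foldr_rcons ptfE; apply: (IH (pt i F)) => // n.
by have [_] := sF n.+1; exact.
Qed.

Lemma CkS (V : normedModType R) n U (F : 'rV[R]_2 -> V) :
  Ck n.+1 U F -> Ck n U F.
Proof.
elim: n F => [|n IH] F; first by case.
by move=> [dF H]; split => // i; apply: IH; exact: H.
Qed.

Lemma open_near U (P : 'rV[R]_2 -> Prop) u :
  open U -> U u -> (forall x, U x -> P x) -> \near u, P u.
Proof. by move=> oU Uu H; apply: filterS H _; exact: open_nbhs_nbhs. Qed.

Lemma Ck_eq (V : normedModType R) n U (F G : 'rV[R]_2 -> V) : open U ->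
  (forall u, U u -> F u = G u) -> Ck n U F -> Ck n U G.
Proof.
move=> oU; elim: n F G => [|n IH] F G FG.
  move=> dF u Uu; apply: near_eq_differentiable (dF u Uu).
  exact: open_near FG.
move=> [dF H]; split => [u Uu|i].
  by apply: near_eq_differentiable (dF u Uu); exact: open_near FG.
apply: IH (H i) => u Uu; rewrite -!ptE; apply: near_eq_derive; exact: open_near FG.
Qed.

Lemma Ck_sub (V : normedModType R) n U U' (F : 'rV[R]_2 -> V) :
  U' `<=` U -> Ck n U F -> Ck n U' F.
Proof.
move=> UU; elim: n F => [|n IH] F /=; first by move=> H u /UU; exact: H.
by move=> [dF H]; split=> [u /UU|i]; [exact: dF | exact: IH].
Qed.

Lemma Ck_cst (V : normedModType R) n U (c : V) : Ck n U (fun=> c).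
Proof.
elim: n c => [|n IH] c; first by move=> u _; exact: differentiable_cst.
split=> [u _|i]; first exact: differentiable_cst.
rewrite (_ : pt i _ = fun=> 0); first exact: IH.
by apply/funext => u; apply: has_partialE; exact: has_partial_cst.
Qed.

Lemma CkD (V : normedModType R) n U (F G : 'rV[R]_2 -> V) : open U ->
  Ck n U F -> Ck n U G -> Ck n U (fun x => F x + G x).
Proof.
move=> oU; elim: n F G => [|n IH] F G CF CG.
  by move=> u Uu; apply: differentiableD; [exact: CF | exact: CG].
case: (CF) (CG) => dF pF [dG pG]; split=> [u Uu|i].
  by apply: differentiableD; [exact: dF | exact: dG].
apply: Ck_eq (IH _ _ (pF i) (pG i)) => // u Uu.
by apply/esym/has_partialE/has_partialD; split=> //; [exact: dF | exact: dG].
Qed.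

Lemma CkM n U (F G : 'rV[R]_2 -> R) : open U ->
  Ck (V := R^o) n U F -> Ck (V := R^o) n U G ->
  Ck (V := R^o) n U (fun x => F x * G x).
Proof.
move=> oU; elim: n F G => [|n IH] F G CF CG.
  by move=> u Uu; apply: differentiableM; [exact: CF | exact: CG].
case: (CF) (CG) => dF pF [dG pG]; split=> [u Uu|i].
  by apply: differentiableM; [exact: dF | exact: dG].
apply: Ck_eq (CkD oU (IH _ _ (pF i) (CkS CG)) (IH _ _ (CkS CF) (pG i))) => // u Uu.
by apply/esym/has_partialE/has_partialM; split=> //; [exact: dF | exact: dG].
Qed.

Lemma CkN (V : normedModType R) n U (F : 'rV[R]_2 -> V) : open U ->
  Ck n U F -> Ck n U (fun x => - F x).
Proof.
move=> oU; elim: n F => [|n IH] F CF.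
  by move=> u Uu; apply: differentiableN; exact: CF.
case: (CF) => dF pF; split=> [u Uu|i]; first by apply: differentiableN; exact: dF.
apply: Ck_eq (IH _ (pF i)) => // u Uu.
by apply/esym/has_partialE/has_partialN; split=> //; exact: dF.
Qed.

Lemma CkV n U (F : 'rV[R]_2 -> R) : open U -> (forall u, U u -> F u != 0) ->
  Ck (V := R^o) n U F -> Ck (V := R^o) n U (fun x => (F x)^-1).
Proof.
move=> oU F0; elim: n => [|n IH] CF.
  by move=> u Uu; apply: differentiableV; [exact: CF | exact: F0].
case: (CF) => dF pF; split=> [u Uu|i].
  by apply: differentiableV; [exact: dF | exact: F0].
have I := IH (CkS CF).
apply: Ck_eq (CkM oU (CkM oU (CkN oU (pF i)) I) I) => // u Uu.
apply/esym/has_partialE/has_partialV; first exact: F0.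
by split=> //; exact: dF.
Qed.

(** The derivative of the root of [F] is a product of the derivative of [F] and of the inverse
    of the same root, so the induction closes. *)
Lemma Ck_sqrt n U (F : 'rV[R]_2 -> R) : open U -> (forall u, U u -> 0 < F u) ->
  Ck (V := R^o) n U F -> Ck (V := R^o) n U (fun x => Num.sqrt (F x)).
Proof.
move=> oU F0; elim: n => [|n IH] CF.
  move=> u Uu; have D := has_partial_diff (V := R^o) 0 (CF u Uu).
  by case: (has_partial_sqrt (F0 _ Uu) D).
case: (CF) => dF pF; split=> [u Uu|i].
  have D := has_partial_diff (V := R^o) 0 (dF u Uu).
  by case: (has_partial_sqrt (F0 _ Uu) D).
have I := IH (CkS CF).
have I' : Ck (V := R^o) n U (fun x => (Num.sqrt (F x))^-1).
  by apply: CkV => // u Uu; rewrite gt_eqF// sqrtr_gt0 F0.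
apply: Ck_eq (CkM oU (CkM oU (Ck_cst _ _ (2^-1 : R^o)) (pF i)) I') => // u Uu.
apply/esym/has_partialE/has_partial_sqrt; first exact: F0.
by split=> //; exact: dF.
Qed.

Lemma Ck_coordP m n U (F : 'rV[R]_2 -> 'rV[R]_m.+1) : open U ->
  Ck n U F <-> forall j, Ck (V := R^o) n U (fun x => F x 0 j).
Proof.
move=> oU; elim: n F => [|n IH] F.
  split=> [dF j u Uu|dF u Uu]; first exact: (differentiable_coordP F u).1 (dF u Uu) j.
  by apply/differentiable_coordP => j; exact: dF.
have E j i u : differentiable F u ->
    pt i F u 0 j = pt (V := R^o) i (fun x => F x 0 j) u.
  by move=> dF; have [_ <-] := (has_partial_coordP _ _ _ _).1 (has_partial_diff i dF) j.
split=> [[dF pF] j|H].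
  split=> [u Uu|i]; first exact: (differentiable_coordP F u).1 (dF u Uu) j.
  apply: (Ck_eq (F := fun x => pt i F x 0 j)) => //.
    by move=> u Uu; apply: E; exact: dF.
  by have := (IH _).1 (pF i) j.
have dF u : U u -> differentiable F u.
  by move=> Uu; apply/differentiable_coordP => j; case: (H j) => + _; exact.
split=> // i; apply/IH => j; case: (H j) => _ /(_ i).
by apply: Ck_eq => // u Uu; rewrite E//; exact: dF.
Qed.

Section Closure.
Variables (U : set 'rV[R]_2) (oU : open U).

Lemma smooth_diff (V : normedModType R) (F : 'rV[R]_2 -> V) u :
  smooth_on U F -> U u -> differentiable F u.
Proof. by move=> sF; exact: (sF [::]). Qed.

Lemma smooth_has_partial (V : normedModType R) i (F : 'rV[R]_2 -> V) u :
  smooth_on U F -> U u -> has_partial i F u (pt i F u).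
Proof. by move=> sF Uu; split => //; exact: smooth_diff Uu. Qed.

Lemma smooth_partial (V : normedModType R) i (F : 'rV[R]_2 -> V) :
  smooth_on U F -> smooth_on U (pt i F).
Proof. by move=> /smooth_onP H; apply/smooth_onP => n; have [_] := H n.+1; exact. Qed.

Lemma smooth_has_sd i (F : 'rV[R]_2 -> R) u :
  smooth_on (V := R^o) U F -> U u -> has_partial (V := R^o) i F u (sd i F u).
Proof. by move=> sF Uu; split; [exact: smooth_diff Uu | exact: ptsdE]. Qed.

Lemma smooth_sd i (F : 'rV[R]_2 -> R) :
  smooth_on (V := R^o) U F -> smooth_on (V := R^o) U (sd i F).
Proof.
move=> sF; have -> : sd i F = pt (V := R^o) i F by apply/funext => u; rewrite ptsdE.
exact: smooth_partial.
Qed.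

Lemma smooth_cvg (V : normedModType R) (F : 'rV[R]_2 -> V) u :
  smooth_on U F -> U u -> {for u, continuous F}.
Proof.
by move=> sF Uu; apply: differentiable_continuous; exact: smooth_diff Uu.
Qed.

Lemma smooth_eq (V : normedModType R) (F G : 'rV[R]_2 -> V) :
  (forall u, U u -> F u = G u) -> smooth_on U F -> smooth_on U G.
Proof. by move=> FG /smooth_onP H; apply/smooth_onP => n; exact: Ck_eq (H n). Qed.

Lemma smooth_sub (V : normedModType R) U' (F : 'rV[R]_2 -> V) :
  U' `<=` U -> smooth_on U F -> smooth_on U' F.
Proof. by move=> UU /smooth_onP H; apply/smooth_onP => n; exact: Ck_sub (H n). Qed.

Lemma smooth_cst (V : normedModType R) (c : V) : smooth_on U (fun=> c).
Proof. by apply/smooth_onP => n; exact: Ck_cst. Qed.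

Lemma smoothD (V : normedModType R) (F G : 'rV[R]_2 -> V) :
  smooth_on U F -> smooth_on U G -> smooth_on U (fun x => F x + G x).
Proof. by move=> /smooth_onP ? /smooth_onP ?; apply/smooth_onP => n; exact: CkD. Qed.

Lemma smoothN (V : normedModType R) (F : 'rV[R]_2 -> V) :
  smooth_on U F -> smooth_on U (fun x => - F x).
Proof. by move=> /smooth_onP ?; apply/smooth_onP => n; exact: CkN. Qed.

Lemma smoothB (V : normedModType R) (F G : 'rV[R]_2 -> V) :
  smooth_on U F -> smooth_on U G -> smooth_on U (fun x => F x - G x).
Proof. by move=> sF /smoothN; exact: smoothD. Qed.

Lemma smoothM (F G : 'rV[R]_2 -> R) :
  smooth_on (V := R^o) U F -> smooth_on (V := R^o) U G ->
  smooth_on (V := R^o) U (fun x => F x * G x).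
Proof. by move=> /smooth_onP ? /smooth_onP ?; apply/smooth_onP => n; exact: CkM. Qed.

Lemma smoothV (F : 'rV[R]_2 -> R) : (forall u, U u -> F u != 0) ->
  smooth_on (V := R^o) U F -> smooth_on (V := R^o) U (fun x => (F x)^-1).
Proof. by move=> ? /smooth_onP ?; apply/smooth_onP => n; exact: CkV. Qed.

Lemma smooth_sqrt (F : 'rV[R]_2 -> R) : (forall u, U u -> 0 < F u) ->
  smooth_on (V := R^o) U F -> smooth_on (V := R^o) U (fun x => Num.sqrt (F x)).
Proof. by move=> ? /smooth_onP ?; apply/smooth_onP => n; exact: Ck_sqrt. Qed.

Lemma smooth_coordP m (F : 'rV[R]_2 -> 'rV[R]_m.+1) :
  smooth_on U F <-> forall j, smooth_on (V := R^o) U (fun x => F x 0 j).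
Proof.
split=> [/smooth_onP H j|H]; apply/smooth_onP => n.
  exact: (Ck_coordP _ _ oU).1.
by apply/Ck_coordP => // j; have /smooth_onP := H j; exact.
Qed.

Lemma smooth_sum (V : normedModType R) n (F : 'I_n -> 'rV[R]_2 -> V) :
  (forall k, smooth_on U (F k)) -> smooth_on U (fun x => \sum_k F k x).
Proof.
elim: n F => [|n IH] F H.
  apply: smooth_eq (smooth_cst 0) => u _; by rewrite big_ord0.
apply: smooth_eq (smoothD (IH _ (fun k => H (widen_ord (leqnSn n) k))) (H ord_max)).
by move=> u _; rewrite big_ord_recr.
Qed.

Lemma smoothZ m (a : 'rV[R]_2 -> R) (F : 'rV[R]_2 -> 'rV[R]_m.+1) :
  smooth_on (V := R^o) U a -> smooth_on U F -> smooth_on U (fun x => a x *: F x).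
Proof.
move=> sa /smooth_coordP sF; apply/smooth_coordP => j.
by apply: smooth_eq (smoothM sa (sF j)) => u _; rewrite mxE.
Qed.

End Closure.

End Smooth.

(** * Mean value theorem and symmetry of second derivatives *)

Section MeanValue.
Variable R : realType.

Lemma is_derive_line (F : 'rV[R]_2 -> R) (w v : 'rV[R]_2) (s : R) :
  differentiable (F : _ -> R^o) (w + s *: v) ->
  is_derive s 1 (fun t : R => F (w + t *: v) : R^o)
    ('D_v (F : _ -> R^o) (w + s *: v)).
Proof.
move=> dF.
have dl : differentiable (fun t : R^o => w + t *: v) s.
  by apply: differentiableD => //; exact: differentiable_cst.
have dc : differentiable (fun t : R => F (w + t *: v) : R^o) s.
  exact: (differentiable_comp (g := F : _ -> R^o) dl dF).
apply: DeriveDef; first exact: diff_derivable.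
rewrite !deriveE//; rewrite (diff_comp (g := F : _ -> R^o) dl dF) /=.
congr ('d _ _ _); rewrite -(deriveE _ dl).
have dv : is_diff s ( *:%R^~ v : R^o -> 'rV[R]_2) ( *:%R^~ v) by exact: is_diff_scalel.
have dv1 := @ex_diff _ _ _ _ _ _ _ dv.
have dvE := @diff_val _ _ _ _ _ _ _ dv.
rewrite [LHS](@deriveD _ _ _ (cst w) ( *:%R^~ v : R^o -> 'rV[R]_2)); last 2 first.
- exact: derivable_cst.
- exact: diff_derivable.
rewrite [X in X + _]derive_cst add0r deriveE//.
by have := congr1 (fun g => g 1) dvE => /= ->; rewrite scale1r.
Qed.

Lemma MVT_line (F : 'rV[R]_2 -> R) (w v : 'rV[R]_2) (h : R) : 0 < h ->
  (forall s, 0 <= s <= h -> differentiable (F : _ -> R^o) (w + s *: v)) ->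
  exists2 s, 0 < s < h &
    F (w + h *: v) - F w = h * 'D_v (F : _ -> R^o) (w + s *: v).
Proof.
move=> h0 dF.
have := @MVT R (fun t => F (w + t *: v)) (fun s => 'D_v (F : _ -> R^o) (w + s *: v)) 0 h h0.
case=> [s|s|s].
- rewrite in_itv /= => /andP[s0 sh]; apply: is_derive_line; apply: dF.
  by rewrite !ltW.
- apply: derivable_within_continuous => {}s; rewrite in_itv /= => sh.
  have [+ _] := is_derive_line (dF _ sh); exact.
- rewrite in_itv /= => sh; rewrite scale0r addr0 subr0 => ->.
  by exists s => //; rewrite mulrC.
Qed.

Lemma norm_delta_le (i : 'I_2) (s : R) : `|s *: (delta_mx 0 i : 'rV[R]_2)| <= `|s|.
Proof.
rewrite normrZ -[leRHS]mulr1 ler_wpM2l//.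
rewrite [leLHS]mx_normrE; apply: bigmax_le => // -[a b] _ /=.
by rewrite mxE; case: (_ && _); rewrite ?normr1 ?normr0.
Qed.

Lemma has_partial_id (k : 'I_2) (u : 'rV[R]_2) :
  has_partial k (fun w : 'rV[R]_2 => w) u (delta_mx 0 k).
Proof.
split; last by rewrite -ptE /partial derive_id.
by have := @ex_diff _ _ _ _ _ _ _ (is_diff_id u).
Qed.

(** The mean value theorem, once in the direction [i] for the difference of [F] in the direction
    [j], then in the direction [j]: the second difference is a mixed derivative at a nearby
    point. *)
Lemma double_difference (F : 'rV[R]_2 -> R) (u : 'rV[R]_2) (i j : 'I_2) (h : R)
    (U : set 'rV[R]_2) : 0 < h ->
  (forall p, `|p - u| <= 2 * h -> U p) -> smooth_on (V := R^o) U F ->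
  exists2 p, `|p - u| <= 2 * h &
    F (u + h *: delta_mx 0 i + h *: delta_mx 0 j) - F (u + h *: delta_mx 0 i)
    - F (u + h *: delta_mx 0 j) + F u
    = h * (h * pt (V := R^o) j (pt (V := R^o) i F) p).
Proof.
move=> h0 HU sF.
have near_u s t : 0 <= s <= h -> 0 <= t <= h ->
    `|u + s *: delta_mx 0 i + t *: delta_mx 0 j - u| <= 2 * h.
  move=> /andP[s0 sh] /andP[t0 th].
  have -> : u + s *: delta_mx 0 i + t *: delta_mx 0 j - u =
     s *: delta_mx 0 i + t *: delta_mx 0 j :> 'rV[R]_2 by rewrite addrC !addrA addNr add0r.
  rewrite (le_trans (ler_normD _ _))// mulr_natl mulr2n lerD//.
    by rewrite (le_trans (norm_delta_le _ _))// ger0_norm.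
  by rewrite (le_trans (norm_delta_le _ _))// ger0_norm.
have zz : (0 : R) <= 0 <= h by rewrite lexx (ltW h0).
pose G w := F (w + h *: delta_mx 0 j) - F w.
have hG s k : 0 <= s <= h -> has_partial (V := R^o) k G (u + s *: delta_mx 0 i)
    (pt (V := R^o) k F (u + s *: delta_mx 0 i + h *: delta_mx 0 j)
     - pt (V := R^o) k F (u + s *: delta_mx 0 i)).
  move=> sh; apply: has_partialB.
    have U1 : U (u + s *: delta_mx 0 i + h *: delta_mx 0 j).
      by apply: HU; apply: near_u => //; rewrite lexx ltW.
    have dF := smooth_diff sF U1.
    have dl : has_partial k (fun w : 'rV[R]_2 => w + h *: (delta_mx 0 j : 'rV[R]_2))
        (u + s *: delta_mx 0 i) (delta_mx 0 k + 0).
      apply: has_partialD; last exact: has_partial_cst.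
      exact: has_partial_id.
    apply: has_partial_eq (has_partial_comp (F := F : _ -> R^o) dl dF) _.
    rewrite addr0 (bigD1 k)//= mxE !eqxx scale1r big1 ?addr0// => a ak.
    by rewrite mxE eqxx /= (negbTE ak) scale0r.
  apply: smooth_has_partial sF _; apply: HU.
  by have := near_u s 0 sh zz; rewrite scale0r addr0.
have [s /andP[s0 sh] E1] := MVT_line h0 (fun s sh => (hG s i sh).1).
have sh' : 0 <= s <= h by rewrite !ltW.
have [t /andP[t0 th] E2] := @MVT_line (pt (V := R^o) i F)
  (u + s *: delta_mx 0 i) (delta_mx 0 j) h h0
  (fun t th => smooth_diff (smooth_partial i sF) (HU _ (near_u s t sh' th))).
exists (u + s *: delta_mx 0 i + t *: delta_mx 0 j).
  by apply: near_u => //; rewrite !ltW.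
rewrite -[pt j _ _]ptE -[partial j _ _]/('D__ _ _) -E2.
move: E1; rewrite -[X in _ = h * X]/(partial i G _) [X in _ = h * X -> _]ptE.
rewrite (has_partialE (hG s i sh')).
by rewrite /G => <-; ring.
Qed.

Lemma cvg_near_dist (f : 'rV[R]_2 -> R) u (e : R) : 0 < e -> {for u, continuous f} ->
  exists2 d, 0 < d & forall p, `|p - u| < d -> `|f p - f u| < e.
Proof.
move=> e0 /cvgrPdist_lt /(_ e e0) /nbhs_ballP [d d0 H]; exists d => // p pd.
by rewrite distrC; apply: H; rewrite -ball_normE /= distrC.
Qed.

Lemma open_ball_sub (U : set 'rV[R]_2) u : open U -> U u ->
  exists2 d, 0 < d & forall p, `|p - u| < d -> U p.
Proof.
move=> oU Uu; have /nbhs_ballP [d d0 H] : nbhs u U by exact: open_nbhs_nbhs.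
by exists d => // p pd; apply: H; rewrite -ball_normE /= distrC.
Qed.

(** Both mixed derivatives are limits of the same second difference, which is symmetric in the
    two directions. *)
Lemma schwarz (F : 'rV[R]_2 -> R) (U : set 'rV[R]_2) u i j : open U -> U u ->
  smooth_on (V := R^o) U F ->
  pt (V := R^o) i (pt (V := R^o) j F) u
  = pt (V := R^o) j (pt (V := R^o) i F) u.
Proof.
move=> oU Uu sF.
have [A EA] : exists A, A = pt (V := R^o) i (pt (V := R^o) j F).
  by eexists; exact: erefl.
have [B EB] : exists B, B = pt (V := R^o) j (pt (V := R^o) i F).
  by eexists; exact: erefl.
have cA : {for u, continuous (A : _ -> R^o)}.
  by rewrite EA; exact: smooth_cvg (smooth_partial i (smooth_partial j sF)) Uu.
have cB : {for u, continuous (B : _ -> R^o)}.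
  by rewrite EB; exact: smooth_cvg (smooth_partial j (smooth_partial i sF)) Uu.
have ddA h := double_difference (F := F) (u := u) j i (h := h) (U := U).
have ddB h := double_difference (F := F) (u := u) i j (h := h) (U := U).
rewrite -EA in ddA *; rewrite -EB in ddB *.
apply/eqP; rewrite -subr_eq0 -normr_le0 leNgt; apply/negP => e0.
have e2 : 0 < `|A u - B u| / 2 by rewrite divr_gt0.
have [d1 d10 H1] := cvg_near_dist e2 cA.
have [d2 d20 H2] := cvg_near_dist e2 cB.
have [d3 d30 H3] := open_ball_sub oU Uu.
pose d := Num.min d1 (Num.min d2 d3).
have d0 : 0 < d by rewrite !lt_min d10 d20.
have [dl1 dl2 dl3] : [/\ d <= d1, d <= d2 & d <= d3].
  by split; rewrite !ge_min lexx ?orbT.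
(* With this step the second difference stays in the ball of radius d. *)
pose h := d / 4.
have h0 : 0 < h by rewrite divr_gt0.
have hd : 2 * h < d by rewrite /h; lra.
have HU p : `|p - u| <= 2 * h -> U p by move=> pd; apply: H3; lra.
have [p pd Ep] := ddB h h0 HU sF.
have [q qd Eq] := ddA h h0 HU sF.
have AB : A q = B p.
  apply: (mulfI (lt0r_neq0 h0)); apply: (mulfI (lt0r_neq0 h0)).
  apply: etrans (etrans _ Ep); first exact: (esym Eq).
  have -> : u + h *: delta_mx 0 j + h *: delta_mx 0 i =
    u + h *: delta_mx 0 i + h *: delta_mx 0 j :> 'rV[R]_2 by rewrite addrAC.
  by rewrite -!addrA; congr (_ + _); rewrite addrCA.
have := H1 q (le_lt_trans qd (lt_le_trans hd dl1)); rewrite AB => a1.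
have := H2 p (le_lt_trans pd (lt_le_trans hd dl2)); move=> a2.
have := ler_distD (B p) (A u) (B u); rewrite [`|A u - B p|]distrC; lra.
Qed.

Lemma schwarz_rV n (F : 'rV[R]_2 -> 'rV[R]_n.+1) (U : set 'rV[R]_2) u i j :
  open U -> U u -> smooth_on U F ->
  pt i (pt j F) u = pt j (pt i F) u.
Proof.
move=> oU Uu sF; apply/rowP => c.
have E k l : pt k (pt l F) u 0 c =
   pt (V := R^o) k (pt (V := R^o) l (fun x => F x 0 c)) u.
  have := (has_partial_coordP _ _ _ _).1
    (smooth_has_partial k (smooth_partial l sF) Uu) c.
  move=> [_ <-]; rewrite -!ptE; apply: near_eq_derive; apply: (open_near oU Uu) => x Ux.
  by have [_ <-] := (has_partial_coordP _ _ _ _).1 (smooth_has_partial l sF Ux) c.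
have S := schwarz i j oU Uu ((smooth_coordP oU F).1 sF c).
by apply: etrans (E i j) (etrans S (esym (E j i))).
Qed.

(** The mean value theorem on the segment from the centre. *)
Lemma ball_constant (F : 'rV[R]_2 -> R) u d : 0 < d ->
  (forall p, `|p - u| < d -> differentiable (F : _ -> R^o) p) ->
  (forall p i, `|p - u| < d -> pt (V := R^o) i F p = 0) ->
  forall p, `|p - u| < d -> F p = F u.
Proof.
move=> d0 dF F0 p pd.
have Bs s : 0 <= s <= 1 -> `|u + s *: (p - u) - u| < d.
  move=> /andP[s0 s1]; rewrite addrAC subrr add0r normrZ ger0_norm//.
  by rewrite (le_lt_trans _ pd)// ler_piMl.
have [s /andP[s0 s1]] := MVT_line ltr01 (fun s sh => dF _ (Bs s sh)).
have B := Bs s; rewrite !ltW// in B; have {}B := B isT.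
rewrite scale1r [u + (p - u)]addrC subrK mul1r deriveE; last exact: dF.
rewrite [X in 'd _ _ X]row_sum_delta linear_sum big1 => [/eqP|i _].
  by rewrite subr_eq0 => /eqP.
rewrite linearZ /= -deriveE; last exact: dF.
by rewrite -[X in _ *: X]/(partial i F _) [X in _ *: X]ptE (F0 _ i B) scaler0.
Qed.

End MeanValue.

(** * The ambient inner product and the space forms *)

Section InnerProduct.
Variables (R : realType) (eps : R).
Implicit Types (v w : 'rV[R]_5).
Local Notation ip := (dot eps).

Lemma sum2 (V : zmodType) (F : 'I_2 -> V) : \sum_i F i = F 0 + F 1.
Proof.
rewrite big_ord_recl big_ord1; congr (_ + F _); exact: val_inj.
Qed.

Lemma forall2 (P : 'I_2 -> Prop) : P 0 -> P 1 -> forall i, P i.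
Proof.
by move=> P0 P1 [[|[|//]] i]; [move: P0|move: P1]; congr P; exact: val_inj.
Qed.

Lemma det2 (A : 'M[R]_2) : \det A = A 0 0 * A 1 1 - A 0 1 * A 1 0.
Proof.
rewrite (expand_det_row _ 0) sum2 /cofactor !det_mx11 !mxE /=.
have -> : lift 0 0 = 1 :> 'I_2 by exact: val_inj.
have -> : lift 1 0 = 0 :> 'I_2 by exact: val_inj.
by rewrite addn0 add0n expr0 expr1; ring.
Qed.

Lemma invmx2 (A : 'M[R]_2) : \det A != 0 ->
  [/\ invmx A 0 0 = (\det A)^-1 * A 1 1, invmx A 0 1 = - ((\det A)^-1 * A 0 1),
      invmx A 1 0 = - ((\det A)^-1 * A 1 0) & invmx A 1 1 = (\det A)^-1 * A 0 0].
Proof.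
move=> d0; have uA : A \in unitmx by rewrite unitmxE unitfE.
have E0 := congr1 (fun M : 'M[R]_2 => M 0 0) (mulVmx uA).
have E1 := congr1 (fun M : 'M[R]_2 => M 0 1) (mulVmx uA).
have E2 := congr1 (fun M : 'M[R]_2 => M 1 0) (mulVmx uA).
have E3 := congr1 (fun M : 'M[R]_2 => M 1 1) (mulVmx uA).
rewrite /= !mxE !sum2 /= in E0 E1 E2 E3.
have dd := det2 A; move: (\det A) d0 dd E0 E1 E2 E3 => d d0 dd.
set a := invmx A 0 0; set b := invmx A 0 1; set c := invmx A 1 0.
set e := invmx A 1 1 => E0 E1 E2 E3.
split; apply: (mulfI d0); rewrite ?mulrN mulrA divff// mul1r dd.
- by transitivity ((a * A 0 0 + b * A 1 0) * A 1 1 - (a * A 0 1 + b * A 1 1) * A 1 0);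
    [ring | rewrite E0 E1; ring].
- by transitivity ((a * A 0 1 + b * A 1 1) * A 0 0 - (a * A 0 0 + b * A 1 0) * A 0 1);
    [ring | rewrite E0 E1; ring].
- by transitivity ((c * A 0 0 + e * A 1 0) * A 1 1 - (c * A 0 1 + e * A 1 1) * A 1 0);
    [ring | rewrite E2 E3; ring].
- by transitivity ((c * A 0 1 + e * A 1 1) * A 0 0 - (c * A 0 0 + e * A 1 0) * A 0 1);
    [ring | rewrite E2 E3; ring].
Qed.

Lemma ipC v w : ip v w = ip w v.
Proof.
by rewrite -!dotE /Defs.ip mulrC [w 0 0 * _]mulrC [RHS]addrC addrC mulrC; congr (_ + _);
  apply: eq_bigr => i _; rewrite mulrC.
Qed.

Lemma ipDl v v' w : ip (v + v') w = ip v w + ip v' w.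
Proof.
rewrite -!dotE /Defs.ip mxE (eq_bigr _ (fun i _ => congr1 (fun z => z * _) (mxE _ _ _ _))).
rewrite (eq_bigr _ (fun i _ => mulrDl _ _ _)) big_split /=; ring.
Qed.

Lemma ipZl a v w : ip (a *: v) w = a * ip v w.
Proof.
rewrite -!dotE /Defs.ip mxE mulrDr mulr_sumr; congr (_ + _); first ring.
by apply: eq_bigr => i _; rewrite mxE mulrA.
Qed.

Lemma ipDr v w w' : ip v (w + w') = ip v w + ip v w'.
Proof. by rewrite ipC ipDl !(ipC v). Qed.

Lemma ipZr a v w : ip v (a *: w) = a * ip v w.
Proof. by rewrite ipC ipZl (ipC v). Qed.

Lemma ipNl v w : ip (- v) w = - ip v w.
Proof. by rewrite -scaleN1r ipZl mulN1r. Qed.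

Lemma ipNr v w : ip v (- w) = - ip v w.
Proof. by rewrite ipC ipNl ipC. Qed.

Lemma ip0l w : ip 0 w = 0.
Proof. by rewrite -(scale0r 0) ipZl mul0r. Qed.

Lemma ip_suml n (F : 'I_n -> 'rV[R]_5) w : ip (\sum_i F i) w = \sum_i ip (F i) w.
Proof.
by elim/big_ind2 : _ => [|a b c d <- <-|//]; [exact: ip0l|exact: ipDl].
Qed.

Lemma ip_sumr n (F : 'I_n -> 'rV[R]_5) w : ip w (\sum_i F i) = \sum_i ip w (F i).
Proof. by rewrite ipC ip_suml; apply: eq_bigr => i _; exact: ipC. Qed.

Lemma ip_comb2 a b v w : ip (a *: v + b *: w) (a *: v + b *: w) =
  a * a * ip v v + 2 * a * b * ip v w + b * b * ip w w.
Proof. by rewrite !ipDl !ipDr !ipZl !ipZr (ipC w v); ring. Qed.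

Lemma has_partial_ip i (F G : 'rV[R]_2 -> 'rV[R]_5) u d e :
  has_partial i F u d -> has_partial i G u e ->
  has_partial (V := R^o) i (fun x => ip (F x) (G x)) u (ip d (G u) + ip (F u) e).
Proof.
move=> /has_partial_coordP HF /has_partial_coordP HG.
have -> : (fun x => ip (F x) (G x)) = fun x => Defs.ip eps (F x) (G x).
  by apply/funext => x; rewrite dotE.
rewrite -!dotE /Defs.ip.
have H k := has_partialM (HF k) (HG k).
apply: has_partial_eq.
  apply: (has_partialD (V := R^o)).
    apply: has_partialM (H 0); exact: has_partial_cst.
  apply: (has_partial_sum (V := R^o)) => k; exact: H.
rewrite big_split /=; ring.
Qed.

Lemma smooth_ip (U : set 'rV[R]_2) (F G : 'rV[R]_2 -> 'rV[R]_5) : open U ->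
  smooth_on U F -> smooth_on U G -> smooth_on (V := R^o) U (fun x => ip (F x) (G x)).
Proof.
move=> oU sF sG.
have -> : (fun x => ip (F x) (G x)) = fun x => Defs.ip eps (F x) (G x).
  by apply/funext => x; rewrite dotE.
have cF := (smooth_coordP oU F).1 sF; have cG := (smooth_coordP oU G).1 sG.
apply: (smoothD oU (V := R^o)).
  by apply: smoothM => //; [exact: smooth_cst | exact: smoothM].
by apply: (smooth_sum oU (V := R^o)) => k; exact: smoothM.
Qed.

Lemma tangentE (x : 'rV[R]_5) v : spaceform_tangent eps x v -> eps * ip v x = 0.
Proof.
rewrite /spaceform_tangent /= dotE.
by case: ifP => [/eqP -> _|_ ->]; rewrite ?mul0r ?mulr0.
Qed.

Lemma tangentD (x : 'rV[R]_5) v w : spaceform_tangent eps x v -> spaceform_tangent eps x w ->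
  spaceform_tangent eps x (v + w).
Proof.
rewrite /spaceform_tangent /=; case: ifP => _; first by rewrite mxE => -> ->; rewrite addr0.
by rewrite !dotE ipDl => -> ->; rewrite addr0.
Qed.

Lemma tangentZ (x : 'rV[R]_5) a v : spaceform_tangent eps x v -> spaceform_tangent eps x (a *: v).
Proof.
rewrite /spaceform_tangent /=; case: ifP => _; first by rewrite mxE => ->; rewrite mulr0.
by rewrite !dotE ipZl => ->; rewrite mulr0.
Qed.

Lemma tangentB (x : 'rV[R]_5) v w : spaceform_tangent eps x v -> spaceform_tangent eps x w ->
  spaceform_tangent eps x (v - w).
Proof. by move=> tv tw; rewrite -scaleN1r; apply/tangentD/tangentZ. Qed.

Lemma proj_tangent (x : 'rV[R]_5) v : eps * ip v x = 0 -> spaceform_proj eps x v = v.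
Proof. by rewrite /spaceform_proj dotE => ->; rewrite scale0r subr0. Qed.

Lemma sum4 (V : zmodType) (F : 'I_4 -> V) :
  \sum_i F i = F 0 + F 1 + F (inord 2) + F (inord 3).
Proof.
rewrite !big_ord_recl big_ord0 addr0 !addrA.
by congr (F _ + F _ + F _ + F _); apply: val_inj; rewrite /= ?inordK.
Qed.

Lemma ip_self_euclid v : 0 <= eps -> ip v v = \sum_i v 0 i ^+ 2.
Proof.
move=> e0; rewrite -!dotE /Defs.ip ltNge e0 expr0 mul1r [RHS]big_ord_recl.
by congr (_ + _); apply: eq_bigr => i _; rewrite expr2.
Qed.

Lemma sum_sq_gt0 n (v : 'rV[R]_n) : v != 0 -> 0 < \sum_i v 0 i ^+ 2.
Proof.
move=> v0; rewrite lt_neqAle sumr_ge0 ?andbT => [|i _]; last exact: sqr_ge0.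
apply: contra v0; rewrite eq_sym psumr_eq0 => [/allP H|i _]; last exact: sqr_ge0.
apply/eqP/rowP => i; rewrite mxE; apply/eqP.
by rewrite -sqrf_eq0; exact: H (mem_index_enum i).
Qed.

(** The metric of the space form is Riemannian. For [eps < 0] the ambient form is Lorentzian,
    but the position vector is timelike, and the reversed Cauchy-Schwarz inequality makes its
    orthogonal complement spacelike. *)
Lemma tangent_gt0 (x : 'rV[R]_5) v : spaceform eps x -> spaceform_tangent eps x v -> v != 0 ->
  0 < ip v v.
Proof.
move=> sx tv v0; have [e0|e0] := leP 0 eps.
  by rewrite ip_self_euclid// sum_sq_gt0.
move: sx tv; rewrite /spaceform /spaceform_tangent /= (lt_eqF e0) => -[+ /(_ e0)].
have v'0 : v 0 0 = 0 -> 0 < \sum_(i < 4) v 0 (lift ord0 i) ^+ 2.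
  move=> v00; suff : 0 < \sum_i v 0 i ^+ 2.
    by rewrite big_ord_recl [v 0 ord0]v00 expr0n add0r.
  exact: sum_sq_gt0.
move: v'0; rewrite -!dotE /Defs.ip e0 expr1 !sum4.
set a0 := v 0 0; set b0 := x 0 0.
set a1 := v 0 _; set a2 := v 0 _; set a3 := v 0 _; set a4 := v 0 _.
set b1 := x 0 _; set b2 := x 0 _; set b3 := x 0 _; set b4 := x 0 _.
move=> a00 xx x0 vx.
have bb : b1 ^+ 2 + b2 ^+ 2 + b3 ^+ 2 + b4 ^+ 2 < b0 ^+ 2.
  rewrite -subr_lt0 -(nmulr_rgt0 _ e0); have : 0 < 1 :> R by [].
  by rewrite -xx; congr (0 < eps * _); ring.
have [a00'|a00'] := eqVneq a0 0.
  by have := a00 a00'; rewrite a00' => H; apply: lt_le_trans H _; rewrite !expr2; lra.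
set A := a1 ^+ 2 + a2 ^+ 2 + a3 ^+ 2 + a4 ^+ 2.
set B := b1 ^+ 2 + b2 ^+ 2 + b3 ^+ 2 + b4 ^+ 2 in bb.
have E : a0 * b0 = a1 * b1 + a2 * b2 + a3 * b3 + a4 * b4 by lra.
(* Cauchy-Schwarz in dimension four, by the identity of Lagrange. *)
have CS : (a0 * b0) ^+ 2 <= A * B.
  rewrite E -subr_ge0.
  have -> : A * B - (a1 * b1 + a2 * b2 + a3 * b3 + a4 * b4) ^+ 2 =
    (a1 * b2 - a2 * b1) ^+ 2 + (a1 * b3 - a3 * b1) ^+ 2 + (a1 * b4 - a4 * b1) ^+ 2
    + (a2 * b3 - a3 * b2) ^+ 2 + (a2 * b4 - a4 * b2) ^+ 2 + (a3 * b4 - a4 * b3) ^+ 2.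
    by rewrite /A /B; ring.
  by rewrite !addr_ge0// sqr_ge0.
have p1 : 0 < a0 ^+ 2 by rewrite exprn_even_gt0.
have p2 : 0 < b0 ^+ 2 by rewrite exprn_gt0.
have A0 : 0 <= A by rewrite !addr_ge0// sqr_ge0.
have : a0 ^+ 2 < A.
  rewrite -(ltr_pM2r p2) -exprMn (le_lt_trans CS)// ltr_pM2l//.
  rewrite lt_neqAle A0 andbT; apply/eqP => A00; move: CS; rewrite -A00 mul0r exprMn.
  by rewrite leNgt mulr_gt0.
rewrite /A !expr2; lra.
Qed.

End InnerProduct.

(** * Surfaces in a chart and the Gauss formula *)

(** Locked copies of the first fundamental form, its inverse, the Christoffel symbols and the
    second fundamental form; [fff] is expressed by [dot] and [pt] from the start. *)
HB.lock Definition fff (R : realType) (eps : R) (X : 'rV[R]_2 -> 'rV[R]_5)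
  (i j : 'I_2) u : R := dot eps (pt i X u) (pt j X u).
HB.lock Definition gup (R : realType) (eps : R) (X : 'rV[R]_2 -> 'rV[R]_5)
  (i j : 'I_2) u : R := ginv eps X u i j.
HB.lock Definition chr (R : realType) (eps : R) (X : 'rV[R]_2 -> 'rV[R]_5)
  (k i j : 'I_2) u : R := christoffel eps X k i j u.
HB.lock Definition sff (R : realType) (eps : R) (X : 'rV[R]_2 -> 'rV[R]_5)
  (i j : 'I_2) u : 'rV[R]_5 := second_ff eps (spaceform_proj eps) X i j u.

Lemma gupE (R : realType) (eps : R) X i j u : ginv eps X u i j = gup eps X i j u.
Proof. by rewrite gup.unlock. Qed.
Lemma chrE (R : realType) (eps : R) X k i j u : christoffel eps X k i j u = chr eps X k i j u.
Proof. by rewrite chr.unlock. Qed.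
Lemma sffE (R : realType) (eps : R) X i j u :
  second_ff eps (spaceform_proj eps) X i j u = sff eps X i j u.
Proof. by rewrite sff.unlock. Qed.

(** The tactics [gen_*] turn geometric quantities into variables, which leaves a polynomial
    identity to [ring] and [lra]. *)
Ltac gen_ip := repeat match goal with
  | |- context [dot ?e ?a ?b] => generalize (dot e a b) end.
Ltac gen_gm := repeat match goal with
  | |- context [fff ?e ?x ?a ?b ?c] => generalize (fff e x a b c) end.

Ltac gen_ginv := repeat match goal with
  | |- context [ginv ?e ?x ?a ?b ?c] => generalize (ginv e x a b c) => * end.

Section LocalSurface.
Variables (R : realType) (eps : R).
Local Notation ip := (dot eps).
Local Notation PN := (spaceform_proj eps).
Implicit Types (U : set 'rV[R]_2) (X : 'rV[R]_2 -> 'rV[R]_5) (u : 'rV[R]_2) (i j k l : 'I_2).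

Definition local_surface U X : Prop :=
  [/\ open U, smooth_on U X, forall u, U u -> spaceform eps (X u) &
      forall u, U u -> row_free (\matrix_(i < 2) pt i X u)].

Variables (U : set 'rV[R]_2) (X : 'rV[R]_2 -> 'rV[R]_5).
Hypothesis sX : local_surface U X.

Lemma surf_open : open U. Proof. by case: sX. Qed.
Lemma surf_smooth : smooth_on U X. Proof. by case: sX. Qed.
Let oU := surf_open.
Let smX := surf_smooth.

Lemma surf_partial i u : U u -> has_partial i X u (pt i X u).
Proof. exact: smooth_has_partial. Qed.

Lemma surf_partial2 i j u : U u ->
  has_partial i (pt j X) u (pt i (pt j X) u).
Proof. by apply: smooth_has_partial; exact: smooth_partial. Qed.

Lemma surf_partial2C i j u : U u ->
  pt i (pt j X) u = pt j (pt i X) u.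
Proof. by move=> Uu; exact: schwarz_rV oU Uu smX. Qed.

Lemma const_has_partial (V : normedModType R) i (F : 'rV[R]_2 -> V) u d c : U u ->
  has_partial i F u d -> (forall x, U x -> F x = c) -> d = 0.
Proof.
move=> Uu [_ <-] Fc; apply: has_partialE.
apply: near_has_partial (has_partial_cst i c u).
by apply: (open_near oU Uu) => x Ux; rewrite Fc.
Qed.

Lemma eq_on_partial (V : normedModType R) i (F G : 'rV[R]_2 -> V) u d e : U u ->
  (forall x, U x -> F x = G x) -> has_partial i F u d -> has_partial i G u e -> d = e.
Proof.
move=> Uu FG [_ <-] [_ <-]; rewrite -!ptE; apply: near_eq_derive.
exact: (open_near oU Uu).
Qed.

Lemma surf_sphere u : eps != 0 -> U u -> eps * ip (X u) (X u) = 1.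
Proof.
move=> e0 Uu; have sf := sX; case: sf => _ _ sf _.
by have := sf u Uu; rewrite /spaceform /= (negbTE e0) dotE => -[].
Qed.

Lemma surf_plane u : eps = 0 -> U u -> X u 0 0 = 0.
Proof.
move=> e0 Uu; have sf := sX; case: sf => _ _ sf _.
by have := sf u Uu; rewrite /spaceform /= e0 eqxx.
Qed.

(** Differentiate the equation of the space form. *)
Lemma surf_tangent i u : U u -> spaceform_tangent eps (X u) (pt i X u).
Proof.
move=> Uu; rewrite /spaceform_tangent /= dotE; case: eqVneq => e0.
  have H := (has_partial_coordP _ _ _ _).1 (surf_partial i Uu) 0.
  exact: const_has_partial Uu H (fun x => surf_plane e0).
have H := has_partialM (has_partial_cst i (eps : R^o) u)
  (has_partial_ip eps (surf_partial i Uu) (surf_partial i Uu)).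
have := const_has_partial Uu H (fun x => surf_sphere e0).
rewrite mul0r add0r (ipC _ (X u)) => /eqP; rewrite mulf_eq0 (negbTE e0) /=.
by move=> /eqP E; lra.
Qed.

Lemma surf_tangentE i u : U u -> eps * ip (pt i X u) (X u) = 0.
Proof. by move=> Uu; exact: tangentE (surf_tangent i Uu). Qed.

Local Notation gm := (fff eps X).
Local Notation gg := (gup eps X).
Local Notation Gam := (chr eps X).
Local Notation Bv := (sff eps X).

Lemma gmE i j u : gm i j u = ip (pt i X u) (pt j X u).
Proof. by rewrite fff.unlock. Qed.

Lemma gm_funE i j : gm i j = fun u => ip (pt i X u) (pt j X u).
Proof. by apply/funext => u; exact: gmE. Qed.

Lemma metricE u i j : metric eps X u i j = gm i j u.
Proof. by rewrite mxE dotE !ptE gmE. Qed.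

Lemma gmC i j u : gm i j u = gm j i u.
Proof. by rewrite !gmE ipC. Qed.

(** Differentiate the orthogonality of [dX] and [X]: the radial part of the Hessian is [- eps
    g]. *)
Lemma hess_tangent i j u : U u ->
  spaceform_tangent eps (X u) (pt i (pt j X) u + (eps * gm i j u) *: X u).
Proof.
move=> Uu; rewrite /spaceform_tangent /= dotE; case: eqVneq => e0.
  have H := (has_partial_coordP _ _ _ _).1 (surf_partial2 i j Uu) 0.
  rewrite !mxE (surf_plane e0 Uu) mulr0 addr0; apply: (const_has_partial (c := 0) Uu H) => x Ux.
  by have := surf_tangent j Ux; rewrite /spaceform_tangent /= e0 eqxx.
have tan x : U x -> ip (pt j X x) (X x) = 0.
  by move=> Ux; have := surf_tangent j Ux; rewrite /spaceform_tangent /= dotE (negbTE e0).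
have H := has_partial_ip eps (surf_partial2 i j Uu) (surf_partial i Uu).
have E := const_has_partial Uu H tan.
by rewrite ipDl ipZl mulrAC (surf_sphere e0 Uu) mul1r gmE (ipC _ (pt i X u)).
Qed.

(** The projection removes the radial part found in [hess_tangent]. *)
Lemma proj_hess i j u : U u ->
  PN (X u) (pt i (pt j X) u) = pt i (pt j X) u + (eps * gm i j u) *: X u.
Proof.
move=> Uu; rewrite /spaceform_proj dotE -scaleNr; congr (_ + _ *: _).
have := tangentE (hess_tangent i j Uu); rewrite ipDl ipZl.
have [->|e0] := eqVneq eps 0 => E; first by rewrite !mul0r oppr0.
have xx := surf_sphere e0 Uu.
have -> : eps * ip (pt i (pt j X) u) (X u) =
  eps * (ip (pt i (pt j X) u) (X u) + eps * gm i j u * ip (X u) (X u))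
  - eps * gm i j u * (eps * ip (X u) (X u)) by gen_ip => *; gen_gm => *; ring.
by rewrite E xx mulr1 sub0r opprK.
Qed.

(** Tangent vectors of the space form have positive length, and the coordinate fields are
    linearly independent. *)
Lemma gm_pos (a b : R) u : U u -> (a != 0) || (b != 0) ->
  0 < a * a * gm 0 0 u + 2 * a * b * gm 0 1 u + b * b * gm 1 1 u.
Proof.
move=> Uu ab.
have sf := sX; case: sf => _ _ sf rf.
suff : 0 < ip (a *: pt 0 X u + b *: pt 1 X u)
              (a *: pt 0 X u + b *: pt 1 X u).
  by rewrite ip_comb2 !gmE.
apply: (tangent_gt0 (sf u Uu)).
  by apply: tangentD; apply: tangentZ; exact: surf_tangent.
apply: contraL ab => /eqP E.
have := rf u Uu; rewrite -kermx_eq0 => /eqP ker0.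
pose c : 'rV[R]_2 := \row_i (if i == 0 then a else b).
have : (c <= kermx (\matrix_(i < 2) pt i X u))%MS.
  apply/sub_kermxP; rewrite mulmx_sum_row sum2 !rowK !mxE /=.
  exact: E.
rewrite ker0 submx0 => /eqP c0.
have := congr1 (fun v : 'rV_2 => v 0 0) c0; have := congr1 (fun v : 'rV_2 => v 0 1) c0.
by rewrite !mxE /= => -> ->; rewrite eqxx.
Qed.

Definition gdet u := gm 0 0 u * gm 1 1 u - gm 0 1 u * gm 0 1 u.

Lemma gm00_gt0 u : U u -> 0 < gm 0 0 u.
Proof.
move=> Uu; have := @gm_pos 1 0 u Uu; rewrite oner_eq0 => /(_ isT).
set a := (X in 0 < X); suff -> : a = gm 0 0 u by [].
by rewrite /a; gen_gm => *; ring.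
Qed.

Lemma gm11_gt0 u : U u -> 0 < gm 1 1 u.
Proof.
move=> Uu; have := @gm_pos 0 1 u Uu; rewrite oner_eq0 orbT => /(_ isT).
set a := (X in 0 < X); suff -> : a = gm 1 1 u by [].
by rewrite /a; gen_gm => *; ring.
Qed.

Lemma gdet_gt0 u : U u -> 0 < gdet u.
Proof.
move=> Uu; have g0 := gm00_gt0 Uu.
have := @gm_pos (- gm 0 1 u) (gm 0 0 u) u Uu; rewrite (gt_eqF g0) orbT => /(_ isT).
rewrite -(pmulr_rgt0 (gdet u) g0).
set a := (X in 0 < X); suff -> : a = gm 0 0 u * gdet u by [].
by rewrite /a /gdet; gen_gm => *; ring.
Qed.

Lemma det_metric u : \det (metric eps X u) = gdet u.
Proof. by rewrite det2 !metricE (gmC 1 0). Qed.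

Definition inv_gdet u : R := (gdet u)^-1.

Lemma ginvE u : U u ->
  [/\ gg 0 0 u = inv_gdet u * gm 1 1 u, gg 0 1 u = - (inv_gdet u * gm 0 1 u),
      gg 1 0 u = - (inv_gdet u * gm 0 1 u) & gg 1 1 u = inv_gdet u * gm 0 0 u].
Proof.
move=> Uu; have := invmx2 (A := metric eps X u); rewrite det_metric.
rewrite gt_eqF ?gdet_gt0// => /(_ isT); rewrite !metricE (gmC 1 0) gup.unlock /ginv.
by case=> -> -> -> ->.
Qed.

Lemma inv_gdetK u : U u -> inv_gdet u * gdet u = 1.
Proof. by move=> Uu; rewrite mulVf// gt_eqF// gdet_gt0. Qed.

Lemma smooth_gm i j : smooth_on (V := R^o) U (gm i j).
Proof. by rewrite gm_funE; apply: smooth_ip => //; exact: smooth_partial. Qed.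

Lemma smooth_gdet : smooth_on (V := R^o) U gdet.
Proof.
by apply: (smoothB oU (V := R^o)); apply: smoothM => //; exact: smooth_gm.
Qed.

Lemma smooth_inv_gdet : smooth_on (V := R^o) U inv_gdet.
Proof.
by apply: smoothV => //; [move=> u Uu; rewrite gt_eqF// gdet_gt0 | exact: smooth_gdet].
Qed.

Lemma has_partial_gm k i j u : U u -> has_partial (V := R^o) k (gm i j) u
  (ip (pt k (pt i X) u) (pt j X u)
   + ip (pt i X u) (pt k (pt j X) u)).
Proof. by move=> Uu; rewrite gm_funE; apply: has_partial_ip; exact: surf_partial2. Qed.

Lemma dmetricE k i j u : U u -> dmetric eps X k i j u =
  ip (pt k (pt i X) u) (pt j X u)
   + ip (pt i X u) (pt k (pt j X) u).
Proof.
move=> Uu; rewrite -(has_partialE (has_partial_gm k i j Uu)); rewrite /dmetric.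
have -> : (fun u' => metric eps X u' i j) = gm i j by apply/funext => x; rewrite metricE.
exact: ptE.
Qed.

Lemma christoffelE k i j u : U u ->
  Gam k i j u = \sum_l gg k l u * ip (pt i (pt j X) u) (pt l X u).
Proof.
move=> Uu; rewrite chr.unlock /christoffel mulr_sumr; apply: eq_bigr => l _.
rewrite !(dmetricE _ _ _ Uu) (surf_partial2C j i Uu) (surf_partial2C l i Uu).
rewrite (surf_partial2C l j Uu) gup.unlock.
rewrite (ipC _ (pt j X u) (pt i (pt l X) u)) (ipC _ (pt i X u) (pt j (pt l X) u)).
by gen_ip => a b c; gen_ginv; field.
Qed.

Lemma christoffelC k i j u : U u -> Gam k i j u = Gam k j i u.
Proof. by move=> Uu; rewrite !christoffelE// surf_partial2C. Qed.

(** The tangential part of the second derivatives of [X] is the one of the Levi-Civita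
    connection of the induced metric. *)
Lemma christoffel_lower i j m u : U u ->
  ip (pt i (pt j X) u) (pt m X u) = \sum_l Gam l i j u * gm l m u.
Proof.
move=> Uu; rewrite sum2 !christoffelE// !sum2.
have [-> -> -> ->] := ginvE Uu; have d1 := inv_gdetK Uu; rewrite /gdet in d1.
move: m; apply: forall2.
  rewrite (gmC 1 0) -[LHS]mul1r -d1; ring.
rewrite -[LHS]mul1r -d1; ring.
Qed.

Lemma second_ffE i j u : U u -> Bv i j u =
  pt i (pt j X) u + (eps * gm i j u) *: X u
  - \sum_k Gam k i j u *: pt k X u.
Proof.
move=> Uu; rewrite sff.unlock /second_ff /nabla ptE ptfE proj_hess//; congr (_ - _).
by apply: eq_bigr => l _; rewrite ptE chrE.
Qed.

(** The Gauss formula in the ambient vector space. *)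
Lemma hessE i j u : U u -> pt i (pt j X) u =
  \sum_k Gam k i j u *: pt k X u + Bv i j u - (eps * gm i j u) *: X u.
Proof. by move=> Uu; rewrite (second_ffE i j Uu) [_ + (_ - _)]addrC subrK addrK. Qed.

Lemma second_ffC i j u : U u -> Bv i j u = Bv j i u.
Proof.
move=> Uu; rewrite !second_ffE// surf_partial2C// gmC; congr (_ - _).
by apply: eq_bigr => k _; rewrite christoffelC.
Qed.

Definition normal_at u (v : 'rV[R]_5) :=
  spaceform_tangent eps (X u) v /\ forall i, ip v (pt i X u) = 0.

Lemma normalZ u a v : normal_at u v -> normal_at u (a *: v).
Proof.
move=> [tv nv]; split; first exact: tangentZ.
by move=> i; rewrite ipZl nv mulr0.
Qed.

Lemma normalD u v w : normal_at u v -> normal_at u w -> normal_at u (v + w).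
Proof.
move=> [tv nv] [tw nw]; split; first exact: tangentD.
by move=> i; rewrite ipDl nv nw addr0.
Qed.

Lemma normalN u v : normal_at u v -> normal_at u (- v).
Proof. by rewrite -scaleN1r; exact: normalZ. Qed.

Lemma second_ff_normal i j u : U u -> normal_at u (Bv i j u).
Proof.
move=> Uu; rewrite second_ffE//; split.
  apply: tangentB; first exact: hess_tangent.
  by rewrite sum2; apply: tangentD; apply: tangentZ; exact: surf_tangent.
move=> k; rewrite ipDl ipNl ipDl ipZl (ipC _ (X u)) mulrAC surf_tangentE// mul0r addr0.
rewrite christoffel_lower// ip_suml -sumrN -big_split /=.
by apply: big1 => l _; rewrite ipZl gmE subrr.
Qed.

Lemma normalX u v : normal_at u v -> eps * ip v (X u) = 0.
Proof. by move=> [/tangentE]. Qed.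

Lemma normal_pos u v : U u -> normal_at u v -> v != 0 -> 0 < ip v v.
Proof.
by move=> Uu [tv _]; have sf := sX; case: sf => _ _ sf _; exact: (tangent_gt0 (sf u Uu) tv).
Qed.

Lemma normal_hess u v i j : U u -> normal_at u v ->
  ip (pt i (pt j X) u) v = ip (Bv i j u) v.
Proof.
move=> Uu nv; rewrite hessE// ipDl ipNl ipDl ipZl mulrAC (ipC _ (X u)) normalX// mul0r subr0.
rewrite ip_suml big1 ?add0r// => k _; rewrite ipZl ipC.
by case: nv => _ ->; rewrite mulr0.
Qed.

Lemma smooth_ginv i j : smooth_on (V := R^o) U (gg i j).
Proof.
have H f g : smooth_on (V := R^o) U f ->
    (forall u, U u -> g u = f u) -> smooth_on (V := R^o) U g.
  by move=> sf fg; apply: (smooth_eq oU) sf => u Uu; rewrite fg.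
have sM a b := smoothM oU (smooth_inv_gdet) (smooth_gm a b).
move: i j; apply: forall2; apply: forall2.
- by apply: H (sM 1 1) _ => u Uu; case: (ginvE Uu).
- by apply: H (smoothN oU (sM 0 1)) _ => u Uu; case: (ginvE Uu).
- by apply: H (smoothN oU (sM 0 1)) _ => u Uu; case: (ginvE Uu).
- by apply: H (sM 0 0) _ => u Uu; case: (ginvE Uu).
Qed.

Lemma smooth_christoffel k i j : smooth_on (V := R^o) U (Gam k i j).
Proof.
apply: (smooth_eq oU (F := fun u => \sum_l gg k l u *
   ip (pt i (pt j X) u) (pt l X u))).
  by move=> u Uu; rewrite christoffelE.
apply: (smooth_sum oU (V := R^o)) => l; apply: smoothM => //; first exact: smooth_ginv.
by apply: smooth_ip => //; do 2?[exact: smooth_partial | apply: smooth_partial].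
Qed.

Lemma smooth_second_ff i j : smooth_on U (Bv i j).
Proof.
apply: (smooth_eq oU (F := fun u => pt i (pt j X) u + (eps * gm i j u) *: X u
  - \sum_k Gam k i j u *: pt k X u)).
  by move=> u Uu; rewrite second_ffE.
apply: smoothB => //.
  apply: smoothD => //; first by apply: smooth_partial; exact: smooth_partial.
  apply: smoothZ => //; apply: smoothM => //; first exact: smooth_cst.
  exact: smooth_gm.
apply: smooth_sum => // k; apply: smoothZ => //; first exact: smooth_christoffel.
exact: smooth_partial.
Qed.

End LocalSurface.

(** * The equations of Gauss, Codazzi and Weingarten, and the bitension field *)

HB.lock Definition mean_vec (R : realType) (eps : R) (X : 'rV[R]_2 -> 'rV[R]_5) u : 'rV[R]_5 :=
  mcv eps X u.

Lemma mean_vecE (R : realType) (eps : R) X u : mcv eps X u = mean_vec eps X u.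
Proof. by rewrite mean_vec.unlock. Qed.

Ltac gen_chr := repeat match goal with
  | |- context [chr ?e ?x ?a ?b ?c ?d] => generalize (chr e x a b c d) end.
Ltac gen_pt := repeat match goal with
  | |- context [sd ?a ?b ?c] => generalize (sd a b c) end.
Ltac gen_all := gen_ip; gen_gm; gen_chr; gen_pt.

Section GaussCodazzi.
Variables (R : realType) (eps : R).
Local Notation ip := (dot eps).
Local Notation PN := (spaceform_proj eps).
Variables (U : set 'rV[R]_2) (X : 'rV[R]_2 -> 'rV[R]_5).
Hypothesis sX : local_surface eps U X.
Local Notation gm := (fff eps X).
Local Notation gg := (gup eps X).
Local Notation Gam := (chr eps X).
Local Notation Bv := (sff eps X).
Local Notation D i := (pt i X).
Local Notation hv := (mean_vec eps X).
Implicit Types (u : 'rV[R]_2) (v : 'rV[R]_5) (i j k l : 'I_2) (xi : 'rV[R]_2 -> 'rV[R]_5).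

Let oU := surf_open sX.
Let smX := surf_smooth sX.

(** The Gauss formula, differentiated once more. Its symmetry in [a] and [i] contains the
    equations of Gauss (tangential part) and Codazzi (normal part). *)
Lemma third_derivative a i j u : U u -> pt a (pt i (pt j X)) u =
  \sum_k (sd a (Gam k i j) u *: D k u + Gam k i j u *: pt a (D k) u)
  + pt a (Bv i j) u
  - ((eps * sd a (gm i j) u) *: X u + (eps * gm i j u) *: D a u).
Proof.
move=> Uu.
have H1 k := has_partialZ (smooth_has_sd a (smooth_christoffel sX k i j) Uu)
  (surf_partial2 sX a k Uu).
have H2 := smooth_has_partial a (smooth_second_ff sX i j) Uu.
have H3 := has_partialZ (has_partialM (has_partial_cst a (eps : R^o) u)
  (smooth_has_sd a (smooth_gm sX i j) Uu)) (surf_partial sX a Uu).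
have H := has_partialB (has_partialD (has_partial_sum H1) H2) H3.
have H' : has_partial a (pt i (pt j X)) u (pt a (pt i (pt j X)) u).
  by apply: smooth_has_partial Uu; do 2!apply: smooth_partial.
by rewrite (eq_on_partial sX Uu (fun x Ux => hessE sX i j Ux) H' H) mul0r add0r.
Qed.

Lemma third_derivativeC a i j u : U u ->
  pt a (pt i (pt j X)) u = pt i (pt a (pt j X)) u.
Proof. by move=> Uu; exact: schwarz_rV oU Uu (smooth_partial _ smX). Qed.

(** The component along [v] of the symmetry of the third derivatives of [X]. *)
Lemma codazzi i j k u v : U u -> normal_at eps X u v ->
  ip (pt i (Bv j k) u) v + \sum_l Gam l j k u * ip (Bv i l u) v =
  ip (pt j (Bv i k) u) v + \sum_l Gam l i k u * ip (Bv j l u) v.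
Proof.
move=> Uu nv.
have E a b : ip (pt a (pt b (pt k X)) u) v =
    ip (pt a (Bv b k) u) v + \sum_l Gam l b k u * ip (Bv a l u) v.
  rewrite third_derivative// ipDl ipNl !ipDl !ipZl ip_suml.
  have -> : ip (D a u) v = 0 by rewrite ipC; case: nv.
  have -> : eps * sd a (gm b k) u * ip (X u) v = 0.
    by rewrite mulrAC (ipC _ (X u)) (normalX nv) mul0r.
  rewrite mulr0 addr0 subr0 addrC; congr (_ + _).
  apply: eq_bigr => l _; rewrite ipDl !ipZl (normal_hess sX _ _ Uu nv).
  have -> : ip (D l u) v = 0 by rewrite ipC; case: nv.
  by rewrite mulr0 add0r.
by rewrite -!E third_derivativeC.
Qed.

Definition normal_section xi := smooth_on U xi /\ forall u, U u -> normal_at eps X u (xi u).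

Lemma normal_section_partial xi i u : normal_section xi -> U u ->
  has_partial i xi u (pt i xi u).
Proof. by move=> [sxi _]; exact: smooth_has_partial. Qed.

(** Differentiate the orthogonality of [xi] and [dX]. *)
Lemma weingarten xi i k u : normal_section xi -> U u ->
  ip (pt i xi u) (D k u) = - ip (xi u) (Bv i k u).
Proof.
move=> nx Uu.
have H := has_partial_ip eps (normal_section_partial i nx Uu) (surf_partial2 sX i k Uu).
have := const_has_partial sX (c := 0) Uu H (fun x Ux => (nx.2 x Ux).2 k).
rewrite (ipC _ (xi u)) (normal_hess sX _ _ Uu (nx.2 u Uu)) => /eqP.
by rewrite addr_eq0 => /eqP ->; rewrite ipC.
Qed.

(** The derivative of a normal field has no radial part: differentiate the orthogonality of [xi]
    and [X]. *)
Lemma section_tangent xi i u : normal_section xi -> U u ->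
  spaceform_tangent eps (X u) (pt i xi u).
Proof.
move=> nx Uu; rewrite /spaceform_tangent /= dotE.
have tx x : U x -> spaceform_tangent eps (X x) (xi x) by move=> Ux; case: (nx.2 x Ux).
case: eqVneq => e0.
  have H := (has_partial_coordP _ _ _ _).1 (normal_section_partial i nx Uu) 0.
  apply: (const_has_partial sX (c := 0) Uu H) => x Ux.
  by have := tx x Ux; rewrite /spaceform_tangent /= e0 eqxx.
have H := has_partial_ip eps (normal_section_partial i nx Uu) (surf_partial sX i Uu).
have := const_has_partial sX (c := 0) Uu H; case: (nx.2 u Uu) => _ ->.
rewrite addr0; apply => x Ux.
by have := tx x Ux; rewrite /spaceform_tangent /= dotE (negbTE e0).
Qed.

Lemma section_X xi i u : normal_section xi -> U u -> eps * ip (pt i xi u) (X u) = 0.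
Proof. by move=> nx Uu; exact: tangentE (section_tangent i nx Uu). Qed.

Lemma second_ff_section i j : normal_section (Bv i j).
Proof. by split; [exact: smooth_second_ff sX i j | move=> u; exact: second_ff_normal]. Qed.

(** The trace of [S] with respect to the metric, multiplied by the determinant of the metric: in
    this form it is polynomial in the coefficients of [g]. *)
Definition gtrace u (S : 'I_2 -> 'I_2 -> R) : R :=
  gm 1 1 u * S 0 0 - gm 0 1 u * (S 0 1 + S 1 0) + gm 0 0 u * S 1 1.

Lemma gtraceE u S : U u -> \sum_i \sum_j gg i j u * S i j = inv_gdet eps X u * gtrace u S.
Proof.
move=> Uu; have [e00 e01 e10 e11] := ginvE sX Uu.
rewrite !sum2 e00 e01 e10 e11 /gtrace.
by move: (S 0 0) (S 0 1) (S 1 0) (S 1 1) => *; gen_gm; move: (inv_gdet _ _ _) => *; ring.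
Qed.

(** The coefficient on the [l]-th coordinate field of the curvature [R(d_0, d_1) d_j]. *)
Definition riem j l u : R :=
  sd 0 (Gam l 1 j) u - sd 1 (Gam l 0 j) u
  + \sum_k (Gam k 1 j u * Gam l 0 k u - Gam k 0 j u * Gam l 1 k u).

(** The tangential component of the symmetry of the third derivatives of [X]. *)
Lemma gauss j m u : U u -> \sum_l riem j l u * gm l m u =
  ip (Bv 1 j u) (Bv 0 m u) - ip (Bv 0 j u) (Bv 1 m u)
  + eps * (gm 1 j u * gm 0 m u - gm 0 j u * gm 1 m u).
Proof.
move=> Uu.
have E a b : ip (pt a (pt b (pt j X)) u) (D m u) =
    \sum_k (sd a (Gam k b j) u * gm k m u + Gam k b j u *
       \sum_l Gam l a k u * gm l m u)
    - ip (Bv b j u) (Bv a m u) - eps * gm b j u * gm a m u.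
  rewrite third_derivative// ipDl ipNl !ipDl !ipZl ip_suml.
  have -> : eps * sd a (gm b j) u * ip (X u) (D m u) = 0.
    by rewrite mulrAC (ipC _ (X u)) (surf_tangentE sX _ Uu) mul0r.
  rewrite add0r (weingarten _ _ (second_ff_section b j) Uu) -gmE.
  congr (_ + _ + _); apply: eq_bigr => k _.
  by rewrite ipDl !ipZl -gmE (christoffel_lower sX).
have := third_derivativeC 0 1 j Uu => /(congr1 (fun v => ip v (D m u))).
rewrite !E !sum2 /riem !sum2.
move/eqP; rewrite -subr_eq0 => /eqP E0; apply/eqP; rewrite -subr_eq0 -E0; apply/eqP.
clear E0; gen_all => *; ring.
Qed.

Lemma gauss_curvatureE u : U u -> gdet eps X u * gauss_curvature eps X u =
  eps * gdet eps X u + ip (Bv 0 0 u) (Bv 1 1 u) - ip (Bv 0 1 u) (Bv 0 1 u).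
Proof.
move=> Uu; rewrite /gauss_curvature (det_metric eps X u).
have d0 : gdet eps X u != 0 by rewrite gt_eqF// (gdet_gt0 sX).
have cE a b c : christoffel eps X a b c = Gam a b c.
  by apply/funext => x; rewrite chrE.
have -> : \sum_l riemann011 eps X l u * metric eps X u l 0 = \sum_l riem 1 l u * gm l 0 u.
  apply: eq_bigr => l _; rewrite metricE; congr (_ * _).
  rewrite /riemann011 /riem !cE !sdE; congr (_ + _).
  by apply: eq_bigr => k _; rewrite !cE.
rewrite gauss// mulrC divfK// (second_ffC sX 1 0 Uu) (ipC _ (Bv 1 1 u)) (gmC eps X 1 0) /gdet.
by gen_all => *; ring.
Qed.

Lemma tensionE u : U u -> tension eps PN X u = 2 *: hv u.
Proof.
move=> Uu; rewrite -mean_vecE /mcv /mean_curvature scalerA divff ?scale1r//.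
Qed.

Lemma mean_curvatureE u : U u -> hv u = (2^-1 * inv_gdet eps X u) *:
  (gm 1 1 u *: Bv 0 0 u - (2 * gm 0 1 u) *: Bv 0 1 u + gm 0 0 u *: Bv 1 1 u).
Proof.
move=> Uu; rewrite -mean_vecE /mcv /mean_curvature /tension -scalerA; congr (_ *: _).
rewrite (eq_bigr (fun i => \sum_j gg i j u *: Bv i j u)) => [|i _]; last first.
  by apply: eq_bigr => j _; rewrite gupE sffE.
rewrite !sum2 (second_ffC sX 1 0 Uu).
have [-> -> -> ->] := ginvE sX Uu.
apply/rowP => c; rewrite !mxE.
move: (Bv 0 0 u 0 c) (Bv 0 1 u 0 c) (Bv 1 1 u 0 c) (inv_gdet _ _ _) => *; gen_gm => *; ring.
Qed.

Lemma smooth_mean_curvature : smooth_on U hv.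
Proof.
apply: (smooth_eq oU (F := fun u => (2^-1 * inv_gdet eps X u) *:
  (gm 1 1 u *: Bv 0 0 u - (2 * gm 0 1 u) *: Bv 0 1 u + gm 0 0 u *: Bv 1 1 u))).
  by move=> u Uu; rewrite mean_curvatureE.
have sB i j := smooth_second_ff sX i j; have sg i j := smooth_gm sX i j.
have s2 : smooth_on (V := R^o) U (fun=> 2) by exact: smooth_cst.
apply: (smoothZ oU).
  apply: (smoothM oU); [exact: smooth_cst | exact: smooth_inv_gdet].
apply: smoothD => //; last exact: smoothZ.
apply: smoothB => //; first exact: smoothZ.
by apply: smoothZ => //; exact: (smoothM oU).
Qed.

Lemma mean_curvature_section : normal_section hv.
Proof.
split=> [|u Uu]; first exact: smooth_mean_curvature.
have nB i j := second_ff_normal sX i j Uu.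
rewrite mean_curvatureE//; apply: normalZ; apply: normalD; last exact: normalZ.
by apply: normalD; [exact: normalZ | apply: normalN; exact: normalZ].
Qed.

(** The mean curvature vector is half the trace of the second fundamental form. *)
Lemma trace_second_ff u v : U u ->
  gtrace u (fun i j => ip (Bv i j u) v) = gdet eps X u * (2 * ip (hv u) v).
Proof.
move=> Uu; rewrite mean_curvatureE// /gtrace (second_ffC sX 1 0 Uu) !(ipZl, ipDl, ipNl).
have d1 := inv_gdetK sX Uu.
rewrite [RHS](_ : _ = inv_gdet eps X u * gdet eps X u * (gm 1 1 u * ip (Bv 0 0 u) v
  - 2 * gm 0 1 u * ip (Bv 0 1 u) v + gm 0 0 u * ip (Bv 1 1 u) v)).
  by rewrite d1; clear d1; gen_all => *; ring.
by clear d1; move: (inv_gdet _ _ _) (gdet _ _ _) => *; gen_all => *; field.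
Qed.

(** The rough Laplacian of the tension field is computed with derivatives in the ambient vector
    space; projections to the space form drop out against a vector [v] orthogonal to [X], and
    the curvature term of the space form contributes [2 eps H]. The factor [2 det g] is divided
    out. *)
Lemma bitension_pairing u v : U u -> bitension eps X u = 0 -> eps * ip v (X u) = 0 ->
  gtrace u (fun i j => ip (pt i (pt j hv) u) v - \sum_k Gam k i j u * ip (pt k hv u) v)
  + 2 * eps * gdet eps X u * ip (hv u) v = 0.
Proof.
move=> Uu b0 vX.
pose tau := tension eps PN X.
have dtau j x : U x -> has_partial j tau x (2 *: pt j hv x).
  move=> Ux; apply: (near_has_partial (F := fun x => 2 *: hv x)).
    by apply: (open_near oU Ux) => y Uy; rewrite /tau tensionE.
  have H := has_partialZ (has_partial_cst j (2 : R^o) x)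
     (smooth_has_partial j smooth_mean_curvature Ux).
  by apply: has_partial_eq H _; rewrite scale0r add0r.
have nX w : ip (PN (X u) w) v = ip w v.
  by rewrite /spaceform_proj ipDl ipNl ipZl dotE mulrAC (ipC _ (X u)) vX mul0r subr0.
have n1 j x : U x -> nabla PN X j tau x = 2 *: pt j hv x.
  move=> Ux; rewrite /nabla ptE (has_partialE (dtau j x Ux)).
  apply: proj_tangent; rewrite ipZl mulrCA (section_X j mean_curvature_section Ux).
  by rewrite mulr0.
have n2 i j : partial i (nabla PN X j tau) u = 2 *: pt i (pt j hv) u.
  rewrite ptE; apply: has_partialE.
  apply: (near_has_partial (F := fun x => 2 *: pt j hv x)).
    by apply: (open_near oU Uu) => y Uy; rewrite n1.
  have H := has_partialZ (has_partial_cst i (2 : R^o) u)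
     (smooth_has_partial i (smooth_partial j smooth_mean_curvature) Uu).
  by apply: has_partial_eq H _; rewrite scale0r add0r.
have := congr1 (fun w => ip w v) b0; rewrite ip0l /bitension -/tau ip_suml.
pose S i j := 2 * (ip (pt i (pt j hv) u) v - \sum_k Gam k i j u * ip (pt k hv u) v)
   + 2 * eps * gm i j u * ip (hv u) v.
rewrite (eq_bigr (fun i => \sum_j gg i j u * S i j)) => [|i _].
  rewrite gtraceE// /gtrace /S => /eqP.
  rewrite mulf_eq0 invr_eq0 gt_eqF ?(gdet_gt0 sX)//= => /eqP E.
  apply: (mulfI (x := 2)); first by rewrite pnatr_eq0.
  rewrite mulr0 -[RHS]E /gtrace /gdet (gmC eps X 1 0) !sum2.
  by clear; gen_all => *; ring.
rewrite ip_suml; apply: eq_bigr => j _.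
rewrite ipZl gupE; congr (_ * _).
rewrite /nabla -/(nabla PN X j tau) n2 ipDl ipNl ipDl ipNl nX ipZl ip_suml.
rewrite (eq_bigr (fun k => 2 * (Gam k i j u * ip (pt k hv u) v))) => [|k _]; last first.
  by rewrite chrE ipZl -/(nabla PN X k tau u) n1// ipZl mulrCA.
rewrite -mulr_sumr /spaceform_curv /tau tensionE// !dotE ipZl ipDl ipNl !ipZl !ptE.
rewrite [ip (hv u) _](mean_curvature_section.2 u Uu).2 -gmE /S.
by clear; move: (\sum_k _) => *; gen_all => *; ring.
Qed.

End GaussCodazzi.

(** * The tangential part of the biharmonic equation *)

Section Tangential.
Variables (R : realType) (eps : R).
Local Notation ip := (dot eps).
Variables (U : set 'rV[R]_2) (X : 'rV[R]_2 -> 'rV[R]_5).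
Hypothesis sX : local_surface eps U X.
Local Notation gm := (fff eps X).
Local Notation Gam := (chr eps X).
Local Notation Bv := (sff eps X).
Local Notation D i := (pt i X).
Local Notation hv := (mean_vec eps X).
Local Notation gd := (gdet eps X).
Local Notation gtrace := (gtrace eps X).
Implicit Types (u : 'rV[R]_2) (i j k l : 'I_2) (xi : 'rV[R]_2 -> 'rV[R]_5).

Lemma has_partial_metric k i j u : U u -> has_partial (V := R^o) k (gm i j) u
  (\sum_l Gam l k i u * gm l j u + \sum_l Gam l k j u * gm l i u).
Proof.
move=> Uu; apply: has_partial_eq (has_partial_gm sX k i j Uu) _.
by rewrite (ipC _ (D i u)) !(christoffel_lower sX).
Qed.

(** The logarithmic derivative of the area element is the trace of the Christoffel symbols. *)
Lemma has_partial_gdet k u : U u -> has_partial (V := R^o) k gd u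
  (2 * (Gam 0 k 0 u + Gam 1 k 1 u) * gd u).
Proof.
move=> Uu; have H i j := has_partial_metric k i j Uu.
apply: has_partial_eq (has_partialB (V := R^o) (has_partialM (H 0 0) (H 1 1))
  (has_partialM (H 0 1) (H 0 1))) _.
rewrite !sum2 (gmC eps X 1 0) /gdet; by clear; gen_all => *; ring.
Qed.

(** Differentiate the Weingarten formula. *)
Lemma section_second_derivative xi i j k u : normal_section eps U X xi -> U u ->
  ip (pt i (pt j xi) u) (D k u) =
  - ip (pt i xi u) (Bv j k u) - ip (xi u) (pt i (Bv j k) u)
  + \sum_l Gam l i k u * ip (xi u) (Bv j l u) - ip (pt j xi u) (Bv i k u).
Proof.
move=> nx Uu; have [sxi _] := nx.
have H1 := has_partial_ip eps (smooth_has_partial i (smooth_partial j sxi) Uu)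
  (surf_partial2 sX i k Uu).
have H2 := has_partial_ip eps (smooth_has_partial i sxi Uu)
  (smooth_has_partial i (smooth_second_ff sX j k) Uu).
have Z x : U x -> ip (pt j xi x) (D k x) + ip (xi x) (Bv j k x) = 0.
  by move=> Ux; rewrite (weingarten sX j k nx Ux) addNr.
have := const_has_partial sX Uu (has_partialD (V := R^o) H1 H2) Z.
have -> : ip (pt j xi u) (pt i (D k) u) =
   - (\sum_l Gam l i k u * ip (xi u) (Bv j l u)) + ip (pt j xi u) (Bv i k u).
  rewrite (hessE sX i k Uu) ipDr ipNr ipDr ipZr mulrAC (section_X sX j nx Uu) mul0r subr0.
  rewrite ip_sumr -sumrN; congr (_ + _); apply: eq_bigr => l _.
  by rewrite ipZr (weingarten sX j l nx Uu) mulrN.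
move: (\sum_l _) => s; clear; gen_ip => *; lra.
Qed.

Lemma second_ff_ptC i j k u : U u -> pt i (Bv j k) u = pt i (Bv k j) u.
Proof.
move=> Uu; exact: (eq_on_partial sX Uu (fun x Ux => second_ffC sX j k Ux)
  (smooth_has_partial i (smooth_second_ff sX j k) Uu)
  (smooth_has_partial i (smooth_second_ff sX k j) Uu)).
Qed.

(** The tangential part of the bitension field. Pairing with [d_k] produces the divergence of
    the shape operator of [H]; the Codazzi equation turns it into the gradient of [|H|^2] and a
    trace of the normal derivative of [H]. *)
Lemma bitension_tangential k u : U u -> bitension eps X u = 0 ->
  gtrace u (fun i j => ip (pt i hv u) (Bv j k u)) + gd u * ip (hv u) (pt k hv u) = 0.
Proof.
move=> Uu b0; have nH := mean_curvature_section sX.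
have := bitension_pairing sX Uu b0 (surf_tangentE sX k Uu).
rewrite (nH.2 u Uu).2 mulr0 addr0.
pose Q i j := ip (hv u) (pt k (Bv i j) u).
pose b i j := ip (hv u) (Bv i j u).
pose W i j := ip (pt i hv u) (Bv j k u).
have P i j : ip (pt i (pt j hv) u) (D k u) - \sum_l Gam l i j u * ip (pt l hv u) (D k u)
   = - W i j - W j i - Q i j + \sum_l Gam l k j u * b i l + \sum_l Gam l i k u * b j l.
  rewrite (section_second_derivative _ _ _ nH Uu) (second_ff_ptC i j k Uu).
  have := codazzi sX i k j Uu (nH.2 u Uu).
  rewrite !sum2 !(weingarten sX _ k nH Uu) !(ipC _ _ (hv u)).
  rewrite (second_ffC sX k 0 Uu) (second_ffC sX k 1 Uu) /W /Q /b.
  clear; gen_all => *; lra.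
rewrite /gtrace !P.
have H := has_partial_metric k.
have bC : b 1 0 = b 0 1 by rewrite /b (second_ffC sX 1 0 Uu).
have QC : Q 1 0 = Q 0 1 by rewrite /Q (second_ff_ptC k 1 0 Uu).
have tb := trace_second_ff sX (hv u) Uu.
have tk := trace_second_ff sX (pt k hv u) Uu.
have dB i j := has_partial_ip eps (smooth_has_partial k (smooth_second_ff sX i j) Uu)
  (smooth_has_partial k nH.1 Uu).
have dH := has_partial_ip eps (smooth_has_partial k nH.1 Uu) (smooth_has_partial k nH.1 Uu).
have dL := has_partialD (V := R^o) (has_partialB (V := R^o)
   (has_partialM (H 1 1 u Uu) (dB 0 0))
   (has_partialM (H 0 1 u Uu) (has_partialD (V := R^o) (dB 0 1) (dB 1 0))))
   (has_partialM (H 0 0 u Uu) (dB 1 1)).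
have dR := has_partialM (has_partial_gdet k Uu)
  (has_partialM (has_partial_cst k (2 : R^o) u) dH).
have := eq_on_partial sX Uu (fun x Ux => trace_second_ff sX (hv x) Ux) dL dR.
move: (congr1 (fun z => 2 * (Gam 0 k 0 u + Gam 1 k 1 u) * z) tb) tk; rewrite /gtrace /=.
rewrite !(ipC _ _ (hv u)) -!/(b _ _) -!/(Q _ _) -!/(W _ _) bC QC.
rewrite (ipC _ (Bv 1 0 u)) (ipC _ (Bv 1 1 u)) (ipC _ (Bv 0 0 u)) (ipC _ (Bv 0 1 u)).
rewrite !sum2 bC (gmC eps X 1 0).
move: (gd u) (W 0 0) (W 0 1) (W 1 0) (W 1 1) (Q 0 0) (Q 0 1) (Q 1 1) (b 0 0) (b 0 1) (b 1 1).
rewrite !(christoffelC sX _ _ k Uu).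
clear; gen_all => *; lra.
Qed.

End Tangential.

(** * Symmetric forms in dimension two *)

Section LinearAlgebra.
Variable R : realType.
Implicit Types (a b c d e f g h p q w : R).

Lemma sumsq_eq0 d p q : 0 < d -> p ^+ 2 + d * q ^+ 2 = 0 -> p = 0 /\ q = 0.
Proof.
move=> d0 E; have p2 : 0 <= p ^+ 2 by exact: sqr_ge0.
have q2 : 0 <= d * q ^+ 2 by rewrite mulr_ge0 ?sqr_ge0// ltW.
have : p ^+ 2 = 0 by lra.
have : d * q ^+ 2 = 0 by lra.
move=> /eqP; rewrite mulf_eq0 (gt_eqF d0) /= sqrf_eq0 => /eqP ->.
by move=> /eqP; rewrite sqrf_eq0 => /eqP ->.
Qed.

(** The determinant of this linear system in [x] and [y] is [- (p^2 + d q^2)]. *)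
Lemma rotation_inj d p q x y : 0 < d -> p ^+ 2 + d * q ^+ 2 != 0 ->
  p * y = q * x -> p * x + d * q * y = 0 -> x = 0 /\ y = 0.
Proof.
move=> d0 n0 E1 E2; split; apply: (mulfI n0); rewrite mulr0.
  transitivity (p * (p * x + d * q * y) - d * q * (p * y - q * x)); first ring.
  by rewrite E2 E1 subrr !mulr0 subrr.
transitivity (q * (p * x + d * q * y) + p * (p * y - q * x)); first ring.
by rewrite E2 E1 subrr !mulr0 addr0.
Qed.

Lemma traceless_solve a b c x y z : 0 < c -> c * x - 2 * b * y + a * z = 0 ->
  x = (2 * b * y - a * z) / c.
Proof.
by move=> c0 E; apply: (canRL (mulfK (lt0r_neq0 c0))); lra.
Qed.

(** The trace-free symmetric forms are a plane. Those that commute with [h] are the multiples of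
    the trace-free part of [h], and if that part is nonzero only zero is also orthogonal to it.
    The matrix products in the hypotheses are taken with the metric [g]. *)
Lemma commute_orthogonal g00 g01 g11 h00 h01 h11 b00 b01 b11 f :
  let d := g00 * g11 - g01 * g01 in
  0 < g11 -> 0 < d ->
  g11 * h00 - 2 * g01 * h01 + g00 * h11 = 2 * f * d ->
  g11 * b00 - 2 * g01 * b01 + g00 * b11 = 0 ->
  (g11 * h00 - g01 * h01) * b01 + (g00 * h01 - g01 * h00) * b11 =
  (g11 * h01 - g01 * h11) * b00 + (g00 * h11 - g01 * h01) * b01 ->
  g11 * ((g11 * h00 - g01 * h01) * b00 + (g00 * h01 - g01 * h00) * b01)
  - g01 * ((g11 * h01 - g01 * h11) * b00 + (g00 * h11 - g01 * h01) * b01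
     + ((g11 * h00 - g01 * h01) * b01 + (g00 * h01 - g01 * h00) * b11))
  + g00 * ((g11 * h01 - g01 * h11) * b01 + (g00 * h11 - g01 * h01) * b11) = 0 ->
  [\/ h00 != f * g00, h01 != f * g01 | h11 != f * g11] ->
  [/\ b00 = 0, b01 = 0 & b11 = 0].
Proof.
move=> d g0 d0 trh trb com inn nh.
have gn : g11 != 0 by rewrite gt_eqF.
pose T00 := h00 - f * g00; pose T01 := h01 - f * g01; pose T11 := h11 - f * g11.
have trT : g11 * T00 - 2 * g01 * T01 + g00 * T11 = 0.
  rewrite -[RHS](subrr (2 * f * d)) -{1}trh /T00 /T01 /T11 /d; ring.
have hT : [/\ h00 = T00 + f * g00, h01 = T01 + f * g01 & h11 = T11 + f * g11].
  by rewrite /T00 /T01 /T11 !subrK.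
have T00E := traceless_solve g0 trT; have b00E := traceless_solve g0 trb.
move: hT T00E nh com inn {trh trT trb}; clearbody T00 T01 T11.
move=> [-> -> ->] -> nh; rewrite b00E => com inn.
pose p := g11 * T01 - g01 * T11; pose p' := g11 * b01 - g01 * b11.
have dn : d != 0 by rewrite gt_eqF.
have E1 : p * b11 = T11 * p'.
  apply: (mulfI (x := 2 * d / g11 ^+ 2)).
    by rewrite !mulf_neq0 ?invr_eq0 ?expf_neq0 ?pnatr_eq0.
  apply/eqP; rewrite -subr_eq0; move/eqP: com; rewrite -subr_eq0 => /eqP <-.
  by apply/eqP; rewrite /p /p' /d; field.
have E2 : p * p' + d * T11 * b11 = 0.
  apply: (mulfI (x := 2 * d / g11 ^+ 2)).
    by rewrite !mulf_neq0 ?invr_eq0 ?expf_neq0 ?pnatr_eq0.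
  by rewrite mulr0 -[RHS]inn /p /p' /d; field.
have [p0|n0] := eqVneq (p ^+ 2 + d * T11 ^+ 2) 0.
  have [p1 T11E] := sumsq_eq0 d0 p0.
  have T01E : T01 = 0.
    by apply: (mulfI gn); move: p1; rewrite /p T11E !mulr0 subr0.
  by move: nh; rewrite T01E T11E !mulr0 subrr mul0r !add0r !eqxx; case.
have [x0 y0] := rotation_inj d0 n0 E1 E2.
have b01E : b01 = 0 by apply: (mulfI gn); move: x0; rewrite /p' y0 !mulr0 subr0.
by rewrite b01E y0 !mulr0 subrr mul0r.
Qed.

(** A trace-free symmetric form has opposite eigenvalues, so it vanishes as soon as it has a
    kernel. The kernel here is spanned by the vector dual to [(w0, w1)]. *)
Lemma kernel_traceless g00 g01 g11 w0 w1 b00 b01 b11 :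
  let d := g00 * g11 - g01 * g01 in
  0 < g11 -> 0 < d ->
  g11 * b00 - 2 * g01 * b01 + g00 * b11 = 0 ->
  g11 * (w0 * b00) - g01 * (w0 * b01 + w1 * b00) + g00 * (w1 * b01) = 0 ->
  g11 * (w0 * b01) - g01 * (w0 * b11 + w1 * b01) + g00 * (w1 * b11) = 0 ->
  (w0 != 0) || (w1 != 0) ->
  [/\ b00 = 0, b01 = 0 & b11 = 0].
Proof.
move=> d g0 d0 tr e0 e1 w.
pose a0 := g11 * w0 - g01 * w1; pose a1 := g00 * w1 - g01 * w0.
have k0 : a0 * b00 = - a1 * b01 by rewrite /a0 /a1; lra.
have k1 : a0 * b01 = - a1 * b11 by rewrite /a0 /a1; lra.
pose Q := g11 * a1 ^+ 2 + 2 * g01 * a0 * a1 + g00 * a0 ^+ 2.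
have Q0 : Q != 0.
  apply/eqP => QE.
  have E : (g11 * a1 + g01 * a0) ^+ 2 + d * a0 ^+ 2 = 0.
    by rewrite -[RHS](mulr0 g11) -QE /Q /d; ring.
  have [x y] := sumsq_eq0 d0 E.
  have a1E : a1 = 0.
    by apply: (mulfI (lt0r_neq0 g0)); move: x; rewrite y !mulr0 addr0.
  have W1 : d * w1 = g01 * a0 + g11 * a1 by rewrite /d /a0 /a1; ring.
  have W0 : d * w0 = g00 * a0 + g01 * a1 by rewrite /d /a0 /a1; ring.
  have z1 : w1 = 0 by apply: (mulfI (lt0r_neq0 d0)); rewrite W1 y a1E !mulr0 addr0.
  have z0 : w0 = 0 by apply: (mulfI (lt0r_neq0 d0)); rewrite W0 y a1E !mulr0 addr0.
  by move: w; rewrite z0 z1 eqxx.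
split; apply: (mulfI Q0); rewrite mulr0.
- transitivity (a1 ^+ 2 * (g11 * b00 - 2 * g01 * b01 + g00 * b11)
    + (2 * g01 * a1 + g00 * a0) * (a0 * b00 - - a1 * b01) - g00 * a1 * (a0 * b01 - - a1 * b11)).
    by rewrite /Q; ring.
  by rewrite tr k0 k1 !subrr !mulr0 subr0 addr0.
- transitivity (- (a0 * a1) * (g11 * b00 - 2 * g01 * b01 + g00 * b11)
    + g11 * a1 * (a0 * b00 - - a1 * b01) + g00 * a0 * (a0 * b01 - - a1 * b11)).
    by rewrite /Q; ring.
  by rewrite tr k0 k1 !subrr !mulr0 !addr0.
- transitivity (a0 ^+ 2 * (g11 * b00 - 2 * g01 * b01 + g00 * b11)
    - g11 * a0 * (a0 * b00 - - a1 * b01) + (g11 * a1 + 2 * g01 * a0) * (a0 * b01 - - a1 * b11)).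
    by rewrite /Q; ring.
  by rewrite tr k0 k1 !subrr !mulr0 subr0 addr0.
Qed.

Lemma rank_one_det w0 w1 h00 h01 h11 :
  h00 * w1 = h01 * w0 -> h01 * w1 = h11 * w0 -> (w0 != 0) || (w1 != 0) ->
  h00 * h11 - h01 * h01 = 0.
Proof.
move=> e0 e1 /orP[] n; apply: (mulfI n); rewrite mulr0.
  transitivity (h00 * (h11 * w0) - h01 * (h01 * w0)); first ring.
  by rewrite -e0 -e1; ring.
transitivity (h11 * (h00 * w1) - h01 * (h01 * w1)); first ring.
by rewrite e0 e1; ring.
Qed.

(** A binary cubic without trace with respect to [g] is, in an orthonormal frame, the real part
    of a multiple of [z^3]. Its contraction with a nonzero trace-free quadratic form is a
    product of two complex numbers, so it vanishes only if the cubic does. *)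
Lemma cubic_apolar g00 g01 g11 t00 t01 t11 c1 c2 c3 c4 :
  let d := g00 * g11 - g01 * g01 in
  0 < g11 -> 0 < d ->
  g11 * t00 - 2 * g01 * t01 + g00 * t11 = 0 ->
  t00 * t11 - t01 * t01 != 0 ->
  g11 * c1 - 2 * g01 * c2 + g00 * c3 = 0 ->
  g11 * c2 - 2 * g01 * c3 + g00 * c4 = 0 ->
  t11 * c1 - 2 * t01 * c2 + t00 * c3 = 0 ->
  t11 * c2 - 2 * t01 * c3 + t00 * c4 = 0 ->
  [/\ c1 = 0, c2 = 0, c3 = 0 & c4 = 0].
Proof.
move=> d g0 d0 trt nt g1 g2 t1 t2.
have gn : g11 != 0 by rewrite gt_eqF.
have dn : d != 0 by rewrite gt_eqF.
have tE := traceless_solve g0 trt.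
have c1E := traceless_solve g0 g1; have c2E := traceless_solve g0 g2.
pose p := g11 * t01 - g01 * t11; pose e := g11 * c3 - g01 * c4.
have E2 : p * e + d * t11 * c4 = 0.
  apply: (mulfI (x := - 2 / g11 ^+ 2)).
    by rewrite mulf_neq0 ?invr_eq0 ?expf_neq0 ?oppr_eq0 ?pnatr_eq0.
  by rewrite mulr0 -[RHS]t2 tE c2E /p /e /d; field.
have E1 : p * c4 = t11 * e.
  apply/eqP; rewrite -subr_eq0; apply/eqP; apply: (mulfI (x := 2 * d / g11 ^+ 3)).
    by rewrite !mulf_neq0 ?invr_eq0 ?expf_neq0 ?pnatr_eq0.
  have E3 : t11 * c1 - 2 * t01 * c2 + t00 * c3 + 2 * g01 / g11 ^+ 3 * (p * e + d * t11 * c4) = 0.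
    by rewrite E2 t1 mulr0 addr0.
  by rewrite mulr0 -[RHS]E3 tE c1E c2E /p /e /d; field.
have [p0|n0] := eqVneq (p ^+ 2 + d * t11 ^+ 2) 0.
  have [p1 t11E] := sumsq_eq0 d0 p0.
  have t01E : t01 = 0 by apply: (mulfI gn); move: p1; rewrite /p t11E !mulr0 subr0.
  by move: nt; rewrite t01E t11E !mulr0 subrr eqxx.
have [x0 y0] := rotation_inj d0 n0 E1 E2.
have c3E : c3 = 0 by apply: (mulfI gn); move: x0; rewrite /e y0 !mulr0 subr0.
have c2Z : c2 = 0 by rewrite c2E c3E y0 !mulr0 subrr mul0r.
by rewrite c1E c2Z c3E y0 !mulr0 subrr mul0r.
Qed.

(** The linear algebra of [umbilical_const]: [b_ijk] stands for the pairing of [d_i E3] with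
    [B_jk], and the first two equations are those of Codazzi. Eliminating [b] leaves a multiple
    of [df]. *)
Lemma umbilical_linear g00 g01 g11 f0 f1 b000 b001 b011 b100 b101 b111 :
  let d := g00 * g11 - g01 * g01 in
  0 < d ->
  f0 * g01 - b001 = f1 * g00 - b100 -> f0 * g11 - b011 = f1 * g01 - b101 ->
  g11 * b000 - 2 * g01 * b001 + g00 * b011 = 0 ->
  g11 * b100 - 2 * g01 * b101 + g00 * b111 = 0 ->
  g11 * b000 - g01 * (b001 + b100) + g00 * b101 = - 2 * d * f0 ->
  g11 * b001 - g01 * (b011 + b101) + g00 * b111 = - 2 * d * f1 ->
  f0 = 0 /\ f1 = 0.
Proof.
move=> d d0 C0 C1 t0 t1 k0 k1; have dn := lt0r_neq0 d0.
have A0 := congr1 (fun z => g01 * z) C0; have A1 := congr1 (fun z => g00 * z) C1.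
have B0 := congr1 (fun z => g11 * z) C0; have B1 := congr1 (fun z => g01 * z) C1.
by split; apply: (mulfI dn); rewrite mulr0; move: A0 A1 B0 B1 k0 k1; rewrite /d /=; lra.
Qed.

Lemma sym_solve g00 g01 g11 x y x' y' : 0 < g00 * g11 - g01 * g01 ->
  x * g00 + y * g01 = x' * g00 + y' * g01 -> x * g01 + y * g11 = x' * g01 + y' * g11 ->
  x = x' /\ y = y'.
Proof.
move=> d0 E0 E1; have dn := lt0r_neq0 d0; split; apply: (mulfI dn).
  transitivity (g11 * (x * g00 + y * g01) - g01 * (x * g01 + y * g11)); first ring.
  by rewrite E0 E1; ring.
transitivity (g00 * (x * g01 + y * g11) - g01 * (x * g00 + y * g01)); first ring.
by rewrite E0 E1; ring.
Qed.

(** The determinant of a trace-free symmetric form is minus half its squared norm. *)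
Lemma traceless_det0 g00 g01 g11 t00 t01 t11 :
  0 < g11 -> 0 < g00 * g11 - g01 * g01 ->
  g11 * t00 - 2 * g01 * t01 + g00 * t11 = 0 ->
  t00 * t11 - t01 * t01 = 0 -> [/\ t00 = 0, t01 = 0 & t11 = 0].
Proof.
move=> g0 d0 tr dt; have gn := lt0r_neq0 g0.
have tE := traceless_solve g0 tr.
have [p0 t11E] : g11 * t01 - g01 * t11 = 0 /\ t11 = 0.
  apply: (sumsq_eq0 d0); rewrite -[RHS](mulr0 (- g11 ^+ 2)) -dt tE; field.
  by rewrite gn.
have t01E : t01 = 0 by apply: (mulfI gn); move: p0; rewrite t11E !mulr0 subr0.
by rewrite tE t01E t11E !mulr0 subrr mul0r.
Qed.

(** A trace-free form proportional to [g] vanishes. *)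
Lemma proportional_traceless g00 g01 g11 t00 t01 t11 :
  0 < g11 -> 0 < g00 * g11 - g01 * g01 ->
  g11 * t00 - 2 * g01 * t01 + g00 * t11 = 0 ->
  g11 * t01 = g01 * t11 -> g11 * t00 = g00 * t11 ->
  t00 * t11 - t01 * t01 = 0.
Proof.
move=> g0 d0 tr e1 e0; have t11E : t11 = 0.
  apply: (mulfI (lt0r_neq0 d0)); apply: (mulfI (x := 2)); first by rewrite pnatr_eq0.
  rewrite !mulr0; have := congr1 (fun z => g11 * z) tr.
  have := congr1 (fun z => g01 * z) e1; have := congr1 (fun z => g11 * z) e0.
  by move=> /=; lra.
have t01E : t01 = 0 by apply: (mulfI (lt0r_neq0 g0)); rewrite e1 t11E !mulr0.
by rewrite t01E t11E !mulr0 subrr.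
Qed.

End LinearAlgebra.

(** * Surfaces without minimal points *)

(** Locked copies of [|H|] and [E3]. *)
HB.lock Definition mean_norm (R : realType) (eps : R) (X : 'rV[R]_2 -> 'rV[R]_5) u : R :=
  fmc eps X u.
HB.lock Definition e3 (R : realType) (eps : R) (X : 'rV[R]_2 -> 'rV[R]_5) u : 'rV[R]_5 :=
  E3 eps X u.

Lemma mean_normE (R : realType) (eps : R) X u : fmc eps X u = mean_norm eps X u.
Proof. by rewrite mean_norm.unlock. Qed.
Lemma e3E (R : realType) (eps : R) X u : E3 eps X u = e3 eps X u.
Proof. by rewrite e3.unlock. Qed.

Section UnitMean.
Variables (R : realType) (eps : R).
Local Notation ip := (dot eps).
Variables (U : set 'rV[R]_2) (X : 'rV[R]_2 -> 'rV[R]_5).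
Hypothesis sX : local_surface eps U X.
Local Notation gm := (fff eps X).
Local Notation Gam := (chr eps X).
Local Notation Bv := (sff eps X).
Local Notation hv := (mean_vec eps X).
Local Notation gd := (gdet eps X).
Local Notation gtrace := (gtrace eps X).
Local Notation f := (mean_norm eps X).
Local Notation n := (e3 eps X).
Implicit Types (u : 'rV[R]_2) (v : 'rV[R]_5) (i j k l : 'I_2).
Hypothesis Hn : forall u, U u -> hv u != 0.

Let oU := surf_open sX.
Let nH := mean_curvature_section sX.

Lemma mean_norm_sqr u : U u -> f u * f u = ip (hv u) (hv u).
Proof.
move=> Uu; rewrite -mean_normE /fmc dotE mean_vecE -expr2 sqr_sqrtr// ltW//.
by apply: normal_pos (Hn Uu); [exact: sX | | exact: nH.2].
Qed.

Lemma mean_norm_gt0 u : U u -> 0 < f u.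
Proof.
move=> Uu; rewrite -mean_normE /fmc dotE mean_vecE sqrtr_gt0.
exact: (normal_pos sX Uu (nH.2 u Uu) (Hn Uu)).
Qed.

Lemma mean_norm_neq0 u : U u -> f u != 0.
Proof. by move=> /mean_norm_gt0 /lt0r_neq0. Qed.

Lemma smooth_mean_norm : smooth_on (V := R^o) U f.
Proof.
apply: (smooth_eq oU (V := R^o) (F := fun u => Num.sqrt (ip (hv u) (hv u)))).
  by move=> u Uu; rewrite -mean_normE /fmc dotE mean_vecE.
apply: smooth_sqrt => //; last by apply: smooth_ip => //; exact: nH.1.
move=> u Uu; exact: (normal_pos sX Uu (nH.2 u Uu) (Hn Uu)).
Qed.

Lemma e3_def u : n u = (f u)^-1 *: hv u.
Proof. by rewrite -e3E /E3 mean_normE mean_vecE. Qed.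

Lemma hv_e3 u : U u -> hv u = f u *: n u.
Proof. by move=> Uu; rewrite e3_def scalerA divff ?scale1r// mean_norm_neq0. Qed.

Lemma e3_section : normal_section eps U X n.
Proof.
split=> [|u Uu]; last by rewrite e3_def; apply: normalZ; exact: nH.2.
apply: (smooth_eq oU (F := fun u => (f u)^-1 *: hv u)).
  by move=> u _; rewrite e3_def.
apply: smoothZ => //; last exact: nH.1.
by apply: smoothV => //; [exact: mean_norm_neq0 | exact: smooth_mean_norm].
Qed.
Let nn := e3_section.

Lemma e3_unit u : U u -> ip (n u) (n u) = 1.
Proof.
move=> Uu; rewrite e3_def ipZl ipZr -mean_norm_sqr//.
by have := mean_norm_neq0 Uu; move: (f u) => x x0; field.
Qed.

(** Differentiate [|E3|^2 = 1]. *)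
Lemma e3_orth i u : U u -> ip (pt i n u) (n u) = 0.
Proof.
move=> Uu; have H := normal_section_partial i nn Uu.
have := const_has_partial sX (c := (1 : R^o)) Uu (has_partial_ip eps H H) e3_unit.
rewrite (ipC _ (n u)); move: (ip _ _) => x; lra.
Qed.

Lemma hv_partial i u : U u ->
  pt i hv u = sd i f u *: n u + f u *: pt i n u.
Proof.
move=> Uu; have H := has_partialZ (smooth_has_sd i smooth_mean_norm Uu)
  (normal_section_partial i nn Uu).
exact: (eq_on_partial sX Uu hv_e3 (normal_section_partial i nH Uu) H).
Qed.

Lemma hv_partial2 i j u v : U u -> ip (n u) v = 0 ->
  ip (pt i n u) v = 0 -> ip (pt j n u) v = 0 ->
  ip (pt i (pt j hv) u) v = f u * ip (pt i (pt j n) u) v.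
Proof.
move=> Uu nv iv jv.
have H := has_partialD
  (has_partialZ (smooth_has_sd i (smooth_sd j smooth_mean_norm) Uu)
     (normal_section_partial i nn Uu))
  (has_partialZ (smooth_has_sd i smooth_mean_norm Uu)
     (smooth_has_partial i (smooth_partial j nn.1) Uu)).
have H' := smooth_has_partial i (smooth_partial j nH.1) Uu.
rewrite (eq_on_partial sX Uu (fun x Ux => hv_partial j Ux) H' H).
by rewrite !ipDl !ipZl nv iv jv !mulr0 !add0r.
Qed.

(** The second fundamental form in the direction of [E3]. *)
Definition sff3 i j u := ip (Bv i j u) (n u).

Lemma sff3C i j u : U u -> sff3 i j u = sff3 j i u.
Proof. by move=> Uu; rewrite /sff3 (second_ffC sX). Qed.

Lemma smooth_sff3 i j : smooth_on (V := R^o) U (sff3 i j).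
Proof. by apply: smooth_ip => //; [exact: smooth_second_ff | exact: nn.1]. Qed.

Lemma has_partial_sff3 i j k u : U u -> has_partial (V := R^o) i (sff3 j k) u
  (ip (pt i (Bv j k) u) (n u) + ip (Bv j k u) (pt i n u)).
Proof.
move=> Uu; apply: has_partial_ip (normal_section_partial i nn Uu).
exact: smooth_has_partial (smooth_second_ff sX j k) Uu.
Qed.

Lemma trace_sff3 u : U u -> gtrace u (fun i j => sff3 i j u) = 2 * f u * gd u.
Proof.
move=> Uu; rewrite /sff3 (trace_second_ff sX (n u) Uu) hv_e3// ipZl e3_unit//; ring.
Qed.

Lemma trace_orth u v : U u -> ip (n u) v = 0 -> gtrace u (fun i j => ip (Bv i j u) v) = 0.
Proof. by move=> Uu nv; rewrite (trace_second_ff sX v Uu) hv_e3// ipZl nv !mulr0. Qed.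

(** The tangential biharmonic equation with [dH = df E3 + f dE3]. *)
Lemma tangential_e3 k u : U u -> bitension eps X u = 0 ->
  gtrace u (fun i j => sd i f u * sff3 j k u + f u * ip (pt i n u) (Bv j k u))
  + gd u * (f u * sd k f u) = 0.
Proof.
move=> Uu b0; rewrite -[RHS](bitension_tangential sX k Uu b0).
have E i j : ip (pt i hv u) (Bv j k u) =
    sd i f u * sff3 j k u + f u * ip (pt i n u) (Bv j k u).
  by rewrite hv_partial// ipDl !ipZl /sff3 (ipC _ (n u)).
rewrite /gtrace !E; congr (_ + _ * _).
by rewrite hv_partial// hv_e3// ipDr !ipZl !ipZr e3_unit// (ipC _ (n u)) e3_orth//
  !mulr0 addr0 mulr1.
Qed.

(** Pseudo-umbilical biharmonic surfaces have constant mean curvature. With [h = f g] the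
    Codazzi equation in the direction of [E3], the tangential biharmonic equation and the
    vanishing trace of [B] in directions orthogonal to [E3] form a linear system for [df]. *)
Lemma umbilical_const : (forall u i j, U u -> sff3 i j u = f u * gm i j u) ->
  (forall u, U u -> bitension eps X u = 0) -> forall u k, U u -> sd k f u = 0.
Proof.
move=> um b0 u k Uu.
have dh i j l := eq_on_partial sX Uu (fun x Ux => um x j l Ux) (has_partial_sff3 i j l Uu)
  (has_partialM (smooth_has_sd i smooth_mean_norm Uu) (has_partial_metric sX i j l Uu)).
pose b i j l := ip (Bv j l u) (pt i n u).
have bC i j l : b i j l = b i l j by rewrite /b (second_ffC sX).
have dB i j l : ip (pt i (Bv j l) u) (n u) = sd i f u * gm j l u +
   f u * (\sum_m Gam m i j u * gm m l u + \sum_m Gam m i l u * gm m j u) - b i j l.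
  by rewrite -dh addrK.
have C l : sd 0 f u * gm 1 l u - b 0 1 l = sd 1 f u * gm 0 l u - b 1 0 l.
  have := codazzi sX 0 1 l Uu (nn.2 u Uu).
  rewrite !dB !sum2 -!/(sff3 _ _ _) !um// !(christoffelC sX _ 1 0 Uu) !(gmC eps X 1 0).
  clear; gen_all; move: (b 0 1 l) (b 1 0 l) (f u) => *; lra.
have tr i : gtrace u (b i) = 0.
  by apply: trace_orth => //; rewrite ipC; exact: e3_orth.
have T l := tangential_e3 l Uu (b0 u Uu).
have d0 := gdet_gt0 sX Uu; have f0 := mean_norm_gt0 Uu.
(* the tangential biharmonic equation for h = f g *)
have key l : gm 1 1 u * b 0 0 l - gm 0 1 u * (b 0 1 l + b 1 0 l) + gm 0 0 u * b 1 1 l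
   = - 2 * gd u * sd l f u.
  apply: (mulfI (lt0r_neq0 f0)); have := T l.
  rewrite /gtrace !um// !(ipC _ (pt _ n u)) -!/(b _ _ _).
  rewrite /gdet.
  move: l; apply: forall2; clear; rewrite ?(gmC eps X 1 0); gen_gm; gen_all;
    move: (b 0 0 0) (b 0 1 0) (b 1 0 0) (b 1 1 0) (b 0 0 1) (b 0 1 1) (b 1 0 1) (b 1 1 1)
      (f u) => *; lra.
have := C 0; have := C 1; have := key 0; have := key 1; have := tr 0; have := tr 1.
rewrite /gtrace !(bC _ 1 0) !(gmC eps X 1 0) => t1 t0 k1 k0 c1 c0.
have [z0 z1] : sd 0 f u = 0 /\ sd 1 f u = 0.
  apply: (umbilical_linear d0 c0 c1 _ _ k0 k1); [rewrite -[RHS]t0 | rewrite -[RHS]t1]; clear;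
  gen_gm; move: (b 0 0 0) (b 0 0 1) (b 0 1 1) (b 1 0 0) (b 1 0 1) (b 1 1 1) => *; ring.
by move: k; apply: forall2.
Qed.

End UnitMean.

(** * The normal derivative of E3 *)

Section Parallel.
Variables (R : realType) (eps : R).
Local Notation ip := (dot eps).
Variables (U : set 'rV[R]_2) (X : 'rV[R]_2 -> 'rV[R]_5).
Hypothesis sX : local_surface eps U X.
Local Notation gm := (fff eps X).
Local Notation gg := (gup eps X).
Local Notation Gam := (chr eps X).
Local Notation Bv := (sff eps X).
Local Notation D i := (pt i X).
Local Notation hv := (mean_vec eps X).
Local Notation gd := (gdet eps X).
Local Notation gtrace := (gtrace eps X).
Local Notation f := (mean_norm eps X).
Local Notation n := (e3 eps X).
Implicit Types (u : 'rV[R]_2) (v : 'rV[R]_5) (i j k l : 'I_2).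
Hypothesis Hn : forall u, U u -> hv u != 0.

Local Notation sff3 := (sff3 eps X).
Let oU := surf_open sX.
Let smX := surf_smooth sX.
Let nn := e3_section sX Hn.

(** The coefficients of the tangential part of [d_j E3]. *)
Definition e3_tan j l u : R := - \sum_m gg l m u * sff3 j m u.
(** The normal derivative of [E3] (see [nabla_perp_e3]). *)
Definition perp_e3 j u := pt j n u - \sum_l e3_tan j l u *: D l u.

Lemma e3_tanE j u : U u ->
  e3_tan j 0 u = - (inv_gdet eps X u * (gm 1 1 u * sff3 j 0 u - gm 0 1 u * sff3 j 1 u))
  /\ e3_tan j 1 u = - (inv_gdet eps X u * (gm 0 0 u * sff3 j 1 u - gm 0 1 u * sff3 j 0 u)).
Proof.
move=> Uu; rewrite /e3_tan !sum2; have [-> -> -> ->] := ginvE sX Uu.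
by split; move: (inv_gdet _ _ _) (sff3 _ _ _) (sff3 _ _ _) => *; gen_gm => *; ring.
Qed.

Lemma smooth_e3_tan j l : smooth_on (V := R^o) U (e3_tan j l).
Proof.
apply: (smoothN oU (V := R^o)); apply: (smooth_sum oU (V := R^o)) => m.
by apply: smoothM => //; [exact: smooth_ginv | exact: smooth_sff3 sX Hn _ _].
Qed.

Lemma e3_tan_gm j k u : U u -> \sum_l e3_tan j l u * gm l k u = - sff3 j k u.
Proof.
move=> Uu; rewrite sum2; have [-> ->] := e3_tanE j Uu.
have d1 := inv_gdetK sX Uu.
move: k; apply: forall2; rewrite ?(gmC eps X 1 0).
  transitivity (- (inv_gdet eps X u * gd u * sff3 j 0 u)); last by rewrite d1 mul1r.
  by rewrite /gdet; clear; move: (inv_gdet _ _ _) (sff3 _ _ _) (sff3 _ _ _) => *; gen_gm => *; ring.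
transitivity (- (inv_gdet eps X u * gd u * sff3 j 1 u)); last by rewrite d1 mul1r.
by rewrite /gdet; clear; move: (inv_gdet _ _ _) (sff3 _ _ _) (sff3 _ _ _) => *; gen_gm => *; ring.
Qed.

Lemma e3_weingarten j k u : U u -> ip (pt j n u) (D k u) = - sff3 j k u.
Proof. by move=> Uu; rewrite (weingarten sX _ _ nn Uu) ipC. Qed.

Lemma perp_e3_normal j u : U u -> normal_at eps X u (perp_e3 j u).
Proof.
move=> Uu; split.
  apply: tangentB; first exact: section_tangent nn Uu.
  by rewrite sum2; apply: tangentD; apply: tangentZ; exact: surf_tangent sX _ _ Uu.
move=> k; rewrite /perp_e3 ipDl ipNl e3_weingarten// ip_suml.
rewrite (eq_bigr (fun l => e3_tan j l u * gm l k u)) => [|l _]; last by rewrite ipZl gmE.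
by rewrite e3_tan_gm// subrr.
Qed.

Lemma perp_e3_ip j u v : U u -> normal_at eps X u v -> ip (perp_e3 j u) v = ip (pt j n u) v.
Proof.
move=> Uu [_ nv]; rewrite /perp_e3 ipDl ipNl ip_suml big1 ?subr0// => l _.
by rewrite ipZl ipC nv mulr0.
Qed.

Lemma perp_e3_orth j u : U u -> ip (perp_e3 j u) (n u) = 0.
Proof. by move=> Uu; rewrite perp_e3_ip//; [exact: (e3_orth sX Hn j Uu) | exact: nn.2]. Qed.

Lemma nabla_perp_e3 j u : U u -> nabla_perp eps X j n u = perp_e3 j u.
Proof.
move=> Uu; rewrite /nabla_perp /nabla ptE proj_tangent; last exact: section_X nn Uu.
rewrite /normal_part /perp_e3; congr (_ - _); apply: eq_bigr => l _.
rewrite -scaler_suml ptE; congr (_ *: _); rewrite /e3_tan -sumrN; apply: eq_bigr => m _.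
by rewrite gupE dotE ptE e3_weingarten// mulrN.
Qed.

Lemma smooth_perp_e3 j : smooth_on U (perp_e3 j).
Proof.
apply: smoothB => //; first exact: (smooth_partial j nn.1).
apply: smooth_sum => // l; apply: smoothZ => //; first exact: smooth_e3_tan.
exact: (smooth_partial l smX).
Qed.

Section ParallelMean.
Hypothesis perp_e3_eq0 : forall u j, U u -> perp_e3 j u = 0.

Lemma par_e3 j u : U u -> pt j n u = \sum_l e3_tan j l u *: D l u.
Proof. by move=> Uu; apply: subr0_eq; exact: (perp_e3_eq0 j Uu). Qed.

Lemma par_normal j u v : U u -> normal_at eps X u v -> ip (pt j n u) v = 0.
Proof. by move=> Uu nv; rewrite -perp_e3_ip// perp_e3_eq0// ip0l. Qed.

(** For a parallel [E3] the normal part of its second derivatives only comes from the second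
    fundamental form. *)
Lemma par_ricci i j u v : U u -> normal_at eps X u v ->
  ip (pt i (pt j n) u) v = \sum_l e3_tan j l u * ip (Bv i l u) v.
Proof.
move=> Uu nv.
have H := has_partial_sum (fun l => has_partialZ (smooth_has_sd i (smooth_e3_tan j l) Uu)
   (surf_partial2 sX i l Uu)).
have H' := smooth_has_partial i (smooth_partial j nn.1) Uu.
rewrite (eq_on_partial sX Uu (fun x Ux => par_e3 j Ux) H' H) ip_suml.
apply: eq_bigr => l _; rewrite ipDl !ipZl (normal_hess sX _ _ Uu nv).
by rewrite (ipC _ (D l u)) nv.2 mulr0 add0r.
Qed.

Lemma e3_partialC i j u : U u -> pt i (pt j n) u = pt j (pt i n) u.
Proof. by move=> Uu; exact: schwarz_rV oU Uu nn.1. Qed.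

(** Against a normal [v] orthogonal to [E3], the symmetry of the second derivatives of [E3] says
    that the shape operators of [v] and [E3] commute, the normal biharmonic equation says that
    they are orthogonal; the one of [v] is trace free, so it vanishes by [commute_orthogonal]. *)
Lemma par_second_ff_orth u v : U u -> bitension eps X u = 0 ->
  (exists i j, sff3 i j u != f u * gm i j u) ->
  normal_at eps X u v -> ip (n u) v = 0 -> forall i j, ip (Bv i j u) v = 0.
Proof.
move=> Uu b0 [i0 [j0 nu]] nv n0.
have g0 := gdet_gt0 sX Uu; have gi0 : inv_gdet eps X u != 0 by rewrite invr_eq0 lt0r_neq0.
have g11 := gm11_gt0 sX Uu.
pose b i j := ip (Bv i j u) v.
have bC : b 1 0 = b 0 1 by rewrite /b (second_ffC sX 1 0 Uu).
have hC := sff3C sX 1 0 Uu.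
have trh := trace_sff3 sX Hn Uu; have trb := trace_orth sX Hn Uu n0.
have com := congr1 (fun w => ip w v) (e3_partialC 0 1 Uu).
rewrite !par_ricci// !sum2 -!/(b _ _) in com.
have inn : gtrace u (fun i j => \sum_l e3_tan j l u * b i l) = 0.
  have := bitension_pairing sX Uu b0 (normalX nv).
  rewrite (hv_e3 sX Hn Uu) ipZl n0 !mulr0 addr0 => E.
  apply: (mulfI (mean_norm_neq0 sX Hn Uu)); rewrite mulr0 -[RHS]E /gtrace.
  have P i j : ip (pt i (pt j hv) u) v - \sum_k Gam k i j u * ip (pt k hv u) v =
     f u * \sum_l e3_tan j l u * b i l.
    rewrite (hv_partial2 sX Hn Uu n0 (par_normal i Uu nv) (par_normal j Uu nv)).
    rewrite par_ricci// [X in _ - X]big1 ?subr0// => k _.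
    by rewrite (hv_partial sX Hn k Uu) ipDl !ipZl n0 (par_normal k Uu nv) !mulr0 addr0 mulr0.
  rewrite !P; move: (\sum_l _) (\sum_l _) (\sum_l _) (\sum_l _) => *; clear.
  by move: (f u) => *; gen_gm => *; ring.
move: trh trb inn com; rewrite /gtrace /= -!/(b _ _) !sum2 bC hC.
have [-> ->] := e3_tanE 0 Uu; have [-> ->] := e3_tanE 1 Uu; rewrite hC => trh trb inn com.
have [z0 z1 z2] : [/\ b 0 0 = 0, b 0 1 = 0 & b 1 1 = 0].
  apply: (commute_orthogonal (h00 := sff3 0 0 u) (h01 := sff3 0 1 u) (h11 := sff3 1 1 u)
    (f := f u) g11 g0).
  - move: trh; rewrite /gdet; clear.
    by move: (f u) (sff3 0 0 u) (sff3 0 1 u) (sff3 1 1 u); gen_gm => *; lra.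
  - move: trb; clear; move: (b 0 0) (b 0 1) (b 1 1); gen_gm => *; lra.
  - apply: (mulfI gi0); move: com; clear; move: (inv_gdet _ _ _)
      (sff3 0 0 u) (sff3 0 1 u) (sff3 1 1 u) (b 0 0) (b 0 1) (b 1 1); gen_gm => *; lra.
  - apply: (mulfI gi0); move: inn; clear; move: (inv_gdet _ _ _)
      (sff3 0 0 u) (sff3 0 1 u) (sff3 1 1 u) (b 0 0) (b 0 1) (b 1 1); gen_gm => *; lra.
  - move: i0 j0 nu; apply: forall2; apply: forall2; rewrite ?hC ?(gmC eps X 1 0) => nu;
    by [constructor 1 | constructor 2 | constructor 3].
by apply: forall2; apply: forall2; rewrite -/(b _ _) ?bC.
Qed.

(** The part of [B] orthogonal to [E3] is a normal vector orthogonal to itself. *)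
Lemma par_second_ff u : U u -> bitension eps X u = 0 ->
  (exists i j, sff3 i j u != f u * gm i j u) -> forall i j, Bv i j u = sff3 i j u *: n u.
Proof.
move=> Uu b0 nu i j; apply/eqP; rewrite -subr_eq0; apply/negPn/negP => v0.
set v := (X in X != 0) in v0.
have nv : normal_at eps X u v.
  by apply: normalD; [exact: (second_ff_normal sX i j Uu) |
    apply: normalN; apply: normalZ; exact: nn.2].
have nv0 : ip (n u) v = 0.
  by rewrite /v ipDr ipNr ipZr (e3_unit sX Hn Uu) mulr1 ipC subrr.
have := normal_pos sX Uu nv v0; rewrite {1}/v ipDl ipNl ipZl nv0 mulr0 subr0.
by rewrite par_second_ff_orth// ltxx.
Qed.

End ParallelMean.

End Parallel.

(** * Surfaces with second fundamental form in the direction of E3 *)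

Ltac gen_sff3 := repeat match goal with
  | |- context [sff3 ?e ?x ?a ?b ?c] => generalize (sff3 e x a b c) end.

Lemma schwarz_sd (R : realType) (F : 'rV[R]_2 -> R) (U : set 'rV[R]_2) u i j : open U -> U u ->
  smooth_on (V := R^o) U F -> sd i (sd j F) u = sd j (sd i F) u.
Proof.
move=> oU Uu sF; have E k : sd k F = pt (V := R^o) k F by apply/funext => x; rewrite ptsdE.
by rewrite -!ptsdE !E; exact: schwarz oU Uu sF.
Qed.

Section ConstantMean.
Variables (R : realType) (eps : R).
Local Notation ip := (dot eps).
Variables (U : set 'rV[R]_2) (X : 'rV[R]_2 -> 'rV[R]_5).
Hypothesis sX : local_surface eps U X.
Local Notation gm := (fff eps X).
Local Notation Gam := (chr eps X).
Local Notation Bv := (sff eps X).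
Local Notation hv := (mean_vec eps X).
Local Notation gd := (gdet eps X).
Local Notation gtrace := (gtrace eps X).
Local Notation f := (mean_norm eps X).
Local Notation n := (e3 eps X).
Implicit Types (u : 'rV[R]_2) (i j k l : 'I_2).
Hypothesis Hn : forall u, U u -> hv u != 0.

Local Notation sff3 := (sff3 eps X).
Local Notation perp_e3 := (perp_e3 eps X).
Let oU := surf_open sX.
Let nn := e3_section sX Hn.

(** The Gauss equation when the normal space is reduced to a line. *)
Lemma gauss_line u : U u -> (forall i j, Bv i j u = sff3 i j u *: n u) ->
  gd u * gauss_curvature eps X u =
  eps * gd u + (sff3 0 0 u * sff3 1 1 u - sff3 0 1 u * sff3 0 1 u).
Proof.
move=> Uu BN; rewrite (gauss_curvatureE sX Uu) !BN !ipZl !ipZr (e3_unit sX Hn Uu).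
by rewrite !mulr1 addrA.
Qed.

(** For a parallel [E3] the tangential biharmonic equation says that [h + f g] kills the nonzero
    vector [grad f]. So its determinant vanishes, and as the trace of [h] is [2 f] the
    eigenvalues of [h] are [- f] and [3 f]. In particular [h <> f g], so [B = h E3], and the
    Gauss equation gives [K]. *)
Lemma par_curvature u k : (forall x j, U x -> perp_e3 j x = 0) -> U u ->
  bitension eps X u = 0 -> sd k f u != 0 ->
  3 * f u ^+ 2 + gauss_curvature eps X u - eps = 0.
Proof.
move=> W0 Uu b0 fk.
have d0 := gdet_gt0 sX Uu; have f0 := mean_norm_gt0 sX Hn Uu.
have T l := tangential_e3 sX Hn l Uu b0.
have hC := sff3C sX 1 0 Uu.
have pB i j l : ip (pt i n u) (Bv j l u) = 0.
  exact: (par_normal W0 i Uu (second_ff_normal sX j l Uu)).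
pose a0 := gm 1 1 u * sd 0 f u - gm 0 1 u * sd 1 f u.
pose a1 := gm 0 0 u * sd 1 f u - gm 0 1 u * sd 0 f u.
have an : (- a1 != 0) || (a0 != 0).
  rewrite oppr_eq0; apply/negP => /negP; rewrite negb_or !negbK => /andP[/eqP z1 /eqP z0].
  have E0 : gd u * sd 0 f u = 0.
    have -> : gd u * sd 0 f u = gm 0 0 u * a0 + gm 0 1 u * a1.
      by rewrite /gdet /a0 /a1; clear; gen_gm; gen_pt => *; ring.
    by rewrite z0 z1 !mulr0 addr0.
  have E1 : gd u * sd 1 f u = 0.
    have -> : gd u * sd 1 f u = gm 0 1 u * a0 + gm 1 1 u * a1.
      by rewrite /gdet /a0 /a1; clear; gen_gm; gen_pt => *; ring.
    by rewrite z0 z1 !mulr0 addr0.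
  move/eqP: E0; move/eqP: E1; rewrite !mulf_eq0 (gt_eqF d0) /= => /eqP E1 /eqP E0.
  by move: k fk; apply: forall2; rewrite ?E0 ?E1 eqxx.
have trh := trace_sff3 sX Hn Uu; rewrite /gtrace hC in trh.
(* (h + f g)(grad f) = 0; up to the factor det g the vector (a0, a1) is grad f *)
have R0 : (sff3 0 0 u + f u * gm 0 0 u) * a0 = (sff3 0 1 u + f u * gm 0 1 u) * - a1.
  have := T 0; rewrite /gtrace !pB hC /gdet /a0 /a1; clear; move: (sff3 0 0 u) (sff3 0 1 u) (f u).
  by gen_gm; gen_pt => *; lra.
have R1 : (sff3 0 1 u + f u * gm 0 1 u) * a0 = (sff3 1 1 u + f u * gm 1 1 u) * - a1.
  have := T 1; rewrite /gtrace !pB /gdet /a0 /a1; clear; move: (sff3 0 1 u) (sff3 1 1 u) (f u).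
  by gen_gm; gen_pt => *; lra.
have D0 := rank_one_det R0 R1 an.
have D1 : sff3 0 0 u * sff3 1 1 u - sff3 0 1 u * sff3 0 1 u = - 3 * f u ^+ 2 * gd u.
  move: D0 (congr1 (fun z => f u * z) trh); rewrite /gdet /=; clear.
  by move: (sff3 0 0 u) (sff3 0 1 u) (sff3 1 1 u) (f u); gen_gm => *; lra.
have nu : exists i j, sff3 i j u != f u * gm i j u.
  apply: contrapT => H.
  have E i j : sff3 i j u = f u * gm i j u.
    by apply/eqP/negPn/negP => N; apply: H; exists i, j.
  move: D1; rewrite !E => D1.
  have : 4 * f u ^+ 2 * gd u = 0.
    move: D1; rewrite /gdet; clear; move: (f u); gen_gm => *; lra.
  by apply/eqP; rewrite !mulf_neq0 ?pnatr_eq0 ?expf_neq0 ?gt_eqF.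
have BN := par_second_ff sX Hn W0 Uu b0 nu.
have := gauss_line Uu BN; rewrite D1 => G.
apply: (mulfI (lt0r_neq0 d0)); rewrite mulr0; move: G.
suff H (K y z : R) : z * K = eps * z + - 3 * y ^+ 2 * z ->
  z * (3 * y ^+ 2 + K - eps) = 0 by exact: H.
by move=> E; rewrite mulrBr mulrDr E; ring.
Qed.

Section FlatCodazzi.
Hypothesis BN : forall u i j, U u -> Bv i j u = sff3 i j u *: n u.
Hypothesis f_const : forall u k, U u -> sd k f u = 0.
Variable c : R.
Hypothesis hdet : forall u, U u -> sff3 0 0 u * sff3 1 1 u - sff3 0 1 u * sff3 0 1 u = c * gd u.
Hypothesis f_c : forall u, U u -> f u ^+ 2 != c.

(** The trace-free part of [h]. *)
Definition tls i j u := sff3 i j u - f u * gm i j u.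

Lemma tlsC i j u : U u -> tls i j u = tls j i u.
Proof. by move=> Uu; rewrite /tls (sff3C sX _ _ Uu) gmC. Qed.

Lemma smooth_tls i j : smooth_on (V := R^o) U (tls i j).
Proof.
apply: (smoothB oU (V := R^o)); first exact: smooth_sff3 sX Hn i j.
by apply: smoothM => //; [exact: smooth_mean_norm sX Hn | exact: smooth_gm sX i j].
Qed.

Lemma tls_trace u : U u -> gtrace u (fun i j => tls i j u) = 0.
Proof.
move=> Uu; have := trace_sff3 sX Hn Uu; rewrite /gtrace /tls /gdet (gmC eps X 1 0).
by move: (sff3 0 0 u) (sff3 0 1 u) (sff3 1 0 u) (sff3 1 1 u) (f u); gen_gm => *; lra.
Qed.

Lemma tls_det u : U u -> tls 0 0 u * tls 1 1 u - tls 0 1 u * tls 0 1 u =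
  (c - f u ^+ 2) * gd u.
Proof.
move=> Uu; have := hdet Uu; have := congr1 (fun z => f u * z) (trace_sff3 sX Hn Uu).
rewrite /gtrace /tls /gdet (sff3C sX 1 0 Uu) /=.
by move: (sff3 0 0 u) (sff3 0 1 u) (sff3 1 1 u) (f u); gen_gm => *; lra.
Qed.

(** Its covariant derivative. *)
Definition ctls i j k u := sd i (tls j k) u
  - \sum_l Gam l i j u * tls l k u - \sum_l Gam l i k u * tls l j u.

(** As [f] is constant and [B = h E3], the Codazzi equation for [h] is the one for [h - f g]. *)
Lemma tls_codazzi i j k u : U u -> ctls i j k u = ctls j i k u.
Proof.
move=> Uu.
have dh a b : has_partial (V := R^o) a (sff3 b k) u (ip (pt a (Bv b k) u) (n u)).
  apply: has_partial_eq (has_partial_sff3 sX Hn a b k Uu) _.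
  by rewrite BN// ipZl (ipC _ (n u)) (e3_orth sX Hn a Uu) mulr0 addr0.
have dT a b : sd a (tls b k) u = ip (pt a (Bv b k) u) (n u)
    - f u * (\sum_l Gam l a b u * gm l k u + \sum_l Gam l a k u * gm l b u).
  rewrite -ptsdE; apply: has_partialE.
  apply: has_partial_eq (has_partialB (V := R^o) (dh a b)
    (has_partialM (smooth_has_sd a (smooth_mean_norm sX Hn) Uu)
       (has_partial_metric sX a b k Uu))) _.
  by rewrite f_const// mul0r add0r.
have := codazzi sX i j k Uu (nn.2 u Uu).
rewrite /ctls !dT !sum2 -!/(sff3 _ _ _) /tls !(christoffelC sX _ j i Uu).
rewrite !(sff3C sX _ i Uu) !(sff3C sX _ j Uu) !(gmC eps X _ i) !(gmC eps X _ j).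
gen_ip; gen_gm; gen_chr; gen_sff3.
by move: (f u) => *; lra.
Qed.

Lemma ctlsC i j k u : U u -> ctls i j k u = ctls i k j u.
Proof.
move=> Uu; rewrite /ctls.
have -> : sd i (tls j k) u = sd i (tls k j) u.
  exact: (eq_on_partial sX Uu (fun x Ux => tlsC j k Ux)
    (smooth_has_sd i (smooth_tls j k) Uu) (smooth_has_sd i (smooth_tls k j) Uu)).
by rewrite -!addrA; congr (_ + _); rewrite addrC.
Qed.

Lemma has_partial_tls i j k u : U u -> has_partial (V := R^o) i (tls j k) u
  (ctls i j k u + \sum_l Gam l i j u * tls l k u + \sum_l Gam l i k u * tls l j u).
Proof.
move=> Uu; apply: has_partial_eq (smooth_has_sd i (smooth_tls j k) Uu) _.
by rewrite /ctls; move: (sd _ _ _) (\sum_l _) (\sum_l _) => *; ring.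
Qed.

(** The covariant derivative of a trace-free tensor is trace free. *)
Lemma ctls_trace i u : U u ->
  gm 1 1 u * ctls i 0 0 u - 2 * gm 0 1 u * ctls i 0 1 u + gm 0 0 u * ctls i 1 1 u = 0.
Proof.
move=> Uu; have dT j k := has_partial_tls i j k Uu.
have dg j k := has_partial_metric sX i j k Uu.
have dL := has_partialD (V := R^o) (has_partialB (V := R^o)
   (has_partialM (dg 1 1) (dT 0 0))
   (has_partialM (dg 0 1) (has_partialD (V := R^o) (dT 0 1) (dT 1 0))))
   (has_partialM (dg 0 0) (dT 1 1)).
have := const_has_partial sX Uu dL tls_trace.
have := congr1 (fun z => 2 * (Gam 0 i 0 u + Gam 1 i 1 u) * z) (tls_trace Uu).
rewrite /gtrace /= !sum2 (tlsC 1 0 Uu) (ctlsC i 1 0 Uu) (gmC eps X 1 0).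
gen_gm; gen_chr; move: (tls 0 0 u) (tls 0 1 u) (tls 1 1 u).
move: (ctls i 0 0 u) (ctls i 0 1 u) (ctls i 1 1 u).
by move=> *; lra.
Qed.

(** The determinant of the trace-free part is a constant multiple of the one of the metric; its
    covariant derivative vanishes. *)
Lemma ctls_det i u : U u ->
  tls 1 1 u * ctls i 0 0 u - 2 * tls 0 1 u * ctls i 0 1 u + tls 0 0 u * ctls i 1 1 u = 0.
Proof.
move=> Uu; have dT j k := has_partial_tls i j k Uu.
have df := smooth_has_sd i (smooth_mean_norm sX Hn) Uu; rewrite f_const// in df.
have dL := has_partialB (V := R^o) (has_partialM (dT 0 0) (dT 1 1))
   (has_partialM (dT 0 1) (dT 0 1)).
have dR := has_partialM (has_partialB (V := R^o) (has_partial_cst i (c : R^o) u)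
   (has_partialM df df)) (has_partial_gdet sX i Uu).
have := eq_on_partial sX Uu tls_det dL dR.
have := congr1 (fun z => 2 * (Gam 0 i 0 u + Gam 1 i 1 u) * z) (tls_det Uu).
rewrite /= !sum2 (tlsC 1 0 Uu).
gen_chr; move: (tls 0 0 u) (tls 0 1 u) (tls 1 1 u).
move: (ctls i 0 0 u) (ctls i 0 1 u) (ctls i 1 1 u).
by move: (gd u) (f u) => *; lra.
Qed.

(** By the Codazzi equation the covariant derivative is totally symmetric, a binary cubic. It is
    trace free both with respect to [g] and to the nonzero form [h - f g], so [cubic_apolar]
    applies. *)
Lemma ctls0 i j k u : U u -> ctls i j k u = 0.
Proof.
move=> Uu.
have [z1 z2 z3 z4] : [/\ ctls 0 0 0 u = 0, ctls 0 0 1 u = 0, ctls 0 1 1 u = 0 & ctls 1 1 1 u = 0].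
  have s1 : ctls 1 0 0 u = ctls 0 0 1 u by rewrite tls_codazzi// ctlsC.
  have s2 : ctls 1 0 1 u = ctls 0 1 1 u by rewrite tls_codazzi.
  have t0 := ctls_trace 0 Uu; have t1 := ctls_trace 1 Uu.
  have d0 := ctls_det 0 Uu; have d1 := ctls_det 1 Uu.
  rewrite s1 s2 in t1 d1.
  have trT := tls_trace Uu; rewrite /gtrace (tlsC 1 0 Uu) in trT.
  apply: (cubic_apolar (gm11_gt0 sX Uu) (gdet_gt0 sX Uu) (t00 := tls 0 0 u)
     (t01 := tls 0 1 u) (t11 := tls 1 1 u)) => //.
    by rewrite -[RHS]trT; gen_gm; move: (tls 0 0 u) (tls 0 1 u) (tls 1 1 u) => *; ring.
  rewrite tls_det// mulf_neq0 ?(lt0r_neq0 (gdet_gt0 sX Uu))//.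
  by rewrite subr_eq0 eq_sym f_c.
move: i j k; apply: forall2; apply: forall2; apply: forall2 => //.
- by rewrite ctlsC.
- by rewrite tls_codazzi// ctlsC.
- by rewrite tls_codazzi.
- by rewrite ctlsC// tls_codazzi.
Qed.

Lemma sd_tls i j k u : U u -> sd i (tls j k) u =
  \sum_l Gam l i j u * tls l k u + \sum_l Gam l i k u * tls l j u.
Proof.
move=> Uu; rewrite -ptsdE (has_partialE (has_partial_tls i j k Uu)).
by rewrite ctls0// add0r.
Qed.

(** The curvature operator annihilates a parallel tensor (the Ricci identity). *)
Lemma riem_tls j k u : U u ->
  \sum_l riem eps X j l u * tls l k u + \sum_l riem eps X k l u * tls l j u = 0.
Proof.
move=> Uu.
have dG a l b m := smooth_has_sd a (smooth_christoffel sX l b m) Uu.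
have E a b : sd a (sd b (tls j k)) u =
    \sum_l (sd a (Gam l b j) u * tls l k u + Gam l b j u *
      (\sum_m Gam m a l u * tls m k u + \sum_m Gam m a k u * tls m l u))
  + \sum_l (sd a (Gam l b k) u * tls l j u + Gam l b k u *
      (\sum_m Gam m a l u * tls m j u + \sum_m Gam m a j u * tls m l u)).
  have dT l m := has_partial_eq (smooth_has_sd a (smooth_tls l m) Uu) (sd_tls a l m Uu).
  apply: (eq_on_partial sX Uu (fun x Ux => sd_tls b j k Ux)
    (smooth_has_sd a (smooth_sd b (smooth_tls j k)) Uu)).
  by apply: (has_partialD (V := R^o)); apply: (has_partial_sum (V := R^o)) => l;
    apply: has_partialM.
have := schwarz_sd 0 1 oU Uu (smooth_tls j k).
rewrite !E /riem !sum2 (tlsC 1 0 Uu).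
have := tlsC j 0 Uu; have := tlsC j 1 Uu; have := tlsC k 0 Uu; have := tlsC k 1 Uu.
rewrite !(christoffelC sX _ 1 0 Uu).
gen_chr; gen_pt.
move: (tls 0 0 u) (tls 0 1 u) (tls 1 1 u) (tls 0 j u) (tls 1 j u) (tls 0 k u) (tls 1 k u).
by move=> *; lra.
Qed.

(** The Gauss equation expresses the curvature tensor by [eps + c]. Unless this number vanishes,
    the Ricci identity makes the trace-free part of [h] proportional to [g], hence zero, while
    its determinant is [(c - f^2) det g]. *)
Lemma codazzi_flat u : U u -> eps + c = 0.
Proof.
move=> Uu.
have G j m := gauss sX j m Uu.
have d0 := gdet_gt0 sX Uu; have g11 := gm11_gt0 sX Uu.
have hC := sff3C sX 1 0 Uu; have hd := hdet Uu.
pose r j l := riem eps X j l u.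
have dd : 0 < gm 0 0 u * gm 1 1 u - gm 0 1 u * gm 0 1 u by exact: d0.
(* The Gauss equation determines the curvature tensor, as the metric is invertible. *)
have [r00 r01] : r 0 0 = (eps + c) * gm 0 1 u /\ r 0 1 = - (eps + c) * gm 0 0 u.
  have := G 0 0; have := G 0 1; rewrite !sum2 !BN// !ipZl !ipZr (e3_unit sX Hn Uu) -!/(r _ _).
  rewrite !mulr1 hC (gmC eps X 1 0) => G1 G0.
  apply: (sym_solve dd); rewrite ?G0 ?G1; move: hd; rewrite /gdet; gen_sff3; gen_gm;
    by move: c => c' *; lra.
have [r10 r11] : r 1 0 = (eps + c) * gm 1 1 u /\ r 1 1 = - (eps + c) * gm 0 1 u.
  have := G 1 0; have := G 1 1; rewrite !sum2 !BN// !ipZl !ipZr (e3_unit sX Hn Uu) -!/(r _ _).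
  rewrite !mulr1 hC (gmC eps X 1 0) => G1 G0.
  apply: (sym_solve dd); rewrite ?G0 ?G1; move: hd; rewrite /gdet; gen_sff3; gen_gm;
    by move: c => c' *; lra.
apply: contrapT => /eqP kn.
have T11 := riem_tls 1 1 Uu; have T01 := riem_tls 0 1 Uu.
rewrite !sum2 -!/(r _ _) (tlsC 1 0 Uu) in T11 T01.
rewrite r10 r11 ?r00 ?r01 in T11 T01.
(* the Ricci identity, divided by eps + c *)
have e1 : gm 1 1 u * tls 0 1 u = gm 0 1 u * tls 1 1 u.
  by apply: (mulfI kn); move: T11; gen_gm; move: (tls 0 1 u) (tls 1 1 u) c => *; lra.
have e0 : gm 1 1 u * tls 0 0 u = gm 0 0 u * tls 1 1 u.
  by apply: (mulfI kn); move: T01; gen_gm; move: (tls 0 0 u) (tls 0 1 u) (tls 1 1 u) c => *; lra.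
have tr : gm 1 1 u * tls 0 0 u - 2 * gm 0 1 u * tls 0 1 u + gm 0 0 u * tls 1 1 u = 0.
  have := tls_trace Uu; rewrite /gtrace /= (tlsC 1 0 Uu) => <-.
  by gen_gm; move: (tls 0 0 u) (tls 0 1 u) (tls 1 1 u) => *; ring.
have := proportional_traceless g11 dd tr e1 e0; rewrite tls_det//; apply/eqP.
by rewrite mulf_neq0 ?(lt0r_neq0 d0)// subr_eq0 eq_sym f_c.
Qed.

End FlatCodazzi.
End ConstantMean.

(** * Biharmonic surfaces of constant mean curvature *)

Section Restriction.
Variables (R : realType) (eps : R) (U : set 'rV[R]_2) (X : 'rV[R]_2 -> 'rV[R]_5).

Lemma local_surface_sub (V : set 'rV[R]_2) : open V -> V `<=` U ->
  local_surface eps U X -> local_surface eps V X.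
Proof.
move=> oV VU [oU sm sf rf]; split => //.
- exact: smooth_sub VU sm.
- by move=> u /VU; exact: sf.
- by move=> u /VU; exact: rf.
Qed.

Lemma smooth_neq0_nbhd (W : normedModType R) (F : 'rV[R]_2 -> W) u : open U -> U u ->
  smooth_on U F -> F u != 0 ->
  exists V, [/\ open V, V u, V `<=` U & forall x, V x -> F x != 0].
Proof.
move=> oU Uu sF F0; have cF := smooth_cvg sF Uu.
have N : nbhs u (U `&` [set x | F x != 0]).
  apply: filterI; first exact: open_nbhs_nbhs.
  have p0 : 0 < `|F u| by rewrite normr_gt0.
  have /cvgrPdist_lt/(_ _ p0) := cF; apply: filterS => x /=.
  by apply: contraTneq => ->; rewrite subr0 ltxx.
move: N; rewrite nbhsE => -[V [oV Vu] VU]; exists V; split => //.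
- by move=> x /VU [].
- by move=> x /VU [].
Qed.

End Restriction.

Section CMC.
Variables (R : realType) (eps : R).
Local Notation ip := (dot eps).
Variables (U : set 'rV[R]_2) (X : 'rV[R]_2 -> 'rV[R]_5).
Hypothesis sX : local_surface eps U X.
Local Notation gm := (fff eps X).
Local Notation Gam := (chr eps X).
Local Notation Bv := (sff eps X).
Local Notation D i := (pt i X).
Local Notation hv := (mean_vec eps X).
Local Notation gd := (gdet eps X).
Local Notation gtrace := (gtrace eps X).
Local Notation f := (mean_norm eps X).
Local Notation n := (e3 eps X).
Implicit Types (u : 'rV[R]_2) (v : 'rV[R]_5) (i j k l : 'I_2).
Hypothesis Hn : forall u, U u -> hv u != 0.

Local Notation sff3 := (sff3 eps X).
Local Notation perp_e3 := (perp_e3 eps X).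
Local Notation e3_tan := (e3_tan eps X).
Let oU := surf_open sX.
Let nH := mean_curvature_section sX.
Let nn := e3_section sX Hn.

(** For [eps > 0] the vectors [X], [d_0], [d_1], [E3], [v] and [w] would be orthogonal to each
    other, apart from the two tangent ones, so they would be six independent vectors in
    dimension five. *)
Lemma normal_dim u v w : 0 < eps -> U u -> normal_at eps X u v -> normal_at eps X u w ->
  ip (n u) v = 0 -> ip (n u) w = 0 -> ip v w = 0 -> v != 0 -> w = 0.
Proof.
move=> e0 Uu nv nw nv0 nw0 vw v0; apply/eqP/negPn/negP => w0.
have en := lt0r_neq0 e0.
have oX z : eps * ip z (X u) = 0 -> ip z (X u) = 0.
  by move=> /eqP; rewrite mulf_eq0 (negbTE en) => /eqP.
have vX := oX _ (normalX nv); have wX := oX _ (normalX nw).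
have nX := oX _ (normalX (nn.2 u Uu)); have dX i := oX _ (surf_tangentE sX i Uu).
have vp := lt0r_neq0 (normal_pos sX Uu nv v0); have wp := lt0r_neq0 (normal_pos sX Uu nw w0).
have XX : ip (X u) (X u) != 0.
  apply/eqP => E; have := surf_sphere sX en Uu; rewrite E mulr0 => /eqP.
  by rewrite eq_sym oner_eq0.
(* Pairing a relation with X, n, v, w kills their coefficients; the rest is in the kernel of dX. *)
pose s := [:: X u; D 0 u; D 1 u; n u; v; w].
pose M : 'M[R]_(6, 5) := \matrix_(i < 6) nth 0 s i.
have : row_free M.
  apply: inj_row_free => c; rewrite mulmx_sum_row.
  rewrite !big_ord_recl big_ord0 !rowK /= addr0.
  set c0 := c 0 _; set c1 := c 0 _; set c2 := c 0 _; set c3 := c 0 _; set c4 := c 0 _.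
  set c5 := c 0 _ => E.
  have c3E : c3 = 0.
    have := congr1 (fun z => ip z (n u)) E; rewrite !ipDl !ipZl ip0l.
    rewrite (ipC _ v) (ipC _ w) (ipC _ (X u)) !(ipC _ (D _ u)) !(nn.2 u Uu).2 nX nv0 nw0.
    rewrite (e3_unit sX Hn Uu).
    by rewrite !mulr0 !add0r !addr0 mulr1.
  have c4E : c4 = 0.
    have := congr1 (fun z => ip z v) E; rewrite !ipDl !ipZl ip0l.
    rewrite nv0 (ipC _ w) vw (ipC _ (X u)) vX !(ipC _ (D _ u)) !nv.2.
    by rewrite !mulr0 !add0r !addr0 => /eqP; rewrite mulf_eq0 (negbTE vp) orbF => /eqP.
  have c5E : c5 = 0.
    have := congr1 (fun z => ip z w) E; rewrite !ipDl !ipZl ip0l.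
    rewrite nw0 vw (ipC _ (X u)) wX !(ipC _ (D _ u)) !nw.2.
    by rewrite !mulr0 !add0r => /eqP; rewrite mulf_eq0 (negbTE wp) orbF => /eqP.
  have c0E : c0 = 0.
    have := congr1 (fun z => ip z (X u)) E; rewrite !ipDl !ipZl ip0l.
    rewrite !dX nX vX wX.
    by rewrite !mulr0 !addr0 => /eqP; rewrite mulf_eq0 (negbTE XX) orbF => /eqP.
  have c12 : (c1 == 0) && (c2 == 0).
    apply/negPn/negP; rewrite negb_and => /(gm_pos sX Uu).
    move: E; rewrite c3E c4E c5E c0E !scale0r !addr0 add0r => E.
    rewrite !(gmE eps X) -ip_comb2 E ip0l ltxx //.
  case/andP: c12 => /eqP c1E /eqP c2E.
  apply/rowP => i; rewrite mxE.
  case: i => [[|[|[|[|[|[|//]]]]]] lti];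
    [rewrite -[RHS]c0E|rewrite -[RHS]c1E|rewrite -[RHS]c2E|rewrite -[RHS]c3E
    |rewrite -[RHS]c4E|rewrite -[RHS]c5E]; congr (c 0 _); exact: val_inj.
by rewrite /row_free => /eqP rM; have := rank_leq_col M; rewrite rM.
Qed.

Hypothesis b0 : forall u, U u -> bitension eps X u = 0.
Variable f0 : R.
Hypothesis f_eq : forall u, U u -> f u = f0.

Lemma f_const u k : U u -> sd k f u = 0.
Proof.
move=> Uu; exact: (const_has_partial sX (c := (f0 : R^o)) Uu
  (smooth_has_sd k (smooth_mean_norm sX Hn) Uu) f_eq).
Qed.

Lemma hv_partial_const j u : U u -> pt j hv u = f u *: pt j n u.
Proof. by move=> Uu; rewrite (hv_partial sX Hn j Uu) f_const// scale0r add0r. Qed.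

(** The component along [E3] of the biharmonic equation, with [<E3, d_i d_j E3> = - <d_i E3, d_j
    E3>]. *)
Lemma energy u : U u -> gtrace u (fun i j => ip (pt i n u) (pt j n u)) = 2 * eps * gd u.
Proof.
move=> Uu.
have := bitension_pairing sX Uu (b0 Uu) (normalX (nn.2 u Uu)).
have P i j : ip (pt i (pt j hv) u) (n u) - \sum_k Gam k i j u * ip (pt k hv u) (n u) =
    - (f u * ip (pt i n u) (pt j n u)).
  rewrite [X in _ - X]big1 => [|k _]; last first.
    by rewrite hv_partial_const// ipZl (e3_orth sX Hn k Uu) !mulr0.
  have H1 := has_partialZ (smooth_has_sd i (smooth_mean_norm sX Hn) Uu)
     (smooth_has_partial i (smooth_partial j nn.1) Uu).
  have H2 := smooth_has_partial i (smooth_partial j nH.1) Uu.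
  rewrite (eq_on_partial sX Uu (fun x Ux => hv_partial_const j Ux) H2 H1) f_const//.
  rewrite scale0r add0r ipZl subr0 -mulrN; congr (_ * _).
  have H3 := has_partial_ip eps (smooth_has_partial i (smooth_partial j nn.1) Uu)
     (normal_section_partial i nn Uu).
  have := const_has_partial sX (c := (0 : R^o)) Uu H3 (fun x Ux => e3_orth sX Hn j Ux).
  by move=> /eqP; rewrite addr_eq0 (ipC _ (pt j n u)) => /eqP.
rewrite /gtrace !P (hv_e3 sX Hn Uu) ipZl (e3_unit sX Hn Uu) mulr1 => E.
apply: (mulfI (mean_norm_neq0 sX Hn Uu)); move: E; gen_ip; gen_gm; move: (f u) (gd u).
by move=> *; lra.
Qed.

(** The energy density of [E3] is nonnegative, so [eps >= 0]. If [eps = 0] then [E3] is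
    constant, so [h = 0], against [trace h = 2 f]. *)
Lemma cmc_eps_gt0 u : U u -> 0 < eps.
Proof.
move=> Uu; have g1 := gm11_gt0 sX Uu; have d0 := gdet_gt0 sX Uu.
have tn j := section_tangent sX j nn Uu.
have pos z : spaceform_tangent eps (X u) z -> 0 <= ip z z.
  move=> tz; have [->|z0] := eqVneq z 0; first by rewrite ip0l.
  have sf := sX; case: sf => _ _ sf _; exact: ltW (tangent_gt0 (sf u Uu) tz z0).
have E : gm 1 1 u * (2 * eps * gd u) =
   ip (gm 1 1 u *: pt 0 n u + (- gm 0 1 u) *: pt 1 n u)
      (gm 1 1 u *: pt 0 n u + (- gm 0 1 u) *: pt 1 n u)
   + gd u * ip (pt 1 n u) (pt 1 n u).
  rewrite -energy// ip_comb2 /gtrace /gdet (ipC _ (pt 1 n u) (pt 0 n u)).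
  by gen_ip; gen_gm => *; ring.
have p1 : 0 <= ip (gm 1 1 u *: pt 0 n u + (- gm 0 1 u) *: pt 1 n u)
      (gm 1 1 u *: pt 0 n u + (- gm 0 1 u) *: pt 1 n u).
  by apply: pos; apply: tangentD; apply: tangentZ.
have p2 := pos _ (tn 1).
have ge0 : 0 <= eps.
  have : 0 <= gm 1 1 u * (2 * eps * gd u) by rewrite E addr_ge0// mulr_ge0// ltW.
  by rewrite pmulr_rge0// pmulr_lge0// pmulr_rge0.
rewrite lt_neqAle ge0 andbT; apply/eqP => e0.
have eE : 2 * eps * gd u = 0 by rewrite -{1}e0 mulr0 mul0r.
move: E; rewrite eE mulr0 => /esym/eqP.
rewrite paddr_eq0// ?mulr_ge0 ?(ltW d0)// mulf_eq0 (gt_eqF d0) /= => /andP[z1 z2].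
have zero z : spaceform_tangent eps (X u) z -> ip z z == 0 -> z = 0.
  move=> tz /eqP zz; apply/eqP/negPn/negP => z0.
  have sf := sX; case: sf => _ _ sf _; have := tangent_gt0 (sf u Uu) tz z0.
  by rewrite zz ltxx.
have n1 := zero _ (tn 1) z2.
have n0 : pt 0 n u = 0.
  have := zero _ (tangentD (tangentZ (gm 1 1 u) (tn 0)) (tangentZ (- gm 0 1 u) (tn 1))) z1.
  by rewrite n1 scaler0 addr0 => /eqP; rewrite scaler_eq0 (gt_eqF g1) => /eqP.
have h0 i j : sff3 i j u = 0.
  apply/eqP; rewrite -oppr_eq0 -(e3_weingarten sX Hn i j Uu); apply/eqP.
  by move: i; apply: forall2; rewrite ?n0 ?n1 ip0l.
have E0 := trace_sff3 sX Hn Uu; rewrite /gtrace !h0 in E0.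
have : 2 * f u * gd u = 0 by rewrite -E0; gen_gm => *; ring.
by apply/eqP; rewrite !mulf_neq0 ?pnatr_eq0 ?(mean_norm_neq0 sX Hn Uu) ?(lt0r_neq0 d0).
Qed.

(** Near a point where the normal derivative of [E3] does not vanish, this derivative and [E3]
    span the normal bundle. The tangential biharmonic equation provides a kernel for the
    component [b] of [B] along it, so [B = h E3]. The Codazzi equation along the derivative then
    says that [h] has rank at most one, and [codazzi_flat] with [c = 0] contradicts [eps > 0]. *)
Lemma cmc_parallel u j : U u -> perp_e3 j u = 0.
Proof.
move=> Uu; apply/eqP/negPn/negP => wn0.
have [V [oV Vu VU wV]] := smooth_neq0_nbhd oU Uu (smooth_perp_e3 sX Hn j) wn0.
have sV := local_surface_sub oV VU sX.
have HnV x : V x -> hv x != 0 by move=> /VU; exact: Hn.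
have e0 := cmc_eps_gt0 Uu.
pose w i x := ip (pt i n x) (perp_e3 j x).
have wE i x : V x -> w i x = ip (perp_e3 i x) (perp_e3 j x).
  by move=> Vx; rewrite (perp_e3_ip i Vx)//; exact: perp_e3_normal sV HnV _ _ Vx.
have wj x : V x -> w j x != 0.
  move=> Vx; rewrite wE//; apply: lt0r_neq0.
  exact: (normal_pos sV Vx (perp_e3_normal sV HnV j Vx) (wV x Vx)).
have w01 x : V x -> (w 0 x != 0) || (w 1 x != 0).
  have J : j = 0 \/ j = 1 by move: (j); apply: forall2; [left|right].
  by move=> /wj; case: J => -> ->; rewrite ?orbT.
pose b l k x := (ip (perp_e3 j x) (perp_e3 j x))^-1 * ip (Bv l k x) (perp_e3 j x).
(* B has no further component: the normal space has dimension two *)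
have Bdec l k x : V x -> Bv l k x = sff3 l k x *: n x + b l k x *: perp_e3 j x.
  move=> Vx; have Ux := VU _ Vx; apply/eqP; rewrite -subr_eq0 opprD addrA; apply/eqP.
  have WW : ip (perp_e3 j x) (perp_e3 j x) != 0 by rewrite -wE// wj.
  have nW := perp_e3_normal sX Hn j Ux; have We := perp_e3_orth sX Hn j Ux.
  have nB := second_ff_normal sX l k Ux.
  apply: (normal_dim e0 Ux nW) => //; last exact: wV.
  - apply: normalD; last by apply: normalN; apply: normalZ.
    by apply: normalD => //; apply: normalN; apply: normalZ; exact: nn.2.
  - by rewrite ipC.
  - rewrite !ipDr !ipNr !ipZr (e3_unit sX Hn Ux) (ipC _ _ (perp_e3 j x)) We /sff3.
    by rewrite mulr0 subr0 mulr1 ipC subrr.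
  - rewrite !ipDr !ipNr !ipZr We mulr0 subr0 /b (ipC _ (Bv l k x)) mulrAC mulVf//.
    by rewrite mul1r subrr.
(* the kernel is the vector dual to the form w *)
have bz x : V x -> [/\ b 0 0 x = 0, b 0 1 x = 0 & b 1 1 x = 0].
  move=> Vx; have Ux := VU _ Vx.
  have bC : b 1 0 x = b 0 1 x by rewrite /b (second_ffC sX 1 0 Ux).
  have pB i l k : ip (pt i n x) (Bv l k x) = w i x * b l k x.
    by rewrite Bdec// ipDr !ipZr (e3_orth sX Hn i Ux) mulr0 add0r mulrC.
  have T k := tangential_e3 sX Hn k Ux (b0 Ux).
  have T' k : gm 1 1 x * (w 0 x * b 0 k x) - gm 0 1 x * (w 0 x * b 1 k x + w 1 x * b 0 k x)
      + gm 0 0 x * (w 1 x * b 1 k x) = 0.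
    apply: (mulfI (mean_norm_neq0 sX Hn Ux)); rewrite mulr0 -[RHS](T k) /gtrace !pB !f_const//.
    by move: (w 0 x) (w 1 x) (b 0 k x) (b 1 k x) (f x) (gd x); gen_sff3; gen_gm => *; ring.
  apply: (kernel_traceless (gm11_gt0 sX Ux) (gdet_gt0 sX Ux) (w0 := w 0 x) (w1 := w 1 x)).
  - have := trace_orth sX Hn Ux (v := perp_e3 j x).
    rewrite ipC (perp_e3_orth sX Hn j Ux) => /(_ erefl).
    rewrite /gtrace (second_ffC sX 1 0 Ux) => E.
    rewrite -[RHS](mulr0 (ip (perp_e3 j x) (perp_e3 j x))^-1) -E /b.
    by move: (_^-1); gen_ip; gen_gm => *; ring.
  - by have := T' 0; rewrite bC.
  - by have := T' 1.
  - exact: w01.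
have bz' x l k : V x -> b l k x = 0.
  move=> Vx; have [z0 z1 z2] := bz x Vx.
  have bC : b 1 0 x = b 0 1 x by rewrite /b (second_ffC sX 1 0 (VU _ Vx)).
  by move: l k; apply: forall2; apply: forall2 => //; rewrite bC.
have BN x l k : V x -> Bv l k x = sff3 l k x *: n x.
  by move=> Vx; rewrite {1}Bdec// bz'// scale0r addr0.
have det0 x : V x -> sff3 0 0 x * sff3 1 1 x - sff3 0 1 x * sff3 0 1 x = 0 * gd x.
  move=> Vx; have Ux := VU _ Vx; rewrite mul0r.
  have nW := perp_e3_normal sX Hn j Ux; have We := perp_e3_orth sX Hn j Ux.
  (* Codazzi along the normal derivative of e3: h_1k w_0 = h_0k w_1 *)
  have dB i l k : ip (pt i (Bv l k) x) (perp_e3 j x) = sff3 l k x * w i x.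
    have H := has_partialZ (smooth_has_sd i (smooth_sff3 sV HnV l k) Vx)
      (normal_section_partial i (e3_section sV HnV) Vx).
    have H' := smooth_has_partial i (smooth_second_ff sV l k) Vx.
    rewrite (eq_on_partial sV Vx (fun y Vy => BN y l k Vy) H' H) ipDl !ipZl.
    by rewrite (ipC _ (n x)) We mulr0 add0r.
  have B0 l k : ip (Bv l k x) (perp_e3 j x) = 0.
    by rewrite BN// ipZl (ipC _ (n x)) We mulr0.
  have C k := codazzi sV 0 1 k Vx (perp_e3_normal sV HnV j Vx).
  have C' k : sff3 1 k x * w 0 x = sff3 0 k x * w 1 x.
    by have := C k; rewrite !dB !sum2 !B0 !mulr0 !addr0.
  apply: (rank_one_det (w0 := w 0 x) (w1 := w 1 x)); last exact: w01.
    by rewrite -C' (sff3C sX 1 0 Ux).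
  by rewrite -C'.
have fV x : V x -> f x ^+ 2 != 0 by move=> /VU Ux; rewrite expf_neq0// (mean_norm_neq0 sX Hn).
have := codazzi_flat sV HnV (fun x i k => BN x i k) (fun x k Vx => f_const k (VU _ Vx)) det0 fV Vu.
by rewrite addr0 => eE; move: e0; rewrite eE ltxx.
Qed.

Lemma e3_partial_ip u i l : U u -> ip (pt i n u) (pt l n u) = - \sum_a e3_tan i a u * sff3 l a u.
Proof.
move=> Uu; have W0 x j (Ux : U x) := cmc_parallel j Ux.
rewrite {1}(par_e3 W0 i Uu) ip_suml -sumrN; apply: eq_bigr => a _.
by rewrite ipZl ipC (e3_weingarten sX Hn l a Uu) mulrN.
Qed.

(** For a parallel [E3] the energy equation is [|h|^2 = 2 eps], and [|h|^2 = (trace h)^2 - 2 det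
    h]. *)
Lemma cmc_det u : U u ->
  sff3 0 0 u * sff3 1 1 u - sff3 0 1 u * sff3 0 1 u = (2 * f0 ^+ 2 - eps) * gd u.
Proof.
move=> Uu; have E := energy Uu; have tr := trace_sff3 sX Hn Uu.
have gi1 := inv_gdetK sX Uu; have d0 := gdet_gt0 sX Uu.
have [c00 c01] := e3_tanE sX 0 Uu; have [c10 c11] := e3_tanE sX 1 Uu.
rewrite /gtrace !e3_partial_ip// !sum2 c00 c01 c10 c11 (sff3C sX 1 0 Uu) in E.
rewrite /gtrace (sff3C sX 1 0 Uu) (f_eq Uu) in tr.
set dh := _ - _.
have E' : inv_gdet eps X u * ((2 * f0 * gd u) * (2 * f0 * gd u) - 2 * gd u * dh) = 2 * eps * gd u.
  by rewrite -tr -E /dh /gdet; gen_sff3; gen_gm; move: (inv_gdet _ _ _) => *; ring.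
have E2 : inv_gdet eps X u * gd u * (4 * f0 ^+ 2 * gd u - 2 * dh) = 2 * eps * gd u.
  by rewrite -E'; ring.
by move: E2; rewrite gi1 mul1r; lra.
Qed.

(** Where [h <> f g], [codazzi_flat] applies with [c = 2 f^2 - eps] and gives [f = 0]. *)
Lemma cmc_umbilical u i j : U u -> sff3 i j u = f u * gm i j u.
Proof.
move=> Uu; apply/eqP; rewrite -subr_eq0; apply/negPn/negP => t0.
have st := smooth_tls sX Hn i j.
have [V [oV Vu VU tV]] := smooth_neq0_nbhd (W := R^o) oU Uu st t0.
have sV := local_surface_sub oV VU sX.
have HnV x : V x -> hv x != 0 by move=> /VU; exact: Hn.
have W0 x k (Ux : U x) := cmc_parallel k Ux.
have BN x k l : V x -> Bv k l x = sff3 k l x *: n x.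
  move=> Vx; apply: (par_second_ff sX Hn W0 (VU _ Vx) (b0 (VU _ Vx))).
  by exists i, j; rewrite -subr_eq0; exact: tV.
have fV x : V x -> f x ^+ 2 != 2 * f0 ^+ 2 - eps.
  move=> Vx; have Ux := VU _ Vx; rewrite f_eq//; apply/eqP => E.
  have dt : tls eps X 0 0 x * tls eps X 1 1 x - tls eps X 0 1 x * tls eps X 0 1 x = 0.
    by rewrite (tls_det sX Hn (fun y => @cmc_det y) Ux) f_eq// -E subrr mul0r.
  have tr : gm 1 1 x * tls eps X 0 0 x - 2 * gm 0 1 x * tls eps X 0 1 x
      + gm 0 0 x * tls eps X 1 1 x = 0.
    have := tls_trace sX Hn Ux; rewrite /gtrace /= (tlsC sX 1 0 Ux) => <-.
    by gen_gm; move: (tls _ _ 0 0 x) (tls _ _ 0 1 x) (tls _ _ 1 1 x) => *; ring.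
  have [z0 z1 z2] := traceless_det0 (gm11_gt0 sX Ux) (gdet_gt0 sX Ux) tr dt.
  have : tls eps X i j x != 0 by exact: tV.
  apply/negP/negPn/eqP; move: (i) (j); apply: forall2; apply: forall2 => //.
  by rewrite (tlsC sX 1 0 Ux).
have := codazzi_flat sV HnV (fun x k l => BN x k l) (fun x k Vx => f_const k (VU _ Vx))
  (fun x Vx => cmc_det (VU _ Vx)) fV Vu.
move=> E; have := mean_norm_neq0 sX Hn Uu; rewrite f_eq// => /eqP; apply.
by apply/eqP; rewrite -sqrf_eq0; apply/eqP; lra.
Qed.

(** Compare [cmc_det] with [h = f g]. *)
Lemma cmc_mean_sqr u : U u -> f0 ^+ 2 = eps.
Proof.
move=> Uu; have d0 := gdet_gt0 sX Uu; have := cmc_det Uu.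
rewrite !cmc_umbilical// f_eq// => E.
apply: (mulIf (lt0r_neq0 d0)); move: E; rewrite /gdet; gen_gm => *; lra.
Qed.

(** As [E3] is parallel, [dE3] is minus the shape operator, which is [f Id]. *)
Lemma cmc_hv_partial u i : U u -> pt i hv u = - eps *: D i u.
Proof.
move=> Uu; rewrite hv_partial_const//.
have W0 x j (Ux : U x) := cmc_parallel j Ux.
rewrite (par_e3 W0 i Uu) sum2.
have gi1 := inv_gdetK sX Uu.
have C j : e3_tan j 0 u = - f u * (j == 0)%:R /\ e3_tan j 1 u = - f u * (j == 1)%:R.
  have [-> ->] := e3_tanE sX j Uu; rewrite !cmc_umbilical// (gmC eps X _ 0).
  move: j; apply: forall2; rewrite /= ?mulr1 ?mulr0 ?(gmC eps X 1 0).
    split; last by gen_gm; move: (inv_gdet _ _ _) (f u) => *; ring.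
    rewrite -[f u in RHS]mulr1 -gi1 /gdet.
    by gen_gm; move: (inv_gdet _ _ _) (f u) => *; ring.
  split; first by gen_gm; move: (inv_gdet _ _ _) (f u) => *; ring.
  rewrite -[f u in RHS]mulr1 -gi1 /gdet.
  by gen_gm; move: (inv_gdet _ _ _) (f u) => *; ring.
have fe : f u * - f u = - eps by rewrite f_eq// -(cmc_mean_sqr Uu) mulrN expr2.
have [-> ->] := C i; move: i; apply: forall2; rewrite /= !mulr1 !mulr0 scale0r.
  by rewrite addr0 scalerA fe.
by rewrite add0r scalerA fe.
Qed.

End CMC.

(** * Locality and invariance under change of coordinates *)

(** Once the pointwise equality of the values of [h] at [X] and [Y] is in the context, hiding [h
    X] and [h Y] behind variables keeps rewriting from unfolding them. *)
Ltac gen_XY h X Y := generalize (h Y); generalize (h X).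

Section Locality.
Variables (R : realType) (eps : R) (V : set 'rV[R]_2).
Hypothesis oV : open V.
Variables X Y : 'rV[R]_2 -> 'rV[R]_5.
Hypothesis XY : forall u, V u -> X u = Y u.
Implicit Types (u : 'rV[R]_2) (i j k l : 'I_2).

Lemma partial_local (W : normedModType R) i (F G : 'rV[R]_2 -> W) u :
  (forall x, V x -> F x = G x) -> V u -> partial i F u = partial i G u.
Proof.
by move=> FG Vu; apply: near_eq_derive; exact: (open_near oV Vu).
Qed.

Lemma metric_local u : V u -> metric eps X u = metric eps Y u.
Proof.
by move=> Vu; apply/matrixP => i j; rewrite !mxE !(partial_local _ XY Vu).
Qed.

Lemma ginv_local u : V u -> ginv eps X u = ginv eps Y u.
Proof. by move=> Vu; rewrite /ginv (metric_local Vu). Qed.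

Lemma christoffel_local k i j u : V u -> christoffel eps X k i j u = christoffel eps Y k i j u.
Proof.
move=> Vu; have G := ginv_local Vu.
have E a b c : dmetric eps X a b c u = dmetric eps Y a b c u.
  exact: (partial_local (W := R^o) _
    (fun x Vx => congr1 (fun M : 'M[R]_2 => M b c) (metric_local Vx)) Vu).
rewrite /christoffel; move: E G; gen_XY (@dmetric R eps) X Y; gen_XY (@ginv R eps) X Y.
by move=> gX gY dX dY E G; rewrite G; congr (_ * _); apply: eq_bigr => l _; rewrite !E.
Qed.

Lemma gauss_curvature_local u : V u -> gauss_curvature eps X u = gauss_curvature eps Y u.
Proof.
move=> Vu; have M := metric_local Vu.
have E a b c d : partial (V := R^o) a (christoffel eps X b c d) u =
   partial (V := R^o) a (christoffel eps Y b c d) u.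
  exact: (partial_local (W := R^o) _ (fun x Vx => christoffel_local b c d Vx) Vu).
have G b c d := christoffel_local b c d Vu.
have K l : riemann011 eps X l u = riemann011 eps Y l u.
  rewrite /riemann011; move: E G; gen_XY (@christoffel R eps) X Y => cX cY E G.
  by rewrite !E; congr (_ + _); apply: eq_bigr => k _; rewrite !G.
rewrite /gauss_curvature; move: M K; gen_XY (@riemann011 R eps) X Y; gen_XY (@metric R eps) X Y.
by move=> mX mY rX rY -> K; congr (_ / _); apply: eq_bigr => l _; rewrite K.
Qed.

Lemma nabla_local i xi eta u : (forall x, V x -> xi x = eta x) -> V u ->
  nabla (spaceform_proj eps) X i xi u = nabla (spaceform_proj eps) Y i eta u.
Proof.
by move=> xe Vu; rewrite /nabla (partial_local _ xe Vu) (XY Vu).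
Qed.

Lemma second_ff_local i j u : V u ->
  second_ff eps (spaceform_proj eps) X i j u = second_ff eps (spaceform_proj eps) Y i j u.
Proof.
move=> Vu; rewrite /second_ff (nabla_local i (fun x Vx => partial_local j XY Vx) Vu).
have G b c d := christoffel_local b c d Vu; have D a := partial_local a XY Vu.
move: G D; gen_XY (@christoffel R eps) X Y => cX cY G D.
by congr (_ - _); apply: eq_bigr => k _; rewrite G D.
Qed.

Lemma tension_local u : V u ->
  tension eps (spaceform_proj eps) X u = tension eps (spaceform_proj eps) Y u.
Proof.
move=> Vu; have G := ginv_local Vu; have S a b := second_ff_local a b Vu.
rewrite /tension; move: G S; gen_XY (@second_ff R eps (spaceform_proj eps)) X Y.
gen_XY (@ginv R eps) X Y => gX gY bX bY -> S.
by apply: eq_bigr => i _; apply: eq_bigr => j _; rewrite S.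
Qed.

Lemma mcv_local u : V u -> mcv eps X u = mcv eps Y u.
Proof. by move=> Vu; rewrite /mcv /mean_curvature (tension_local Vu). Qed.

Lemma fmc_local u : V u -> fmc eps X u = fmc eps Y u.
Proof. by move=> Vu; rewrite /fmc (mcv_local Vu). Qed.

Lemma E3_local u : V u -> E3 eps X u = E3 eps Y u.
Proof. by move=> Vu; rewrite /E3 (fmc_local Vu) (mcv_local Vu). Qed.

Lemma grad_local (h h' : 'rV[R]_2 -> R) u : (forall x, V x -> h x = h' x) -> V u ->
  grad eps X h u = grad eps Y h' u.
Proof.
move=> hh' Vu; have G := ginv_local Vu.
have D a := partial_local a XY Vu.
have H a := partial_local (W := R^o) a hh' Vu.
rewrite /grad; move: G D H; gen_XY (@ginv R eps) X Y => gX gY ->.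
move=> D H; apply: eq_bigr => i _; apply: eq_bigr => j _.
by rewrite H D.
Qed.

Lemma normal_part_local u v : V u -> normal_part eps X u v = normal_part eps Y u v.
Proof.
move=> Vu; have G := ginv_local Vu; have D a := partial_local a XY Vu.
rewrite /normal_part; move: G; gen_XY (@ginv R eps) X Y => gX gY ->.
by congr (_ - _); apply: eq_bigr => i _; apply: eq_bigr => j _; rewrite (D i) (D j).
Qed.

Lemma nabla_perp_local i xi eta u : (forall x, V x -> xi x = eta x) -> V u ->
  nabla_perp eps X i xi u = nabla_perp eps Y i eta u.
Proof.
by move=> xe Vu; rewrite /nabla_perp (normal_part_local _ Vu) (nabla_local _ xe Vu).
Qed.

Lemma shape_local u v : V u -> Defs.shape eps X v u = Defs.shape eps Y v u.
Proof.
move=> Vu; rewrite /Defs.shape (ginv_local Vu); have S a b := second_ff_local a b Vu.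
move: S; gen_XY (@second_ff R eps (spaceform_proj eps)) X Y => bX bY S.
by congr (_ *m _); apply/matrixP => i j; rewrite !mxE S.
Qed.

Lemma bitension_local u : V u -> bitension eps X u = bitension eps Y u.
Proof.
move=> Vu.
have N a x Vx := nabla_local (u := x) a (fun x Vx => tension_local (u := x) Vx) Vx.
have NN a b := nabla_local a (fun x Vx => N b x Vx) Vu.
have Nu a := N a u Vu.
have D a := partial_local a XY Vu; have G b c d := christoffel_local b c d Vu.
have T := tension_local Vu; have I := ginv_local Vu.
rewrite /bitension; move: NN Nu D G T I.
gen_XY (@ginv R eps) X Y; gen_XY (@christoffel R eps) X Y.
gen_XY (@nabla R (spaceform_proj eps)) X Y.
gen_XY (@tension R eps (spaceform_proj eps)) X Y.
move=> tX tY nX nY cX cY gX gY NN Nu D G T I; rewrite I T.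
apply: eq_bigr => i _; apply: eq_bigr => j _; rewrite NN (D i) (D j); congr (_ *: (_ - _ - _)).
by apply: eq_bigr => k _; rewrite G Nu.
Qed.

Lemma flat_normal_local u : V u -> flat_normal_at eps X u -> flat_normal_at eps Y u.
Proof.
move=> Vu flat U xi oU Uu [sxi nxi].
have oW : open (U `&` V) by exact: openI.
have E : curv_perp eps X xi u = curv_perp eps Y xi u.
  have N a x Vx := @nabla_perp_local a xi xi x (fun y _ => erefl) Vx.
  have NN a b := nabla_perp_local a (fun x Vx => N b x Vx) Vu.
  by rewrite /curv_perp !NN.
have nf : normal_field eps (U `&` V) X xi.
  split; first by apply: smooth_sub sxi => x [].
  move=> x [Ux Vx]; have [tx nx] := nxi x Ux; rewrite (XY Vx); split; first exact: tx.
  by move=> i; rewrite (partial_local i XY Vx); exact: nx.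
exact: (etrans (esym E) (flat _ _ oW (conj Uu Vu) nf)).
Qed.

Lemma row_free_local u : V u -> row_free (\matrix_(i < 2) partial i X u) ->
  row_free (\matrix_(i < 2) partial i Y u).
Proof.
move=> Vu; have D a := partial_local a XY Vu.
have -> : (\matrix_(i < 2) partial i X u) = \matrix_(i < 2) partial i Y u.
  by apply/row_matrixP => i; rewrite !rowK D.
exact.
Qed.

End Locality.

Section ChartInvariance.
Variables (R : realType) (eps : R) (U V : set 'rV[R]_2).
Variables (X Y : 'rV[R]_2 -> 'rV[R]_5) (t : 'rV[R]_2 -> 'rV[R]_2).
Hypotheses (sX : local_surface eps U X) (sY : local_surface eps V Y).
Hypotheses (smt : smooth_on V t) (tV : forall u, V u -> U (t u)).
Hypothesis XY : forall u, V u -> Y u = X (t u).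
Local Notation ip := (dot eps).

Let oV := surf_open sY.

Definition jac i a u : R := sd i (fun x => t x 0 a) u.

Lemma has_partial_t i u : V u -> has_partial i t u (\row_a jac i a u).
Proof.
move=> Vu; apply/has_partial_coordP => a; rewrite mxE.
exact: (smooth_has_sd i ((smooth_coordP oV t).1 smt a) Vu).
Qed.

Lemma has_partial_reparam (W : normedModType R) i (F : 'rV[R]_2 -> W) u :
  smooth_on U F -> V u ->
  has_partial i (F \o t) u (jac i 0 u *: pt 0 F (t u) + jac i 1 u *: pt 1 F (t u)).
Proof.
move=> sF Vu; apply: has_partial_eq (has_partial_comp (has_partial_t i Vu)
  (smooth_diff sF (tV Vu))) _.
by rewrite sum2 !mxE.
Qed.

Lemma partial_reparam i u : V u ->
  pt i Y u = jac i 0 u *: pt 0 X (t u) + jac i 1 u *: pt 1 X (t u).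
Proof.
move=> Vu; exact: (eq_on_partial sY Vu XY (surf_partial sY i Vu)
  (has_partial_reparam i (surf_smooth sX) Vu)).
Qed.

(** The metric determinants differ by the square of the Jacobian determinant. *)
Lemma jac_det_neq0 u : V u -> jac 0 0 u * jac 1 1 u - jac 0 1 u * jac 1 0 u != 0.
Proof.
move=> Vu; have := gdet_gt0 sY Vu; rewrite /gdet !gmE !partial_reparam//.
rewrite !(ipDl, ipDr, ipZl, ipZr) (ipC _ (pt 1 X _) (pt 0 X _)).
set g := (X in 0 < X).
have -> : g = (jac 0 0 u * jac 1 1 u - jac 0 1 u * jac 1 0 u) ^+ 2 *
    (ip (pt 0 X (t u)) (pt 0 X (t u)) * ip (pt 1 X (t u)) (pt 1 X (t u))
    - ip (pt 0 X (t u)) (pt 1 X (t u)) ^+ 2).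
  rewrite /g; gen_ip; move: (jac 0 0 u) (jac 0 1 u) (jac 1 0 u) (jac 1 1 u) => *; ring.
by apply: contraTneq => ->; rewrite expr0n mul0r ltxx.
Qed.

Lemma normal_reparam u v : V u -> normal_at eps X (t u) v <-> normal_at eps Y u v.
Proof.
move=> Vu; rewrite /normal_at XY//; split=> -[tv nv]; split => // i.
  by rewrite partial_reparam// ipDr !ipZr !nv !mulr0 addr0.
have := nv 0; have := nv 1; rewrite !partial_reparam// !(ipDr, ipZr).
have jn := jac_det_neq0 Vu; move: jn.
move: (jac 0 0 u) (jac 0 1 u) (jac 1 0 u) (jac 1 1 u) => a b c d jn E1 E0.
move: i; apply: forall2; apply: (mulfI jn); rewrite mulr0.
  move: E0 E1; gen_ip => x y E0 E1.
  by transitivity (d * (a * y + b * x) - b * (c * y + d * x)); [ring | rewrite E0 E1 !mulr0 subrr].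
move: E0 E1; gen_ip => x y E0 E1.
by transitivity (a * (c * y + d * x) - c * (a * y + b * x)); [ring | rewrite E0 E1 !mulr0 subrr].
Qed.

(** The second derivatives of [t] only contribute tangent vectors. *)
Lemma hess_reparam i j u v : V u -> normal_at eps X (t u) v ->
  ip (pt i (pt j Y) u) v =
  jac i 0 u * (jac j 0 u * ip (sff eps X 0 0 (t u)) v + jac j 1 u * ip (sff eps X 0 1 (t u)) v)
  + jac i 1 u * (jac j 0 u * ip (sff eps X 1 0 (t u)) v + jac j 1 u * ip (sff eps X 1 1 (t u)) v).
Proof.
move=> Vu nv; have smX := surf_smooth sX.
have sjac a := smooth_sd j ((smooth_coordP oV t).1 smt a).
have H := has_partialD
  (has_partialZ (smooth_has_sd i (sjac 0) Vu) (has_partial_reparam i (smooth_partial 0 smX) Vu))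
  (has_partialZ (smooth_has_sd i (sjac 1) Vu) (has_partial_reparam i (smooth_partial 1 smX) Vu)).
have H' := surf_partial2 sY i j Vu.
rewrite (eq_on_partial sY Vu (fun x Vx => partial_reparam j Vx) H' H).
rewrite !(ipDl, ipZl) /= !(normal_hess sX _ _ (tV Vu) nv) !(ipC _ (pt _ X (t u))) !nv.2.
rewrite -!/(jac _ _ _) (second_ffC sX 1 0 (tV Vu)).
gen_ip; move: (jac i 0 u) (jac i 1 u) (jac j 0 u) (jac j 1 u) (sd _ _ _) (sd _ _ _) => *; ring.
Qed.

(** Both vectors are normal, and by [trace_second_ff] they have the same product with every
    normal vector, in particular with their difference. *)
Lemma mean_curvature_reparam u : V u -> mean_vec eps Y u = mean_vec eps X (t u).
Proof.
move=> Vu; have Utu := tV Vu.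
have nX := (mean_curvature_section sX).2 _ Utu.
have nY := (normal_reparam _ Vu).2 ((mean_curvature_section sY).2 _ Vu).
apply/eqP; rewrite -subr_eq0; apply/negPn/negP => w0; set w := _ - _ in w0.
have wE : w = mean_vec eps Y u - mean_vec eps X (t u) by [].
have nw : normal_at eps X (t u) w by apply: normalD => //; exact: normalN.
clearbody w.
have nw' := (normal_reparam _ Vu).1 nw.
have := trace_second_ff sX w Utu; have := trace_second_ff sY w Vu.
rewrite /gtrace -!(normal_hess sY _ _ Vu nw') !hess_reparam//.
rewrite (second_ffC sX 1 0 Utu) /gdet !(gmE eps Y) !partial_reparam//.
rewrite !(ipDl, ipDr, ipZl, ipZr) -!(gmE eps X) (gmC eps X 1 0).
have jn := jac_det_neq0 Vu; have d0 := gdet_gt0 sX Utu => EY EX.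
have : ip w w = 0.
  apply: (mulfI (x := 2 * gdet eps X (t u) * (jac 0 0 u * jac 1 1 u - jac 0 1 u * jac 1 0 u) ^+ 2)).
    by rewrite !mulf_neq0 ?pnatr_eq0 ?(lt0r_neq0 d0) ?expf_neq0.
  rewrite mulr0 {1}wE ipDl ipNl mulrBr.
  have EX' := congr1 (fun z => (jac 0 0 u * jac 1 1 u - jac 0 1 u * jac 1 0 u) ^+ 2 * z) EX.
  move: EX' EY => /=; rewrite /gdet.
  clear -R; gen_ip; gen_gm; move: (jac 0 0 u) (jac 0 1 u) (jac 1 0 u) (jac 1 1 u).
  by move=> *; lra.
by apply/eqP; rewrite (gt_eqF (normal_pos sX Utu nw w0)).
Qed.

End ChartInvariance.

(** * Charts and connectedness *)

Lemma open_within (S T : topologicalType) (A : set S) (g : S -> T) (O : set T) :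
  open A -> {within A, continuous g} -> open O -> open (A `&` g @^-1` O).
Proof.
by move=> oA; rewrite continuous_open_subspace// => /(continuous_inP _ oA); exact.
Qed.

(** A ball is the union of segments through its centre. *)
Lemma ball_connected (R : realType) n (u : 'rV[R]_n) (d : R) : 0 < d -> connected (ball u d).
Proof.
move=> d0; pose seg (p : 'rV[R]_n) := (fun s : R => u + s *: (p - u)) @` `[0, 1].
have E : ball u d = \bigcup_(p in ball u d) seg p.
  apply/seteqP; split => [p pd|x [p pd] [s]].
    exists p => //; exists 1; first by rewrite /= in_itv /= ler01 lexx.
    by rewrite scale1r addrC subrK.
  rewrite /= in_itv /= => /andP[s0 s1] <-; move: pd; rewrite -ball_normE /= => pd.
  rewrite opprD addrA subrr sub0r normrN normrZ ger0_norm// distrC.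
  by rewrite (le_lt_trans _ pd)// ler_piMl.
rewrite E; apply: bigcup_connected.
  exists u => p _; exists 0; first by rewrite /= in_itv /= lexx ler01.
  by rewrite scale0r addr0.
move=> p _; apply: connected_continuous_connected; first exact: segment_connected.
apply: continuous_subspaceT => s.
have dl : differentiable (fun t : R^o => u + t *: (p - u)) s.
  by apply: differentiableD => //; exact: differentiable_cst.
exact: (differentiable_continuous dl).
Qed.

Section Charts.
Variables (R : realType) (eps : R) (M : surface R) (phi : M -> 'rV[R]_5).
Hypothesis himm : immersion eps phi.
Implicit Types c : chart R M.
Local Notation X c := (phi \o par c).

Lemma chart_surface c : atlas c -> local_surface eps (dom c) (X c).
Proof.
move=> ac; have [sf sm rf] := himm; have [od _ _ _ _] := atlas_chart ac.
split => //; [exact: sm | by move=> u _; exact: sf |].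
move=> u du; have := rf c ac u du.
have -> : (\matrix_(i < 2) partial i (X c) u) = \matrix_(i < 2) pt i (X c) u.
  by apply/row_matrixP => i; rewrite !rowK ptE.
exact.
Qed.

Lemma dom_open c : atlas c -> open (dom c).
Proof. by move=> /atlas_chart[]. Qed.

Lemma chart_open c (V : set 'rV[R]_2) : atlas c -> open V -> V `<=` dom c ->
  open (par c @` V).
Proof.
move=> ac oV Vd; have [od op cK cp e3_tan] := atlas_chart ac.
rewrite (_ : par c @` V = (par c @` dom c) `&` (Defs.coord c @^-1` V)); first exact: open_within.
apply/seteqP; split => [_ [u Vu <-]|_ [[u du <-]]].
  by split; [exists u => //; exact: Vd | rewrite /= cK//; exact: Vd].
by rewrite /= cK// => Vu; exists u.
Qed.

(** The points where [Q] holds form an open set, and so do those where it fails; [M] is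
    connected. *)
Lemma chart_clopen (Q : chart R M -> 'rV[R]_2 -> Prop) :
  (forall c c' u u', atlas c -> atlas c' -> dom c u -> dom c' u' ->
     par c u = par c' u' -> Q c u -> Q c' u') ->
  (forall c u, atlas c -> dom c u -> exists V, [/\ open V, V u, V `<=` dom c &
     forall x, V x -> Q c x <-> Q c u]) ->
  forall c u c' u', atlas c -> atlas c' -> dom c u -> dom c' u' -> Q c u -> Q c' u'.
Proof.
move=> inv loc c0 u0 c' u' ac0 ac' du0 du' Q0.
(* the points where Q holds, in some chart and hence in every chart *)
pose S := [set p : M | exists c u, [/\ atlas c, dom c u, par c u = p & Q c u]].
have nb c u (B : set M) : atlas c -> dom c u ->
    (exists V, [/\ open V, V u, V `<=` dom c & forall x, V x -> B (par c x)]) ->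
    nbhs (par c u) B.
  move=> ac du [V [oV Vu Vd VB]]; rewrite nbhsE; exists (par c @` V).
    by split; [exact: chart_open | exists u].
  by move=> _ [x Vx <-]; exact: VB.
have oS : open S.
  rewrite openE => _ [c [u [ac du <- Qu]]]; apply: nb => //.
  have [V [oV Vu Vd VQ]] := loc c u ac du; exists V; split => // x Vx.
  by exists c, x; split => //; [exact: Vd | exact/VQ].
have oC : open (~` S).
  rewrite openE => p nSp; have [c ac [u du up]] := atlas_cover p.
  rewrite -up; apply: nb => //; have [V [oV Vu Vd VQ]] := loc c u ac du.
  exists V; split => // x Vx [c1 [u1 [ac1 du1 e1 Q1]]]; apply: nSp.
  exists c, u; split => //; apply/(VQ x Vx).
  by apply: (inv c1 c u1 x) => //; exact: Vd.
have ST : S = setT.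
  have conn : connected [set: M] := @surface_connected R M.
  apply: (conn S).
  - by exists (par c0 u0), c0, u0.
  - by exists S => //; rewrite setTI.
  - by exists S; [rewrite -openC | rewrite setTI].
have : S (par c' u') by rewrite ST.
by move=> [c [u [ac du e Qu]]]; exact: inv Qu.
Qed.

(** The transition between the charts is the change of coordinates of [mean_curvature_reparam]. *)
Lemma mean_curvature_chart c c' u u' : atlas c -> atlas c' -> dom c u -> dom c' u' ->
  par c u = par c' u' -> mean_vec eps (X c) u = mean_vec eps (X c') u'.
Proof.
move=> ac ac' du du' e.
have [od op cK cp e3_tan] := atlas_chart ac; have [od' op' cK' cp' cc'] := atlas_chart ac'.
pose V := dom c `&` par c @^-1` (par c' @` dom c').
have oV : open V by exact: open_within.
have Vu : V u by split => //; exists u'.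
have tE x : V x -> dom c' ((Defs.coord c' \o par c) x) /\
    par c' ((Defs.coord c' \o par c) x) = par c x.
  by move=> [_ [y dy /= yE]]; rewrite /= -yE cK'.
have sY : local_surface eps V (X c).
  by apply: (local_surface_sub oV _ (chart_surface ac)) => x [].
rewrite (mean_curvature_reparam (chart_surface ac') sY (t := Defs.coord c' \o par c)) //=.
- by rewrite e cK'.
- exact: atlas_smooth.
- by move=> x /tE[].
- by move=> x /tE[_ /= ->].
Qed.

End Charts.

(** * A coordinate ball as a surface *)

Section SubTopology.
Variables (T : topologicalType) (A : set T).

Lemma subtype_nbhs (p : A) (N : set A) :
  nbhs p N <-> exists Z : set T, [/\ open Z, Z (\val p) & forall q : A, Z (\val q) -> N q].
Proof.
split.
  rewrite nbhsE => -[W [[Z oZ <-] Op] WN]; exists Z; split => //.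
move=> [Z [oZ Op ON]]; rewrite nbhsE; exists (\val @^-1` Z); last by move=> q; exact: ON.
by split => //; exists Z.
Qed.

Lemma subtype_hausdorff : hausdorff_space T -> hausdorff_space A.
Proof.
move=> hT p q cpq; apply: val_inj; apply: hT => B C.
rewrite !nbhsE => -[B' [oB Bp] BB] [C' [oC Cq] CC].
have [z [Bz Cz]] : (\val @^-1` B' `&` \val @^-1` C' : set A) !=set0.
  apply: cpq.
  - by apply/subtype_nbhs; exists B'.
  - by apply/subtype_nbhs; exists C'.
by exists (\val z); split; [exact: BB | exact: CC].
Qed.

Lemma subtype_second_countable : @second_countable T -> @second_countable A.
Proof.
move=> [B cB [oB bB]]; exists ((fun Z : set T => (\val @^-1` Z : set A)) @` B).
  exact: card_le_trans (card_image_le _ _) cB.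
split; first by move=> _ [Z BO <-]; exists Z => //; exact: oB.
move=> p N /subtype_nbhs [Z [oZ Op ON]].
have [W [BW Wp] WO] := bB (\val p) Z (open_nbhs_nbhs (conj oZ Op)).
exists (\val @^-1` W); first by split => //; exists W.
by move=> q /= /WO /ON.
Qed.

(** The open sets of the subtype are traces of open sets, so a clopen set of the subtype is one
    of [A]. *)
Lemma subtype_connected : connected A -> connected [set: A].
Proof.
move=> cA B [b Bb] [B1 [Z oZ ZB1]] + [B2 /closed_openC [Z' oZ' ZB2]].
rewrite !setTI => BB1 BB2.
have inB (q : A) : B q <-> Z (\val q) by rewrite BB1 -ZB1.
have inB' (q : A) : B q <-> ~ Z' (\val q).
  have -> : Z' (\val q) = (~` B2) q by rewrite -ZB2.
  by rewrite BB2 /setC /= notK.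
have AZ : A `&` Z = A.
  apply: cA.
  - by exists (\val b); split; [exact: set_mem (valP b) | exact/inB].
  - by exists Z.
  - exists (~` Z'); first exact: open_closedC.
    apply/seteqP; split => [x [Ax Zx]|x [Ax Zx]]; split => //.
      by apply/(inB' (SigSub (mem_set Ax)))/inB.
    by apply/(inB (SigSub (mem_set Ax)))/inB'.
apply/seteqP; split => // q _; apply/inB.
have AZq : (A `&` Z) (\val q) = A (\val q) := congr1 (fun S : set T => S (\val q)) AZ.
have : (A `&` Z) (\val q) by rewrite AZq; exact: set_mem (valP q).
by case.
Qed.

End SubTopology.

Lemma smooth_id (R : realType) (U : set 'rV[R]_2) : smooth_on U (fun x : 'rV[R]_2 => x).
Proof.
move=> s u _; case: (lastP s) => [|s' i]; first by have [] := has_partial_id 0 u.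
rewrite foldr_rcons ptfE.
have -> : pt i (fun x : 'rV[R]_2 => x) = fun=> delta_mx 0 i.
  by apply/funext => x; apply: has_partialE; exact: has_partial_id.
by apply: (smooth_cst (U := setT) (delta_mx 0 i : 'rV[R]_2)).
Qed.

Section SubSurface.
Variables (R : realType) (M : surface R) (c : chart R M) (u0 : 'rV[R]_2) (d : R).
Hypotheses (ac : atlas c) (d0 : 0 < d) (Vd : ball u0 d `<=` dom c).
Local Notation V := (ball u0 d).
Local Notation A := (par c @` V).

Let pA (u : 'rV[R]_2) (Vu : V u) : par c u \in A := mem_set (ex_intro2 _ _ u Vu erefl).
Definition sub_base : A := SigSub (pA (ballxx u0 d0)).
Definition sub_par (u : 'rV[R]_2) : A := insubd sub_base (par c u).
(** A coordinate ball of [M], as an open subset, with the restriction of one chart. Outside the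
    ball the parametrization takes the default value [sub_base]. *)
Definition sub_chart : chart R A := Chart V sub_par (fun p => Defs.coord c (\val p)).

Lemma sub_parE u : V u -> \val (sub_par u) = par c u.
Proof. by move=> Vu; rewrite /sub_par insubdK//; exact: pA. Qed.

Let oV : open V. Proof. exact: ball_open. Qed.

Lemma sub_image : sub_par @` V = [set: A].
Proof.
apply/seteqP; split => // p _.
have [u Vu up] := set_mem (valP p); exists u => //.
by apply: val_inj; rewrite sub_parE.
Qed.

Lemma sub_is_chart : is_chart sub_chart.
Proof.
have [od op cK cp e3_tan] := atlas_chart ac.
split => /=; [exact: oV | by rewrite sub_image; exact: openT | | |].
- by move=> u Vu; rewrite sub_parE// cK//; exact: Vd.
- rewrite continuous_open_subspace; last exact: oV.
  move=> u /set_mem Vu N /subtype_nbhs [Z [oZ Zu ZN]].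
  rewrite sub_parE// in Zu.
  have oW := open_within od cp oZ.
  have : nbhs u (V `&` (dom c `&` par c @^-1` Z)).
    apply: filterI; first by apply: open_nbhs_nbhs; split => //; exact: oV.
    by apply: open_nbhs_nbhs; split => //; split => //; exact: Vd.
  by apply: filterS => x [Vx [_ Zx]]; apply: ZN; rewrite sub_parE.
- rewrite sub_image continuous_open_subspace; last exact: openT.
  move=> p _ N; rewrite nbhsE => -[W [oW Wp] WN].
  have oS := open_within op e3_tan oW; rewrite /=.
  apply/subtype_nbhs; exists ((par c @` dom c) `&` Defs.coord c @^-1` W); split => //.
    split => //; have [u Vu up] := set_mem (valP p).
    by exists u => //; exact: Vd.
  by move=> q [_ Wq]; exact: WN.
Qed.

Lemma sub_transition : smooth_transition sub_chart sub_chart.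
Proof.
rewrite /smooth_transition.
have -> : dom sub_chart `&` par sub_chart @^-1` (par sub_chart @` dom sub_chart) = V.
  by apply/seteqP; split => [x []//|x Vx]; split => //; exists x.
apply: (smooth_eq oV) (@smooth_id R V) => u Vu /=.
by rewrite sub_parE//; have [_ _ cK _ _] := atlas_chart ac; rewrite cK//; exact: Vd.
Qed.

Lemma A_connected : connected A.
Proof.
have [od op cK cp e3_tan] := atlas_chart ac.
apply: connected_continuous_connected; first exact: ball_connected.
exact: continuous_subspaceW Vd cp.
Qed.

Definition sub_surface : surface R.
Proof.
apply: (@Surface R (A : topologicalType) [set sub_chart]).
- by exists sub_base.
- exact: subtype_connected A_connected.
- exact: subtype_hausdorff (@surface_hausdorff R M).
- exact: subtype_second_countable (@surface_second_countable R M).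
- by move=> _ ->; exact: sub_is_chart.
- move=> p; exists sub_chart => //.
  by have [u Vu <-] : (sub_par @` V) p by [rewrite sub_image]; exists u.
- by move=> _ _ -> ->; exact: sub_transition.
Defined.

End SubSurface.

(** * Constancy of the mean curvature *)

Section NonCMC.
Variables (R : realType) (eps : R).
Variables (U : set 'rV[R]_2) (X : 'rV[R]_2 -> 'rV[R]_5).
Hypothesis sX : local_surface eps U X.
Implicit Types (u : 'rV[R]_2) (i j k : 'I_2).

Lemma metric_unit u : U u -> metric eps X u \in unitmx.
Proof. by move=> Uu; rewrite unitmxE det_metric unitfE (lt0r_neq0 (gdet_gt0 sX Uu)). Qed.

(** The products of the gradient with the coordinate fields are the partial derivatives. *)
Lemma grad_eq0 u : U u -> grad eps X (fmc eps X) u = 0 -> forall k, sd k (mean_norm eps X) u = 0.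
Proof.
move=> Uu; have fE : fmc eps X = mean_norm eps X by apply/funext => x; rewrite mean_normE.
rewrite /grad fE => g0.
have {}g0 : \sum_i (\sum_j gup eps X i j u * sd j (mean_norm eps X) u) *: pt i X u = 0.
  rewrite -[RHS]g0; apply: eq_bigr => i _; rewrite scaler_suml.
  by apply: eq_bigr => j _; rewrite gupE sdE ptE.
rewrite !sum2 in g0.
have P k := congr1 (fun z => dot eps z (pt k X u)) g0.
have [g00 g01 g10 g11] := ginvE sX Uu.
have gi1 := inv_gdetK sX Uu.
move: (P 0) (P 1); rewrite !ipDl !ipZl !ip0l -!gmE g00 g01 g10 g11 (gmC eps X 1 0) => P0 P1.
apply: forall2.
  rewrite -P0 -[LHS]mul1r -gi1 /gdet; gen_gm; gen_pt; move: (inv_gdet _ _ _) => *; ring.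
rewrite -P1 -[LHS]mul1r -gi1 /gdet; gen_gm; gen_pt; move: (inv_gdet _ _ _) => *; ring.
Qed.

Lemma shape_scalar u : U u ->
  Defs.shape eps X (E3 eps X u) u = (fmc eps X u)%:M ->
  forall i j, sff3 eps X i j u = mean_norm eps X u * fff eps X i j u.
Proof.
move=> Uu S i j; have := congr1 (fun A => (metric eps X u *m A) i j) S.
rewrite /Defs.shape /ginv mulKVmx ?metric_unit// mul_mx_scalar.
by rewrite [LHS]mxE [RHS]mxE dotE sffE e3E mean_normE metricE.
Qed.

End NonCMC.

Section Generic.
Variables (R : realType) (eps : R) (M : surface R) (phi : M -> 'rV[R]_5).
Hypothesis himm : immersion eps phi.
Hypothesis hW : W_surface eps phi.
Hypothesis hflat : flat_normal_bundle eps phi.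
Hypothesis hcurv : curvature_condition eps phi.
Hypothesis hbih : biharmonic eps phi.
Variables (c : chart R M) (u0 : 'rV[R]_2) (d : R).
Hypotheses (ac : atlas c) (d0 : 0 < d) (Vd : ball u0 d `<=` dom c).
Local Notation V := (ball u0 d).
Local Notation X := (phi \o par c).
Let S := sub_surface ac d0 Vd.
Let psi (p : S) : 'rV[R]_5 := phi (\val p).
Let Y : 'rV[R]_2 -> 'rV[R]_5 := psi \o par (sub_chart c u0 d0).

Let XY u : V u -> X u = Y u.
Proof. by move=> Vu; rewrite /Y /psi /= sub_parE. Qed.

Let oV : open V := ball_open u0 d.
Let sX : local_surface eps V X := local_surface_sub oV Vd (chart_surface himm ac).

Let everywhere_sub Q : (forall u, V u -> Q Y u) -> everywhere psi Q.
Proof. by move=> H _ -> u; exact: H. Qed.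

(** A coordinate ball is a surface to which (P) applies. Its parametrization agrees on the ball
    with the one of [M], and all conditions are local. *)
Lemma generic_not_biharmonic : statement_P R ->
  (forall u, V u -> mean_vec eps X u != 0) ->
  (forall u, V u -> exists k, sd k (mean_norm eps X) u != 0) ->
  (forall u, V u -> exists i j, sff3 eps X i j u != mean_norm eps X u * fff eps X i j u) ->
  (forall u, V u -> exists j, perp_e3 eps X j u != 0) -> False.
Proof.
move=> hP Hn Hf Hh Hw; apply: (hP eps S psi).
- split.
  + by move=> p; case: himm => sf _ _; exact: sf.
  + move=> _ -> /=; apply: (smooth_eq oV XY); exact: surf_smooth sX.
  + apply: everywhere_sub => u Vu; apply: (row_free_local oV XY Vu).
    by case: himm => _ _; apply => //; exact: Vd.
- apply: everywhere_sub => u Vu; split.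
  + by rewrite -(mcv_local eps oV XY Vu) mean_vecE; exact: Hn.
  + rewrite -(grad_local eps oV XY (fun x Vx => fmc_local eps oV XY Vx) Vu).
    have [k fk] := Hf u Vu; apply: contra_neq fk => g0.
    exact: (grad_eq0 sX Vu g0).
  + rewrite -(E3_local eps oV XY Vu) -(fmc_local eps oV XY Vu) -(shape_local eps oV XY _ Vu).
    have [i [j hij]] := Hh u Vu; apply: contra_neq hij => s0.
    exact: (shape_scalar sX Vu s0).
- have [W [sW gW W0]] := hW; exists W; split => //; apply: everywhere_sub => u Vu.
  rewrite -(fmc_local eps oV XY Vu) -(gauss_curvature_local eps oV XY Vu).
  by apply: W0 => //; exact: Vd.
- apply: everywhere_sub => u Vu; apply: (flat_normal_local oV XY Vu).
  by apply: hflat => //; exact: Vd.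
- apply: everywhere_sub => u Vu.
  rewrite -(fmc_local eps oV XY Vu) -(gauss_curvature_local eps oV XY Vu).
  by apply: hcurv => //; exact: Vd.
- apply: everywhere_sub => u Vu; have [j wj] := Hw u Vu; exists j.
  rewrite -(nabla_perp_local eps oV XY j (fun x Vx => E3_local eps oV XY Vx) Vu).
  have -> : E3 eps X = e3 eps X by apply/funext => x; rewrite e3E.
  by rewrite (nabla_perp_e3 sX Hn j Vu).
- apply: everywhere_sub => u Vu; rewrite -(bitension_local eps oV XY Vu).
  by apply: hbih => //; exact: Vd.
Qed.

End Generic.

Section MeanConstant.
Variables (R : realType) (eps : R) (M : surface R) (phi : M -> 'rV[R]_5).
Hypothesis hP : statement_P R.
Hypothesis himm : immersion eps phi.
Hypothesis hW : W_surface eps phi.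
Hypothesis hflat : flat_normal_bundle eps phi.
Hypothesis hcurv : curvature_condition eps phi.
Hypothesis hbih : biharmonic eps phi.
Local Notation X c := (phi \o par c).
Implicit Types c : chart R M.

(** The successive shrinkings described above: first [df <> 0], then [h <> f g], then a
    nonvanishing normal derivative of [E3]. Each of them is possible, as otherwise
    [umbilical_const] or [par_curvature] would apply to the open set reached so far. *)
Lemma mean_norm_critical c u k : atlas c -> dom c u -> mean_vec eps (X c) u != 0 ->
  sd k (mean_norm eps (X c)) u = 0.
Proof.
move=> ac du h0; apply/eqP/negPn/negP => fk.
have sX := chart_surface himm ac.
have [V1 [oV1 V1u V1d h1]] := smooth_neq0_nbhd (dom_open ac) du (mean_curvature_section sX).1 h0.
have s1 := local_surface_sub oV1 V1d sX.
have [V2 [oV2 V2u V21 f2]] :=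
  smooth_neq0_nbhd (W := R^o) oV1 V1u (smooth_sd k (smooth_mean_norm s1 h1)) fk.
have V2d := subset_trans V21 V1d.
have s2 := local_surface_sub oV2 V2d sX.
have h2 x (Vx : V2 x) := h1 x (V21 x Vx).
have b2 x (Vx : V2 x) := hbih ac (V2d x Vx).
(* otherwise h = f g on V2, and f would be critical there *)
have [v [i [j [V2v tv]]]] : exists v i j, V2 v /\ tls eps (X c) i j v != 0.
  apply: contrapT => H; have := f2 u V2u; rewrite (umbilical_const s2 h2 _ b2 k V2u) ?eqxx//.
  move=> x i j Vx; apply/eqP; rewrite -subr_eq0; apply/negPn/negP => t0.
  by apply: H; exists x, i, j.
have [V3 [oV3 V3v V32 t3]] := smooth_neq0_nbhd (W := R^o) oV2 V2v (smooth_tls s2 h2 i j) tv.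
have V3d := subset_trans V32 V2d.
have s3 := local_surface_sub oV3 V3d sX.
have h3 x (Vx : V3 x) := h2 x (V32 x Vx).
(* otherwise e3 is parallel on V3, against the curvature condition *)
have [w [l [V3w ww]]] : exists w l, V3 w /\ perp_e3 eps (X c) l w != 0.
  apply: contrapT => H; have := hcurv ac (V3d v V3v); rewrite mean_normE => /eqP; apply.
  apply: (par_curvature s3 h3 _ V3v (b2 v V2v) (f2 v V2v)) => x l Vx.
  by apply/eqP/negPn/negP => w0; apply: H; exists x, l.
have [V4 [oV4 V4w V43 w4]] := smooth_neq0_nbhd oV3 V3w (smooth_perp_e3 s3 h3 l) ww.
have /nbhs_ballP [d d0 Bd] : nbhs w V4 by exact: open_nbhs_nbhs.
have Vd : ball w d `<=` dom c by move=> x /Bd /V43 /V3d.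
apply: (generic_not_biharmonic himm hW hflat hcurv hbih ac d0 Vd hP) => x /Bd Vx.
- by apply: h3; exact: V43.
- by exists k; apply: f2; apply: V32; exact: V43.
- by exists i, j; rewrite -subr_eq0; apply: t3; exact: V43.
- by exists l; exact: w4.
Qed.

Lemma mean_norm_eq0 c u : atlas c -> dom c u ->
  mean_norm eps (X c) u = 0 -> mean_vec eps (X c) u = 0.
Proof.
move=> ac du; rewrite -mean_normE /fmc dotE mean_vecE => f0; apply/eqP/negPn/negP => h0.
have sX := chart_surface himm ac.
have := normal_pos sX du ((mean_curvature_section sX).2 u du) h0.
by rewrite -sqrtr_gt0 f0 ltxx.
Qed.

Lemma mean_norm_locally_constant c u : atlas c -> dom c u -> mean_vec eps (X c) u != 0 ->
  exists V, [/\ open V, V u, V `<=` dom c &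
    forall x, V x -> mean_norm eps (X c) x = mean_norm eps (X c) u].
Proof.
move=> ac du h0; have sX := chart_surface himm ac.
have [V [oV Vu Vd hV]] := smooth_neq0_nbhd (dom_open ac) du (mean_curvature_section sX).1 h0.
have sV := local_surface_sub oV Vd sX.
have [d d0 Bd] := open_ball_sub oV Vu.
exists (ball u d); split; [exact: ball_open | exact: ballxx | |].
  by move=> x; rewrite -ball_normE /= distrC => /Bd /Vd.
move=> x; rewrite -ball_normE /= distrC; apply: (ball_constant d0).
  by move=> p /Bd; exact: smooth_diff (smooth_mean_norm sV hV).
move=> p i /Bd Vp; rewrite ptsdE; apply: mean_norm_critical => //; [exact: Vd | exact: hV].
Qed.

(** Unlike [|H|] itself, its square is smooth at the zeros of [H]. *)
Lemma smooth_mean_norm_sqr c : atlas c ->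
  smooth_on (V := R^o) (dom c) (fun u => mean_norm eps (X c) u * mean_norm eps (X c) u).
Proof.
move=> ac; have sX := chart_surface himm ac.
have nH := mean_curvature_section sX.
apply: (smooth_eq (dom_open ac) (V := R^o)
  (F := fun u => dot eps (mean_vec eps (X c) u) (mean_vec eps (X c) u))); last first.
  by apply: smooth_ip => //; [exact: dom_open| |]; exact: nH.1.
move=> u du; rewrite -mean_normE /fmc dotE mean_vecE -expr2 sqr_sqrtr//.
have [->|h0] := eqVneq (mean_vec eps (X c) u) 0; first by rewrite ip0l.
exact: ltW (normal_pos sX du (nH.2 u du) h0).
Qed.

(** The set where [f] takes the value [f0 > 0] is open by [mean_norm_locally_constant] and
    closed by continuity of [f^2]. *)
Lemma mean_norm_constant c u c' u' : atlas c -> atlas c' -> dom c u -> dom c' u' ->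
  mean_vec eps (X c) u != 0 -> mean_norm eps (X c') u' = mean_norm eps (X c) u.
Proof.
move=> ac ac' du du' h0; set f0 := mean_norm eps (X c) u.
have f00 : f0 != 0 by apply: contra_neq h0; exact: mean_norm_eq0.
pose Q c u := mean_norm eps (X c) u = f0.
apply: (@chart_clopen R M Q _ _ c u c' u') => //.
  move=> c1 c2 x y ac1 ac2 dx dy e; rewrite /Q -!mean_normE /fmc !mean_vecE.
  by rewrite (mean_curvature_chart himm ac1 ac2 dx dy e).
move=> c1 x ac1 dx; rewrite /Q.
have [fx|fx] := eqVneq (mean_norm eps (X c1) x) f0.
  have h1 : mean_vec eps (X c1) x != 0.
    have := f00; rewrite -fx; apply: contra_neq => h1.
    by rewrite -mean_normE /fmc dotE mean_vecE h1 ip0l sqrtr0.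
  have [V [oV Vx Vd E]] := mean_norm_locally_constant ac1 dx h1.
  by exists V; split => // y /E ->; rewrite fx.
have f0_ge0 : 0 <= f0 by rewrite /f0 -mean_normE sqrtr_ge0.
have fge0 y : 0 <= mean_norm eps (X c1) y by rewrite -mean_normE sqrtr_ge0.
pose F y : R^o := mean_norm eps (X c1) y * mean_norm eps (X c1) y - f0 * f0.
have sF : smooth_on (dom c1) F.
  by apply: smoothB; [exact: dom_open | exact: smooth_mean_norm_sqr | exact: smooth_cst].
have F0 y : F y != 0 <-> mean_norm eps (X c1) y != f0.
  rewrite /F subr_eq0 -!expr2; split; apply: contra_neq; first by move->.
  by move=> /eqP; rewrite eqrXn2// => /eqP.
have [V [oV Vx Vd FV]] := smooth_neq0_nbhd (dom_open ac1) dx sF ((F0 x).2 fx).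
exists V; split => // y /FV /F0 /eqP fy; split=> // E.
by move/eqP: fx.
Qed.

End MeanConstant.

(** * The small hypersphere *)

Section SmallHypersphere.
Variables (R : realType) (eps : R).
Variables (U : set 'rV[R]_2) (X : 'rV[R]_2 -> 'rV[R]_5).
Hypothesis sX : local_surface eps U X.
Hypothesis e0 : 0 < eps.
Local Notation ip := (dot eps).
Local Notation hv := (mean_vec eps X).
Local Notation gm := (fff eps X).
Local Notation Bv := (sff eps X).
Implicit Types (u : 'rV[R]_2) (i j : 'I_2).

(** If [dH = - eps dX], this combination of [H] and [X] is constant. *)
Definition center u : 'rV[R]_5 := (2 * eps)^-1 *: (hv u + eps *: X u).

Let oU := surf_open sX.
Let nH := mean_curvature_section sX.
Let en := lt0r_neq0 e0.

Lemma mean_sphere_ip u : U u -> ip (hv u) (X u) = 0.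
Proof.
move=> Uu; have := normalX (nH.2 u Uu) => /eqP.
by rewrite mulf_eq0 (negbTE en) => /eqP.
Qed.

Lemma center_partial i u : U u -> pt i hv u = - eps *: pt i X u ->
  has_partial i center u 0.
Proof.
move=> Uu hE; have H := has_partialD (smooth_has_partial i nH.1 Uu)
  (has_partialZ (has_partial_cst i (eps : R^o) u) (surf_partial sX i Uu)).
have H2 := has_partialZ (has_partial_cst i ((2 * eps)^-1 : R^o) u) H.
by apply: has_partial_eq H2 _; rewrite hE !scale0r !add0r scaleNr addNr scaler0.
Qed.

Lemma center_locally_constant u :
  (forall i x, U x -> pt i hv x = - eps *: pt i X x) -> U u ->
  exists V, [/\ open V, V u, V `<=` U & forall x, V x -> center x = center u].
Proof.
move=> hE Uu; have [d d0 Bd] := open_ball_sub oU Uu.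
exists (ball u d); split; [exact: ball_open | exact: ballxx | |].
  by move=> x; rewrite -ball_normE /= distrC => /Bd.
move=> x; rewrite -ball_normE /= distrC => xd; apply/rowP => j.
have C i p (Up : U p) := (has_partial_coordP _ _ _ _).1 (center_partial Up (hE i p Up)) j.
apply: (ball_constant d0 (F := fun p => center p 0 j)) xd => [p /Bd Up|p i /Bd Up].
  exact: (C 0 p Up).1.
by rewrite (C i p Up).2 mxE.
Qed.

Section Center.
Variables (u : 'rV[R]_2) (a : 'rV[R]_5).
Hypotheses (Uu : U u) (ca : center u = a) (hh1 : ip (hv u) (hv u) = eps).

Let XX : ip (X u) (X u) = eps^-1.
Proof. by rewrite -[LHS]mul1r -(mulVf en) -mulrA (surf_sphere sX en Uu) mulr1. Qed.

Let hX := mean_sphere_ip Uu.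

Let aE : a = (2 * eps)^-1 *: hv u + 2^-1 *: X u.
Proof. by rewrite -ca /center scalerDr scalerA; congr (_ + _ *: _); field. Qed.

Let XaE : X u - a = 2^-1 *: X u - (2 * eps)^-1 *: hv u.
Proof.
rewrite aE opprD addrCA addrC; congr (_ - _).
by rewrite -{1}[X u]scale1r -scalerBl; congr (_ *: _); field.
Qed.

Lemma center_sqr : ip a a = eps^-1 - (2 * eps)^-1.
Proof.
rewrite aE !(ipDl, ipDr, ipZl, ipZr) (ipC _ (X u) (hv u)) hX hh1 XX; field; exact: en.
Qed.

Lemma hypersphere_center : hypersphere eps (2 * eps) a (X u).
Proof.
rewrite /hypersphere /= !dotE XaE aE; split.
  rewrite !(ipDl, ipDr, ipZl, ipZr, ipNl, ipNr) (ipC _ (X u) (hv u)) hX hh1 XX.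
  by field; exact: en.
rewrite !(ipDl, ipDr, ipZl, ipZr, ipNl, ipNr) (ipC _ (X u) (hv u)) hX hh1 XX.
by field; exact: en.
Qed.

Hypothesis um : forall i j, ip (Bv i j u) (hv u) = eps * gm i j u.

(** The normal [X - a] of the small sphere within the affine hyperplane is [(X - H / eps) / 2].
    Pairing the Hessian of [X] with it gives [- g], and pairing it with [a] gives zero. *)
Lemma hypersphere_second_ff i j :
  second_ff eps (hypersphere_proj eps (2 * eps) a) X i j u = Bv i j u - gm i j u *: hv u.
Proof.
rewrite /second_ff /nabla ptE ptfE.
rewrite (eq_bigr (fun k => chr eps X k i j u *: pt k X u)) => [|k _]; last by rewrite chrE ptE.
rewrite /hypersphere_proj !dotE (hessE sX i j Uu).
set S := \sum_k _.
have Dh k : ip (pt k X u) (hv u) = 0 by rewrite ipC (nH.2 u Uu).2.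
have DX k : ip (pt k X u) (X u) = 0.
  by have /eqP := surf_tangentE sX k Uu; rewrite mulf_eq0 (negbTE en) => /eqP.
have Sh : ip S (hv u) = 0 by rewrite /S ip_suml big1// => k _; rewrite ipZl Dh mulr0.
have SX : ip S (X u) = 0 by rewrite /S ip_suml big1// => k _; rewrite ipZl DX mulr0.
have BX : ip (Bv i j u) (X u) = 0.
  have /eqP := normalX (second_ff_normal sX i j Uu).
  by rewrite mulf_eq0 (negbTE en) => /eqP.
clearbody S.
have E1 : 2 * eps * ip (S + Bv i j u - (eps * gm i j u) *: X u) (X u - a) = - (2 * eps * gm i j u).
  rewrite XaE !(ipDl, ipDr, ipZl, ipZr, ipNl, ipNr) (ipC _ (X u) (hv u)) hX XX Sh SX BX um.
  by gen_gm => g; field; exact: en.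
have E2 : ip (S + Bv i j u - (eps * gm i j u) *: X u) a = 0.
  rewrite aE !(ipDl, ipDr, ipZl, ipZr, ipNl, ipNr) (ipC _ (X u) (hv u)) hX XX Sh SX BX um.
  by gen_gm => g; field; exact: en.
rewrite E1 E2 mul0r scale0r subr0 XaE scaleNr opprK scalerBr !scalerA.
have -> : 2 * eps * gm i j u * 2^-1 = eps * gm i j u by gen_gm => g; field.
have -> : 2 * eps * gm i j u * (2 * eps)^-1 = gm i j u by gen_gm => g; field; exact: en.
by apply/rowP => k; rewrite !mxE; gen_gm => g; ring.
Qed.

Lemma hypersphere_minimal : mean_curvature eps (hypersphere_proj eps (2 * eps) a) X u = 0.
Proof.
rewrite /mean_curvature /tension.
have T : \sum_i \sum_j ginv eps X u i j *: second_ff eps (spaceform_proj eps) X i j u = 2 *: hv u.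
  rewrite -mean_vecE /mcv /mean_curvature /tension scalerA mulfV ?scale1r//; lra.
have G : \sum_i \sum_j ginv eps X u i j * gm i j u = 2.
  rewrite !sum2 !gupE; have [-> -> -> ->] := ginvE sX Uu; rewrite (gmC eps X 1 0).
  transitivity (2 * (inv_gdet eps X u * gdet eps X u)); last by rewrite (inv_gdetK sX Uu) mulr1.
  by rewrite /gdet; gen_gm; move: (inv_gdet _ _ _) => *; ring.
transitivity (2^-1 *: (2 *: hv u - 2 *: hv u)); last by rewrite subrr scaler0.
congr (_ *: _); rewrite -[X in _ = X - _]T -[X in _ = _ - X *: _]G
  scaler_suml -sumrB; apply: eq_bigr => i _.
rewrite scaler_suml -sumrB; apply: eq_bigr => j _.
by rewrite hypersphere_second_ff sffE scalerBr scalerA.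
Qed.

End Center.
End SmallHypersphere.

Theorem theorem5p1 (R : realType) (hP : statement_P R)
    (eps : R) (M : surface R) (phi : M -> 'rV[R]_5)
    (himm : immersion eps phi)
    (hbih : proper_biharmonic eps phi)
    (hW : W_surface eps phi)
    (hflat : flat_normal_bundle eps phi)
    (hcurv : curvature_condition eps phi) :
  0 < eps /\
  exists a : 'rV[R]_5,
    ip eps a a = eps^-1 - (2 * eps)^-1 /\
    minimal_in_hypersphere eps phi (2 * eps) a.
Proof.
have [bih nmin] := hbih.
have [c0 [u0 [ac0 du0 h0]]] : 
    exists c u, [/\ atlas c, dom c u & mean_vec eps (phi \o par c) u != 0].
  apply: contrapT => H; apply: nmin => c ac u du; rewrite mean_vecE.
  by apply/eqP/negPn/negP => h; apply: H; exists c, u.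
set f0 := mean_norm eps (phi \o par c0) u0.
have f_eq c u : atlas c -> dom c u -> mean_norm eps (phi \o par c) u = f0.
  by move=> ac du; exact: (mean_norm_constant hP himm hW hflat hcurv bih ac0 ac du0 du h0).
have f00 : f0 != 0 by apply: contra_neq h0; exact: (mean_norm_eq0 himm ac0 du0).
have Hn c u : atlas c -> dom c u -> mean_vec eps (phi \o par c) u != 0.
  move=> ac du; have := f00; rewrite -(f_eq c u ac du); apply: contra_neq => h1.
  by rewrite -mean_normE /fmc dotE mean_vecE h1 ip0l sqrtr0.
have sX c (ac : atlas c) := chart_surface himm ac.
have e0 : 0 < eps.
  exact: (cmc_eps_gt0 (sX c0 ac0) (fun x => Hn c0 x ac0) (bih c0 ac0)
    (fun x => f_eq c0 x ac0) du0).
have hh1 c u : atlas c -> dom c u ->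
    dot eps (mean_vec eps (phi \o par c) u) (mean_vec eps (phi \o par c) u) = eps.
  move=> ac du; rewrite -(mean_norm_sqr (sX c ac) (fun x => Hn c x ac) du) f_eq// -expr2.
  exact: (cmc_mean_sqr (sX c ac) (fun x => Hn c x ac) (bih c ac) (fun x => f_eq c x ac) du).
pose a := center eps (phi \o par c0) u0.
have aE c u : atlas c -> dom c u -> center eps (phi \o par c) u = a.
  move=> ac du; pose Q c u := center eps (phi \o par c) u = a.
  apply: (@chart_clopen R M Q _ _ c0 u0 c u) => //.
    move=> c1 c2 x y ac1 ac2 dx dy e; rewrite /Q /center.
    by rewrite (mean_curvature_chart himm ac1 ac2 dx dy e) /= e.
  move=> c1 x ac1 dx.
  (* dH = - eps dX on the whole chart *)
  have [|V [oV Vx Vd E]] := center_locally_constant (sX c1 ac1) _ dx.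
    move=> i y dy; exact: (cmc_hv_partial (sX c1 ac1) (fun x => Hn c1 x ac1) (bih c1 ac1)
      (fun x => f_eq c1 x ac1) i dy).
  by exists V; split => // y /E; rewrite /Q => ->.
have um c u (ac : atlas c) (du : dom c u) i j :
    dot eps (sff eps (phi \o par c) i j u) (mean_vec eps (phi \o par c) u) =
    eps * fff eps (phi \o par c) i j u.
  have sc := sX c ac; have Hc x := Hn c x ac.
  rewrite {1}(hv_e3 sc Hc du) ipZr -/(sff3 eps _ i j u).
  rewrite (cmc_umbilical sc Hc (bih c ac) (fun x => f_eq c x ac) i j du) mulrA.
  by rewrite (mean_norm_sqr sc Hc du) hh1.
split => //; exists a; split.
  by rewrite dotE; exact: (center_sqr (sX c0 ac0) e0 du0 (aE c0 u0 ac0 du0) (hh1 c0 u0 ac0 du0)).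
split=> [p|c ac u du].
  have [c ac [u du <-]] := atlas_cover p.
  exact: (hypersphere_center (sX c ac) e0 du (aE c u ac du) (hh1 c u ac du)).
exact: (hypersphere_minimal (sX c ac) e0 du (aE c u ac du) (um c u ac du)).
Qed.
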